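(* Let $\zeta=(\xi,\zeta_{\mathbb C})$ be generic, and let $\omega\in\mathcal W$, $a$, $\mathbf v,\mathbf w$ satisfy $-a\omega(\zeta)=\zeta$, $a(\mathbf w)=\mathbf w$, $a(\omega*\mathbf v)=\mathbf v$. Let $\sigma=aS_\omega\tau_\zeta$ and $\mathfrak S_\zeta(\mathbf v,\mathbf w)=\mathfrak M_\zeta(\mathbf v,\mathbf w)^\sigma$. Let $\mathcal W^{\omega,a}=\{x\in\mathcal W: x\omega=\omega x,\ a(x)=x\}$. Then for every $x\in\mathcal W^{\omega,a}$ the reflection functor $S_x:\mathfrak M_\zeta(\mathbf v,\mathbf w)\to\mathfrak M_{x(\zeta)}(x*\mathbf v,\mathbf w)$ restricts to a map $$S_x^\sigma:\ \mathfrak S_\zeta(\mathbf v,\mathbf w)\longrightarrow\mathfrak S_{x(\zeta)}(x*\mathbf v,\mathbf w),$$ and these maps define an action of $\mathcal W^{\omega,a}$ on $\sigma$-quiver varieties.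
   Context: **Nakajima varieties.** $\Gamma$ is a finite graph without loops with vertex set $I$ and set $H$ of oriented edges (source $o(h)$, target $i(h)$, reversal $\bar h$); $\varepsilon:H\to\{\pm1\}$ with $\varepsilon(h)+\varepsilon(\bar h)=0$; Cartan matrix $c_{ij}=2\delta_{ij}-\#\{h:o(h)=i,i(h)=j\}$. For $I$-graded complex spaces $V,W$ of dimensions $\mathbf v,\mathbf w$, points are $\mathbf x=(x_h:V_{o(h)}\to V_{i(h)},\ p_i:W_i\to V_i,\ q_i:V_i\to W_i)$; $\mu_i(\mathbf x)=\sum_{i(h)=i}\varepsilon(h)x_hx_{\bar h}-p_iq_i$; $\Lambda_{\zeta_{\mathbb C}}=\{\mu_i=\zeta^{(i)}_{\mathbb C}\mathrm{id}\ \forall i\}$. $\mathbf x$ is $\xi$-semistable if $\xi\cdot\dim S\le0$ for all $x$-stable graded $S\subseteq\ker q$ and $\xi\cdot\dim T\le\xi\cdot\mathbf v$ for all $x$-stable $T\supseteq\operatorname{im}p$. $\mathfrak M_\zeta(\mathbf v,\mathbf w)$ is the GIT quotient of the semistable locus of $\Lambda_{\zeta_{\mathbb C}}$ by $G_{\mathbf v}=\prod GL(V_i)$. $\zeta$ is generic if $\xi$ or $\zeta_{\mathbb C}$ lies on no hyperplane $\{u:u\cdot\gamma=0\}$ with $0\ne\gamma\in\mathbb N^I$, ${}^t\gamma C\gamma\le2$, $\gamma\le\mathbf v$. **Reflection functors** (for $\zeta$ generic). The Weyl group $\mathcal W$ is generated by $s_i$, $s_i(\xi)_j=\xi_j-c_{ji}\xi_i$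 (same formula on $\mathbb C^I$); $(s_i*\mathbf v)_i=\mathbf v_i-\sum_jc_{ij}\mathbf v_j+\mathbf w_i$, other entries unchanged. If $\xi_i<0$ or $\zeta_{\mathbb C}^{(i)}\ne0$, $S_i:\mathfrak M_\zeta(\mathbf v,\mathbf w)\to\mathfrak M_{s_i\zeta}(s_i*\mathbf v,\mathbf w)$ sends $[\mathbf x]$ to $[\mathbf x']$, where $V'_j=V_j$ for $j\ne i$, components not touching $i$ agree, $0\to V'_i\xrightarrow{a_i(\mathbf x')}U_i\xrightarrow{b_i(\mathbf x)}V_i\to0$ is exact, $a_i(\mathbf x)b_i(\mathbf x)-a_i(\mathbf x')b_i(\mathbf x')=s_i(\zeta_{\mathbb C})^{(i)}$, and the moment map equations with parameters $\zeta_{\mathbb C}$, $s_i\zeta_{\mathbb C}$ hold for $\mathbf x,\mathbf x'$ at vertices $j\ne i$; here $U_i=W_i\oplus\bigoplus_{o(h)=i}V_{i(h)}$, $a_i(\mathbf x)=(q_i,x_h)_{o(h)=i}$, $b_i(\mathbf x)=(p_i,\varepsilon(\bar h)x_h)_{i(h)=i}$. If $\xi_i>0$ use the inverse of this map for $s_i\zeta$. For $x=s_{i_1}\cdots s_{i_l}\in\mathcal W$, $S_x=S_{i_1}\cdots S_{i_l}$; it is known that $S_{x'}S_x=S_{x'x}$. **Transpose.** $V,W$ carry nondegenerate bilinear forms on each graded piece (different pieces orthogonal). $T^*$ is the right adjoint, $(Te,e')=(e,T^*e')$. $\tau_\zeta:\mathfrak M_\zeta(\mathbf v,\mathbf w)\to\mathfrak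 M_{-\zeta}(\mathbf v,\mathbf w)$ is induced by $(x_h,p_i,q_i)\mapsto(\varepsilon(h)x^*_{\bar h},-q_i^*,p_i^* )$ and does not depend on the form on $V$. **Diagram isomorphism.** $a$ is an automorphism of $\Gamma$ (compatible with $o,i,\bar{\ }$) with $\varepsilon(a(h))=c\,\varepsilon(h)$ for a constant $c=\pm1$; it acts on $\mathcal W$ by $s_i\mapsto s_{a(i)}$; $a(V)_i=V_{a^{-1}(i)}$, $a(\mathbf v)_i=\mathbf v_{a^{-1}(i)}$, likewise for $\zeta$. It induces $\mathfrak M_\zeta(\mathbf v,\mathbf w)\to\mathfrak M_{a\zeta}(a\mathbf v,a\mathbf w)$ with $a(x)_h=\varepsilon(h)^{(1-c)/2}x_{a^{-1}(h)}$, $a(p)_i=p_{a^{-1}(i)}$, $a(q)_i=q_{a^{-1}(i)}$. When $a(\mathbf w)=\mathbf w$ one identifies $W_i$ with $W_{a(i)}$, so $a(W)=W$.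
   Formalization: Stated for those x for which S_x is defined: some expression of x never applies an S_i where ξ_i=0 and ζ_C^(i)=0. Genericity, which only involves γ ≤ v, does not ensure this (e.g. v=0, ζ=0, ω=1, a=1, x=s_i). *)

(* Defs.v *)
From HB Require Import structures.
From Stdlib Require Import Relation_Operators.
From mathcomp Require Import all_boot all_order all_algebra all_fingroup.
From mathcomp Require Import complex.
From mathcomp Require Import boolp classical_sets reals.

Set Implicit Arguments.
Unset Strict Implicit.
Unset Printing Implicit Defensive.

Import Order.TTheory GRing.Theory Num.Theory.
Local Open Scope ring_scope.

(* The ground field is the field R[i] of complex numbers, R : realType. *)

(* [arr i j] is the set of oriented edges h with o(h) = i and i(h) = j, so that
   the set H of all oriented edges is the disjoint union of the [arr i j]. *)
Record dgraph := DGraph {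
  vtx : finType;
  arr : vtx -> vtx -> finType;
  rv : forall i j, arr i j -> arr j i;
  rvK : forall i j (h : arr i j), rv (rv h) = h;
  arr_irr : forall i, arr i i -> False;
  eps : forall i j, arr i j -> int;
  eps_sign : forall i j (h : arr i j), eps h = 1 \/ eps h = -1;
  eps_rv : forall i j (h : arr i j), eps h + eps (rv h) = 0
}.
Arguments rv {d i j} h.
Arguments eps {d i j} h.

Definition cartan (G : dgraph) (i j : vtx G) : int :=
  2 * (i == j)%:R - #|arr i j|%:R.

(* The constant c of the automorphism is (-1) ^+ [dsgn].  On edges we record the
   action [dhV] of the inverse automorphism, whose type then matches
   a(V)_i = V_(a^-1 i) on the nose. *)
Record diag_aut (G : dgraph) := DiagAut {
  dvtx : {perm vtx G};
  dhV : forall i j : vtx G, arr i j -> arr ((dvtx^-1)%g i) ((dvtx^-1)%g j);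
  dhV_bij : forall i j, bijective (@dhV i j);
  dhV_rv : forall i j (h : arr i j), dhV (rv h) = rv (dhV h);
  dsgn : bool;
  eps_dhV : forall i j (h : arr i j), eps h = (-1) ^+ dsgn * eps (dhV h)
}.
Arguments dhV {G} d {i j} h.

Definition dvtxV (G : dgraph) (a : diag_aut G) (i : vtx G) : vtx G :=
  ((dvtx a)^-1)%g i.

Definition atwist (G : dgraph) (a : diag_aut G) (A : Type) (u : vtx G -> A) :
  vtx G -> A := fun i => u (dvtxV a i).

Definition srefl (G : dgraph) (A : zmodType) (i : vtx G) (u : vtx G -> A) :
  vtx G -> A := fun j => u j - u i *~ cartan j i.

(* An element s_(i_1) ... s_(i_l) of the Weyl group is given by a word
   [:: i_1; ...; i_l]; two words are the same element when [weyl_eq] holds. *)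
Definition wact (G : dgraph) (A : zmodType) (r : seq (vtx G)) (u : vtx G -> A) :
  vtx G -> A := foldr (@srefl G A) u r.

Definition weyl_eq (G : dgraph) (r r' : seq (vtx G)) : Prop :=
  forall u : vtx G -> int, wact r u = wact r' u.

(* x omega = omega x and a(x) = x, where a(s_i) = s_(a i). *)
Definition in_weyl_omega_a (G : dgraph) (a : diag_aut G) (omega x : seq (vtx G)) :
  Prop :=
  weyl_eq (x ++ omega) (omega ++ x) /\ weyl_eq (map (dvtx a) x) x.

(* Dimension vectors of V are integral because s_i * v may have a negative entry;
   the corresponding varieties are empty (see [sslocus]). *)
Definition star1 (G : dgraph) (w : vtx G -> nat) (i : vtx G) (v : vtx G -> int) :
  vtx G -> int :=
  fun j => if j == i then v i - \sum_k cartan i k * v k + (w i)%:Z else v j.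

Definition star (G : dgraph) (w : vtx G -> nat) (r : seq (vtx G))
  (v : vtx G -> int) : vtx G -> int := foldr (star1 w) v r.

Lemma arr_neq (G : dgraph) (i j : vtx G) (h : arr i j) : j != i.
Proof. by apply/eqP => ji; move: h; rewrite ji; exact: arr_irr. Qed.

Lemma dim_star1 (G : dgraph) (w : vtx G -> nat) (i : vtx G) (v : vtx G -> int)
  (j : vtx G) : j != i -> `|v j|%N = `|star1 w i v j|%N.
Proof. by rewrite /star1 => /negbTE->. Qed.

(* The real part xi may be any real vector; characters of G_v are the integral
   ones. *)
Definition param (R : realType) (G : dgraph) : Type :=
  ((vtx G -> R) * (vtx G -> R[i]))%type.

Section Param.
Variables (R : realType) (G : dgraph).
Implicit Types (zeta : param R G) (v : vtx G -> int).

Definition popp zeta : param R G :=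
  ((fun i => - zeta.1 i), (fun i => - zeta.2 i)).
Definition pact (r : seq (vtx G)) zeta : param R G :=
  (wact r zeta.1, wact r zeta.2).
Definition ptwist (a : diag_aut G) zeta : param R G :=
  (atwist a zeta.1, atwist a zeta.2).

Definition bounded_root v (gamma : vtx G -> nat) : Prop :=
  [/\ exists i, gamma i != 0%N,
      \sum_i \sum_j (gamma i)%:Z * cartan i j * (gamma j)%:Z <= 2
    & forall i, (gamma i)%:Z <= v i].

Definition generic zeta v : Prop :=
  (forall gamma, bounded_root v gamma -> \sum_i zeta.1 i *+ gamma i != 0) \/
  (forall gamma, bounded_root v gamma -> \sum_i zeta.2 i *+ gamma i != 0).

End Param.

Section Quiver.
Variables (R : realType) (G : dgraph) (w : vtx G -> nat).
Local Notation I := (vtx G).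
Local Notation C := (R[i]).
Implicit Types (v : I -> int) (zeta : param R G).

(* V_i = C^(v_i), W_i = C^(w_i); linear maps act on column vectors from the left,
   so a map C^m -> C^n is a matrix in 'M_(n, m). *)
Record rep v := Rep {
  rx : forall i j : I, arr i j -> 'M[C]_(`|v j|, `|v i|);
  rp : forall i : I, 'M[C]_(`|v i|, w i);
  rq : forall i : I, 'M[C]_(w i, `|v i|)
}.

Section FixedDim.
Variable v : I -> int.
Implicit Types (x y z : rep v).

Definition mu x (i : I) : 'M[C]_(`|v i|) :=
  \sum_(j : I) \sum_(h : arr j i) (eps h)%:~R *: (rx x h *m rx x (rv h))
  - rp x i *m rq x i.

Definition in_Lambda (zc : I -> C) x : Prop := forall i, mu x i = (zc i)%:M.

Definition gsub : Type := forall i : I, {vspace 'cV[C]_(`|v i|)}.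

Definition stable x (S : gsub) : Prop :=
  forall (i j : I) (h : arr i j) u, u \in S i -> rx x h *m u \in S j.

Definition semistable (xi : I -> R) x : Prop :=
  (forall S : gsub, stable x S ->
     (forall i u, u \in S i -> rq x i *m u = 0) ->
     \sum_i xi i *+ \dim (S i) <= 0) /\
  (forall T : gsub, stable x T ->
     (forall i (u : 'cV[C]_(w i)), rp x i *m u \in T i) ->
     \sum_i xi i *+ \dim (T i) <= \sum_i xi i *~ v i).

Definition sslocus zeta x : Prop :=
  [/\ forall i, 0 <= v i, in_Lambda zeta.2 x & semistable zeta.1 x].

Definition gact (g : forall i : I, 'M[C]_(`|v i|)) x : rep v :=
  @Rep v (fun i j h => g j *m rx x h *m invmx (g i))
         (fun i => g i *m rp x i)
         (fun i => rq x i *m invmx (g i)).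

Definition close (e : C) x y : Prop :=
  [/\ forall (i j : I) (h : arr i j) k l, `|rx x h k l - rx y h k l| < e,
      forall i k l, `|rp x i k l - rp y i k l| < e
    & forall i k l, `|rq x i k l - rq y i k l| < e].

(* z lies in the closure of the G_v-orbit of x (orbits being constructible, the
   Zariski and the classical closure coincide). *)
Definition orbit_closure x z : Prop :=
  forall e : C, 0 < e ->
    exists2 g, (forall i, g i \in unitmx) & close e (gact g x) z.

(* The points of the GIT quotient are the semistable points modulo: x ~ y when
   the closures of their orbits meet inside the semistable locus.  That this
   relation is transitive is a theorem on reductive groups; taking the equivalence
   relation it generates gives the same classes without appealing to it. *)
Definition closures_meet zeta x y : Prop :=
  [/\ sslocus zeta x, sslocus zeta y
    & exists z, [/\ sslocus zeta z, orbit_closure x z & orbit_closure y z]].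

Definition git_eq zeta : rep v -> rep v -> Prop :=
  clos_refl_sym_trans (rep v) (closures_meet zeta).

End FixedDim.

(* A point of a quiver variety, of unspecified dimension vector, is an equivalence
   class of representations. *)
Record qpoint := QPoint { qdim : I -> int; qclass : set (rep qdim) }.

Definition cls zeta v (x : rep v) : qpoint :=
  QPoint [set y : rep v | git_eq zeta x y]%classic.

Definition quiver_variety zeta v : set qpoint :=
  [set P | exists2 x : rep v, sslocus zeta x & P = cls zeta x]%classic.

(* Maps between quiver varieties are given by their graphs. *)
Definition is_map (F : qpoint -> qpoint -> Prop) (A B : set qpoint) : Prop :=
  forall P, A P ->
    exists P', [/\ F P P', B P' & forall P'', F P P'' -> P'' = P'].

Section Reflection.
Variables (v : I -> int) (i : I).

(* Uspace = W_i (+) (sum over h with o(h) = i of V_(i(h))). *)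
Definition Uspace : Type :=
  ('cV[C]_(w i) * (forall j : I, arr i j -> 'cV[C]_(`|v j|)))%type.

Definition amap (x : rep v) (y : 'cV[C]_(`|v i|)) : Uspace :=
  (rq x i *m y, fun j h => rx x h *m y).

(* The component of b_i on the summand V_(i(h)), o(h) = i, of U_i is given by the
   edge rv h, with coefficient eps (rv (rv h)) = eps h. *)
Definition bmap (x : rep v) (u : Uspace) : 'cV[C]_(`|v i|) :=
  rp x i *m u.1
  + \sum_(j : I) \sum_(h : arr i j) (eps h)%:~R *: (rx x (rv h) *m u.2 j h).

End Reflection.

(* The identity V_j = V'_j, j != i, induces U_i = U'_i. *)
Definition Ucast v (i : I) (u : Uspace v i) : Uspace (star1 w i v) i :=
  (u.1, fun j h =>
          castmx (dim_star1 w v (arr_neq h), erefl 1%N) (u.2 j h)).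

(* c stands for s_i(zeta_C)^(i).  The three parts: x and x' agree away from i;
   0 -> V'_i -> U_i -> V_i -> 0 is exact; a_i(x) b_i(x) - a_i(x') b_i(x') = c. *)
Definition refl_rel v (i : I) (c : C) (x : rep v) (x' : rep (star1 w i v)) : Prop :=
  [/\ [/\ forall (j k : I) (h : arr j k) (hj : j != i) (hk : k != i),
            rx x' h = castmx (dim_star1 w v hk, dim_star1 w v hj) (rx x h),
          forall (j : I) (hj : j != i),
            rp x' j = castmx (dim_star1 w v hj, erefl (w j)) (rp x j)
        & forall (j : I) (hj : j != i),
            rq x' j = castmx (erefl (w j), dim_star1 w v hj) (rq x j)],
      [/\ injective (amap x' : _ -> Uspace (star1 w i v) i),
          forall u : Uspace v i,
            bmap x u = 0 <-> exists y, amap x' y = Ucast u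
        & forall y, exists u : Uspace v i, bmap x u = y]
    & forall u : Uspace v i,
        let ab := Ucast (amap x (bmap x u)) in
        let ab' := amap x' (bmap x' (Ucast u)) in
        ab.1 - ab'.1 = c *: (Ucast u).1 /\
        forall (j : I) (h : arr i j), ab.2 j h - ab'.2 j h = c *: (Ucast u).2 j h].

(* The moment map equations for x and x' are part of [sslocus]. *)
Definition refl_direct (i : I) zeta (P P' : qpoint) : Prop :=
  exists v (x : rep v) (x' : rep (star1 w i v)),
    [/\ sslocus zeta x /\ P = cls zeta x,
        sslocus (pact [:: i] zeta) x' /\ P' = cls (pact [:: i] zeta) x'
      & refl_rel ((pact [:: i] zeta).2 i) x x'].

Definition refl1 (i : I) zeta (P P' : qpoint) : Prop :=
  ((zeta.1 i < 0 \/ zeta.2 i != 0) /\ refl_direct i zeta P P') \/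
  (0 < zeta.1 i /\ refl_direct i (pact [:: i] zeta) P' P).

Fixpoint refl_word (r : seq I) zeta (P P' : qpoint) : Prop :=
  if r is i :: r' then
    exists2 Q, refl_word r' zeta P Q & refl1 i (pact r' zeta) Q P'
  else P' = P.

(* S_i is defined for the parameter zeta as soon as (zeta.1 i, zeta.2 i) != 0. *)
Fixpoint word_defined (r : seq I) zeta : Prop :=
  if r is i :: r' then
    word_defined r' zeta /\
    ((pact r' zeta).1 i != 0 \/ (pact r' zeta).2 i != 0)
  else True.

(* The functor S_x of a Weyl group element x is computed from any expression of x
   along which the successive functors S_i are defined. *)
Definition refl_functor (x : seq I) zeta (P P' : qpoint) : Prop :=
  exists2 r, weyl_eq r x & refl_word r zeta P P'.

Definition refl_defined (x : seq I) zeta : Prop :=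
  exists2 r, weyl_eq r x & word_defined r zeta.

(* The form (e, e') = e^T B e' on column vectors; [adjmx B1 B2 T] is the right
   adjoint of T : (C^m, B1) -> (C^n, B2). *)
Definition bform n (B : 'M[C]_n) (e e' : 'cV[C]_n) : C := (e^T *m B *m e') 0 0.

Definition adjmx m n (B1 : 'M[C]_m) (B2 : 'M[C]_n) (T : 'M[C]_(n, m)) :
  'M[C]_(m, n) := invmx B1 *m T^T *m B2.

Lemma adjmxP m n (B1 : 'M[C]_m) (B2 : 'M[C]_n) (T : 'M[C]_(n, m)) e e' :
  B1 \in unitmx -> bform B2 (T *m e) e' = bform B1 e (adjmx B1 B2 T *m e').
Proof. by move=> uB1; rewrite /bform /adjmx trmx_mul -!mulmxA mulKVmx. Qed.

Definition transpose v (A : forall i : I, 'M[C]_(`|v i|))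
    (B : forall i : I, 'M[C]_(w i)) (x : rep v) : rep v :=
  @Rep v (fun i j h => (eps h)%:~R *: adjmx (A j) (A i) (rx x (rv h)))
         (fun i => - adjmx (A i) (B i) (rq x i))
         (fun i => adjmx (B i) (A i) (rp x i)).

Definition tau (B : forall i : I, 'M[C]_(w i)) zeta (P P' : qpoint) : Prop :=
  exists v (x : rep v) (A : forall i : I, 'M[C]_(`|v i|)),
    [/\ forall i, A i \in unitmx,
        sslocus zeta x /\ P = cls zeta x
      & P' = cls (popp zeta) (transpose A B x)].

(* phi_i : W_i -> W_(a^-1 i), with inverse phiV_i, is the identification of
   a(W)_i = W_(a^-1 i) with W_i. *)
Definition rep_twist (a : diag_aut G)
    (phi : forall i : I, 'M[C]_(w (dvtxV a i), w i))
    (phiV : forall i : I, 'M[C]_(w i, w (dvtxV a i)))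
    v (x : rep v) : rep (atwist a v) :=
  @Rep (atwist a v)
    (fun i j h => (eps h)%:~R ^+ dsgn a *: rx x (dhV a h))
    (fun i => rp x (dvtxV a i) *m phi i)
    (fun i => phiV i *m rq x (dvtxV a i)).

Definition diag_iso (a : diag_aut G)
    (phi : forall i : I, 'M[C]_(w (dvtxV a i), w i))
    (phiV : forall i : I, 'M[C]_(w i, w (dvtxV a i)))
    zeta (P P' : qpoint) : Prop :=
  exists v (x : rep v),
    [/\ sslocus zeta x, P = cls zeta x
      & P' = cls (ptwist a zeta) (rep_twist phi phiV x)].

Definition sigma (a : diag_aut G) (omega : seq I)
    (B : forall i : I, 'M[C]_(w i))
    (phi : forall i : I, 'M[C]_(w (dvtxV a i), w i))
    (phiV : forall i : I, 'M[C]_(w i, w (dvtxV a i)))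
    zeta (P P' : qpoint) : Prop :=
  exists Q Q',
    [/\ tau B zeta P Q, refl_functor omega (popp zeta) Q Q'
      & diag_iso phi phiV (pact omega (popp zeta)) Q' P'].

Definition sigma_quiver_variety (a : diag_aut G) (omega : seq I)
    (B : forall i : I, 'M[C]_(w i))
    (phi : forall i : I, 'M[C]_(w (dvtxV a i), w i))
    (phiV : forall i : I, 'M[C]_(w i, w (dvtxV a i)))
    zeta v : set qpoint :=
  [set P | quiver_variety zeta v P /\ sigma omega B phi phiV zeta P P]%classic.

End Quiver.

(* Main.v *)
(* Up to isomorphism, S_i is a linear-algebra relation between representations.
   Since zeta is generic, every semistable representation is stable: a
   destabilizing subspace would carry an unframed representation, whose dimension
   gamma satisfies gamma C gamma <= 2 (Crawley-Boevey) and on which xi and zeta_C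
   vanish.  Hence the points of the quiver varieties are isomorphism classes, and
   the varieties along a word are computed by chains of local relations.

   That S_x does not depend on the word follows from Tits' solution of the word
   problem.  For a braid s_i s_j s_i = s_j s_i s_j, if all steps are direct then
   the result of either side is characterized by one relation, symmetric in i and
   j; the other signs of the parameter are reduced to that case by moving one
   arrow of the commuting hexagon at a time from one side to the other.

   Transposition and the diagram automorphism commute with the S_i.  If P is fixed
   by sigma, with r a word of omega from the transpose of P to a point whose twist
   is P, and rx a word of x, then a^-1(rx) r rx^-1 is a word of a^-1(x) omega x^-1
   = omega that leads from the transpose of S_x P to a point whose twist is S_x P. *)

Require Import Defs.
From Stdlib Require Import Relation_Operators.
From mathcomp Require Import all_boot all_order all_algebra all_fingroup.
From mathcomp Require Import complex.
From mathcomp Require Import boolp classical_sets reals.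
From mathcomp Require Import zify ring.

Set Implicit Arguments.
Unset Strict Implicit.
Unset Printing Implicit Defensive.

Import Order.TTheory GRing.Theory Num.Theory.
Local Open Scope ring_scope.

(** * The word problem in the Weyl group *)

(** Representations met along a word have dimension vectors that agree only after a proof. They are
    therefore compared by mutually inverse families of matrices between possibly different vectors
    ([riso]), and a reflection ([hrefl]) carries its own identification of the spaces away from i,
    so that chains compose without casts. Genericity is assumed for $\mathbf v$ alone and serves to
    obtain [Stab]; that property, not genericity, is then moved from one dimension vector to the
    next. The relation of S_i gives existence and uniqueness directly only under [dir]. The opposite
    sign of $\xi_i$ is reached by transposition: dualizing the exact sequence exchanges source and
    target and replaces $\zeta$ by $-\zeta$. Cancelling [i :: i] in a word keeps its steps defined,
    but inserting it may not. Hence the word problem is solved for a directed relation, and two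
    expressions of one element are compared at a common reduced word, along which the functor is
    defined as soon as it is along one of them. *)

Section Tits.
Variable G : dgraph.
Implicit Types (r : seq (vtx G)) (i j k : vtx G) (u : vtx G -> int).

Lemma cartanii i : cartan i i = 2.
Proof.
have e : #|arr i i| = 0%N by apply: eq_card0 => h; case: (arr_irr h).
by rewrite /cartan eqxx e subr0 mulr1.
Qed.

Lemma card_arrC i j : #|arr i j| = #|arr j i|.
Proof.
by apply: (@bij_eq_card _ _ (@rv G i j)); exists (@rv G j i); exact: rvK.
Qed.

Lemma cartanC i j : cartan i j = cartan j i.
Proof. by rewrite /cartan eq_sym card_arrC. Qed.

Lemma cartan_neq i j : i != j -> cartan i j = - (#|arr i j|%:Z).
Proof. by move=> /negbTE ij; rewrite /cartan ij mulr0 sub0r natz. Qed.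

Lemma srefl_same (A : zmodType) i (u : vtx G -> A) : srefl i u i = - u i.
Proof. rewrite /srefl cartanii; have -> : u i *~ 2 = u i + u i by rewrite -mulr2n.
by rewrite opprD addrA subrr sub0r. Qed.

Lemma srefl_neq (A : zmodType) i j (u : vtx G -> A) : i != j ->
  srefl i u j = u j + u i *+ #|arr i j|.
Proof.
by move=> ij; rewrite /srefl cartanC cartan_neq // mulrNz opprK.
Qed.

Lemma srefl_cartan0 (A : zmodType) i j (u : vtx G -> A) : i != j ->
  #|arr i j| = 0%N -> srefl i u j = u j.
Proof. by move=> ij e; rewrite srefl_neq // e addr0. Qed.

Lemma sreflK (A : zmodType) i (u : vtx G -> A) : srefl i (srefl i u) = u.
Proof.
apply: funext => j; rewrite {1}/srefl srefl_same /srefl.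
by rewrite mulNrz opprK subrK.
Qed.

Lemma srefl_comm (A : zmodType) i j (u : vtx G -> A) : i != j ->
  #|arr i j| = 0%N -> srefl i (srefl j u) = srefl j (srefl i u).
Proof.
move=> ij e; apply: funext => k; rewrite /srefl.
have e1 : cartan i j = 0 by rewrite cartan_neq // e.
by rewrite [cartan j i]cartanC e1 !mulr0z !subr0 addrAC.
Qed.

Lemma srefl_braid (A : zmodType) i j (u : vtx G -> A) : i != j ->
  #|arr i j| = 1%N ->
  srefl i (srefl j (srefl i u)) = srefl j (srefl i (srefl j u)).
Proof.
move=> ij e; have ji : j != i by rewrite eq_sym.
have e' : #|arr j i| = 1%N by rewrite card_arrC.
have E k l w : k != l -> #|arr k l| = 1%N -> srefl k (srefl l (srefl k u)) w =
    u w - u k *~ cartan w k - (u k + u l) *~ cartan w l - u l *~ cartan w k.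
  move=> kl ekl; rewrite {1}/srefl.
  have -> : srefl l (srefl k u) k = u l.
    rewrite srefl_neq 1?eq_sym // card_arrC ekl mulr1n srefl_same srefl_neq //.
    by rewrite ekl mulr1n [u l + _]addrC addKr.
  rewrite {1}/srefl.
  have -> : srefl k u l = u k + u l by rewrite srefl_neq // ekl mulr1n addrC.
  by [].
apply: funext => k; rewrite !E // [u j + u i]addrC !mulrzDl -!addrA -!opprD.
congr (_ - _); rewrite [X in _ = X]addrC -!addrA.
by rewrite [X in _ + X = _]addrCA; congr (_ + _); rewrite addrC -!addrA addrCA.
Qed.

(** Cancellation of [i :: i] is left out, so the length is preserved. Orders 2 and 3 are the only
    ones to record: with two or more edges between i and j the product s_i s_j has infinite
    order. *)
Inductive wbraid : seq (vtx G) -> seq (vtx G) -> Prop :=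
| wb_refl r : wbraid r r
| wb_trans r1 r2 r3 : wbraid r1 r2 -> wbraid r2 r3 -> wbraid r1 r3
| wb_cons k r r' : wbraid r r' -> wbraid (k :: r) (k :: r')
| wb_comm i j r : i != j -> #|arr i j| = 0%N ->
    wbraid (i :: j :: r) (j :: i :: r)
| wb_braid i j r : i != j -> #|arr i j| = 1%N ->
    wbraid (i :: j :: i :: r) (j :: i :: j :: r).

Lemma wbraid_sym r r' : wbraid r r' -> wbraid r' r.
Proof.
elim=> [s|r1 r2 r3 _ h1 _ h2|k s s' _|i j s ij e|i j s ij e].
- exact: wb_refl.
- exact: wb_trans h2 h1.
- exact: wb_cons.
- by apply: wb_comm; rewrite 1?eq_sym 1?card_arrC.
- by apply: wb_braid; rewrite 1?eq_sym 1?card_arrC.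
Qed.

Lemma wbraid_wact (A : zmodType) r r' (u : vtx G -> A) :
  wbraid r r' -> wact r u = wact r' u.
Proof.
elim=> //= [r1 r2 r3 _ -> _ -> //|k s s' _ -> //|i j s ij e|i j s ij e].
- exact: srefl_comm.
- exact: srefl_braid.
Qed.

Lemma wbraid_size r r' : wbraid r r' -> size r = size r'.
Proof. by elim=> //= [r1 r2 r3 _ -> _ -> //|k s s' _ ->]. Qed.

(* The functional u |-> (r u)_i is the root r^-1 alpha_i; [pos] says that it is
   positive, so that i :: r is reduced if r is, and [good] words are the reduced
   ones. *)
Definition pos r i : Prop :=
  forall u, (forall k, 0 <= u k) -> 0 <= wact r u i.

Fixpoint good r : Prop := if r is i :: r' then good r' /\ pos r' i else True.

Lemma wbraid_pos r r' i : wbraid r r' -> pos r i -> pos r' i.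
Proof. by move=> b h u hu; rewrite -(wbraid_wact _ b); exact: h. Qed.

Lemma pos_comm r i j : i != j -> #|arr i j| = 0%N ->
  pos (i :: r) j <-> pos r j.
Proof.
by move=> ij e; split => h u hu; move: (h u hu) => /=; rewrite srefl_cartan0.
Qed.

(** For a single edge, the coordinate at j of s_i s_j u is u_i. *)
Lemma pos_braid1 r i j : i != j -> #|arr i j| = 1%N ->
  pos (i :: j :: r) j <-> pos r i.
Proof.
move=> ij e; have ji : j != i by rewrite eq_sym.
by split => h u hu; move: (h u hu) => /=;
  rewrite srefl_neq // e srefl_same srefl_neq // card_arrC e mulr1n addrC addrK.
Qed.

Lemma pos_braid2 r i j : i != j -> #|arr i j| = 1%N ->
  pos (i :: r) j <-> pos (j :: r) i.
Proof.
move=> ij e; have ji : j != i by rewrite eq_sym.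
have e1 : #|arr j i| = 1%N by rewrite card_arrC.
by split => h u hu; move: (h u hu) => /=;
  rewrite !srefl_neq // ?e ?e1 addrC.
Qed.

(** The two sides of a rank two relation test the positivity of the same roots, two or three of
    them, in opposite orders. *)
Lemma wbraid_good r r' : wbraid r r' -> good r -> good r'.
Proof.
elim=> //= [r1 r2 r3 _ h1 _ h2 /h1 //|k s s' b h [/h gs p]
           |i j s ij e [[gs p] q]|i j s ij e [[[gs p] q] t]].
- by split => //; exact: wbraid_pos p.
- have ji : j != i by rewrite eq_sym.
  have e' : #|arr j i| = 0%N by rewrite card_arrC.
  by split; first split => //; [apply/(pos_comm s ji e') | apply/(pos_comm s ij e)].
- have ji : j != i by rewrite eq_sym.
  have e' : #|arr j i| = 1%N by rewrite card_arrC.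
  split; first split; first split => //.
  + by apply/(pos_braid1 s ji e').
  + by apply/(pos_braid2 s ij e).
  + by apply/(pos_braid1 s ij e).
Qed.

(* With two edges or more between i and j, the coefficients of the roots in the
   plane of i and j grow, so that a reduced word j :: r has no descent at i. *)
Lemma pos_dihedral_inf n : (forall r i, (size r <= n)%N -> good r ->
     pos r i \/ exists2 r', good r' & wbraid r (i :: r')) ->
  forall m, (m <= n)%N -> forall r i j p q, (size r <= m)%N ->
  good (j :: r) -> i != j -> (1 < #|arr i j|)%N -> 0 <= q <= p ->
  forall u, (forall k, 0 <= u k) ->
  0 <= p * wact (j :: r) u i + q * wact (j :: r) u j :> int.
Proof.
move=> IH; elim=> [|m IHm] mn r i j p q sr [gr pr] ij aij /andP[q0 qp] u hu /=.
  have -> : r = [::] by case: (r) sr.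
  rewrite /= srefl_same srefl_neq 1?eq_sym // card_arrC -mulr_natr.
  have h1 : p <= p * #|arr i j|%:Z - q by nia.
  have h2 : 0 <= p by lia.
  have := mulr_ge0 h2 (hu i); have := mulr_ge0 (le_trans h2 h1) (hu j).
  by rewrite natz; lia.
rewrite srefl_same srefl_neq 1?eq_sym // card_arrC -mulr_natr natz.
(* With n >= 2 edges and q <= p, the new pair of coefficients (p n - q, p) is ordered again, which
   is the invariant of the induction. *)
have q' : p <= p * #|arr i j|%:Z - q by nia.
suff: 0 <= (p * #|arr i j|%:Z - q) * wact r u j + p * wact r u i by lia.
case: (IH r i (leq_trans sr mn) gr) => [pi|[r' gr' br]].
  have h2 : 0 <= p by lia.
  by have := mulr_ge0 h2 (pi u hu); have := mulr_ge0 (le_trans h2 q') (pr u hu); lia.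
have := wbraid_good br gr; rewrite (wbraid_wact u br) => gir'.
apply: IHm => //; first by rewrite ltnW.
- by rewrite -ltnS -[(size r').+1]/(size (i :: r')) -(wbraid_size br).
- by rewrite eq_sym.
- by rewrite card_arrC.
- by rewrite q' (le_trans q0).
Qed.

(** The exchange property, by induction on the length. With at most one edge between i and the first
    letter, a descent of the tail is pushed through the rank two relation; with more edges
    [pos_dihedral_inf] leaves only positivity. *)
Lemma descent n r i : (size r <= n)%N -> good r ->
     pos r i \/ exists2 r', good r' & wbraid r (i :: r').
Proof.
elim: n r i => [|n IH] r i; first by case: r => // _ _; left => u; exact.
case: r => [_ _|j r sr /= [gr pr]]; first by left => u; exact.
case: (eqVneq j i) => [->|ji]; first by right; exists r => //; exact: wb_refl.
have ij : i != j by rewrite eq_sym.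
case e : #|arr i j| => [|[|m]]; last first.
- left => u hu; have := pos_dihedral_inf IH (leqnn n) sr (conj gr pr) ij.
  by move=> /(_ 1 0 _ _ u hu); rewrite mul0r addr0 mul1r; apply => //; rewrite e.
- have e' : #|arr j i| = 1%N by rewrite card_arrC.
  case: (IH r i) => // [pi|[r2 gr2 b]].
    left => u hu /=; rewrite srefl_neq // e' mulr1n addr_ge0 //; first exact: pi.
    exact: pr.
  have sr2 : (size r2 <= n)%N.
    by rewrite ltnW // -[(size r2).+1]/(size (i :: r2)) -(wbraid_size b).
  case: (IH r2 j) => // [pj|[r3 gr3 b3]].
    left; apply: (@wbraid_pos (j :: i :: r2)).
      by apply: wb_cons; exact: wbraid_sym.
    exact/pos_braid1.
  right; exists (j :: i :: r3).
    have : wbraid (j :: r) (i :: j :: i :: r3).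
      apply: (wb_trans (wb_cons j b)); apply: wb_trans (wb_braid r3 ji e').
      by do 2![apply: wb_cons].
    by move/wbraid_good => /(_ (conj gr pr)) [].
  apply: (wb_trans (wb_cons j b)); apply: wb_trans (wb_braid r3 ji e').
  by do 2![apply: wb_cons].
- have e' : #|arr j i| = 0%N by rewrite card_arrC.
  case: (IH r i) => // [pi|[r2 gr2 b]].
    by left; apply/pos_comm.
  have B : wbraid (j :: r) (i :: j :: r2).
    by apply: (wb_trans (wb_cons j b)); exact: wb_comm.
  right; exists (j :: r2) => //.
  by case: (wbraid_good B (conj gr pr)).
Qed.

Lemma wact_revK (A : zmodType) r (u : vtx G -> A) : wact r (wact (rev r) u) = u.
Proof.
elim: r u => //= i r IH u; rewrite rev_cons -cats1 /wact foldr_cat /=.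
by have := IH (srefl i u); rewrite /wact => ->; rewrite sreflK.
Qed.

(** The word acts invertibly and the positive cone spans, so a coordinate that vanishes on the cone
    would vanish at the preimage of the constant vector 1. *)
Lemma wact0_le r i : (forall u, (forall k, 0 <= u k) -> wact r u i = 0) -> False.
Proof.
have wactB (u u' : vtx G -> int) :
    wact r (fun k => u k - u' k) = fun k => wact r u k - wact r u' k.
  elim: r => //= j s ->; apply: funext => k; rewrite /srefl !mulrzz; ring.
move=> h; pose u : vtx G -> int := wact (rev r) (fun=> 1).
have := congr1 (fun f => f i) (wact_revK r (fun=> 1 : int)).
pose up k := `|u k| : int.
have -> : wact (rev r) (fun=> 1 : int) = fun k => up k - (up k - u k).
  by apply: funext => k; rewrite opprB addrC subrK.
rewrite wactB !h ?subrr // => k; rewrite /up ?subr_ge0 ?ler_norm //.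
Qed.

(** Matsumoto's theorem. If i were no descent of r', the coordinate at i of r would be both
    nonnegative and nonpositive on the positive cone, hence 0 there. *)
Lemma good_unique r r' : good r -> good r' -> weyl_eq r r' -> wbraid r r'.
Proof.
elim: r r' => [|i r IH] r' /=.
  case: r' => [|i r'] _; first by move=> _ _; exact: wb_refl.
  move=> [_ p] /(_ (fun=> 1)) /= /(congr1 (fun f => f i)) /=.
  by rewrite srefl_same; have := p (fun=> 1) (fun=> isT); lia.
move=> [gr pr] gr' E.
case: (descent i (leqnn _) gr') => [p|[r2 gr2 b]].
  case: (@wact0_le r i) => u hu; apply/eqP; rewrite eq_le pr // andbT.
  by have := p u hu; rewrite -E /= srefl_same oppr_ge0.
apply: wb_trans (wbraid_sym b); apply: wb_cons; apply: IH => // u.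
by have := E u; rewrite (wbraid_wact u b) /= => /(congr1 (srefl i)); rewrite !sreflK.
Qed.

(** T need not be symmetric: cancellation is asked only from the longer word to the shorter. Each
    word is brought down to a reduced one, and the two reduced words are joined by braid moves,
    which may be used in either direction. *)
Lemma tits (T : seq (vtx G) -> seq (vtx G) -> Prop) :
  (forall r, T r r) -> (forall r1 r2 r3, T r1 r2 -> T r2 r3 -> T r1 r3) ->
  (forall k r r', T r r' -> T (k :: r) (k :: r')) ->
  (forall i r, T (i :: i :: r) r) ->
  (forall i j r, i != j -> #|arr i j| = 0%N -> T (i :: j :: r) (j :: i :: r)) ->
  (forall i j r, i != j -> #|arr i j| = 1%N ->
     T (i :: j :: i :: r) (j :: i :: j :: r)) ->
  forall r r', weyl_eq r r' -> exists2 r0, T r r0 & T r' r0.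
Proof.
move=> T1 Ttr Tc T2 Tcm Tb.
have TB r r' : wbraid r r' -> T r r'.
  elim=> [s|r1 r2 r3 _ h1 _ h2|k s s' _ h|i j s ij e|i j s ij e].
  - exact: T1.
  - exact: Ttr h1 h2.
  - exact: Tc.
  - exact: Tcm.
  - exact: Tb.
have red r : exists r0, [/\ good r0, T r r0 & weyl_eq r r0].
  elim: r => [|i r [r0 [g t e]]]; first by exists [::].
  case: (descent i (leqnn _) g) => [p|[r1 g1 b]].
    by exists (i :: r0); split => //; [exact: Tc | move=> u /=; rewrite e].
  exists r1; split => //.
    by apply: (Ttr _ _ _ (Tc i _ _ t)); apply: (Ttr _ _ _ (Tc i _ _ (TB _ _ b))).
  by move=> u /=; rewrite e (wbraid_wact u b) /= sreflK.
move=> r r' E; have [r0 [g t e]] := red r; have [r0' [g' t' e']] := red r'.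
exists r0' => //; apply: (Ttr _ _ _ t); apply: TB; apply: good_unique => // u.
by rewrite -e E e'.
Qed.

(** [weyl_eq] tests integral vectors only. The defining relations hold on any abelian group, so the
    word problem carries the equality to real and complex parameters. *)
Lemma weyl_eq_wact (A : zmodType) r r' (u : vtx G -> A) :
  weyl_eq r r' -> wact r u = wact r' u.
Proof.
move=> E; suff [r0 -> ->] : exists2 r0, wact r u = wact r0 u
   & wact r' u = wact r0 u by [].
apply: (@tits (fun r r' => wact r u = wact r' u)) => //=.
- by move=> r1 r2 r3 -> ->.
- by move=> k s s' ->.
- by move=> i s; rewrite sreflK.
- by move=> i j s ij e; rewrite srefl_comm.
- by move=> i j s ij e; rewrite srefl_braid.
Qed.

End Tits.

(** * Linear algebra *)

Section LinearAlgebra.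
Variable F : fieldType.

Lemma mulmx_ext m n (A B : 'M[F]_(m, n)) :
  (forall z : 'cV_n, A *m z = B *m z) -> A = B.
Proof.
move=> h; apply/matrixP => a b.
by have := congr1 (fun M : 'cV_m => M a 0) (h (delta_mx b 0)); rewrite -!colE !mxE.
Qed.

Lemma linv_of_inj m n (A : 'M[F]_(m, n)) :
  (forall z : 'cV_n, A *m z = 0 -> z = 0) -> exists r, r *m A = 1%:M.
Proof.
move=> h; have /row_freeP [r hr] : row_free A^T.
  apply: inj_row_free => z hz; apply: trmx_inj; rewrite trmx0; apply: h.
  by apply: trmx_inj; rewrite trmx_mul trmxK trmx0.
by exists r^T; apply: trmx_inj; rewrite trmx_mul trmxK trmx1.
Qed.

Lemma rinv_of_surj m n (A : 'M[F]_(m, n)) :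
  (forall z : 'cV_m, exists u, A *m u = z) -> exists s, A *m s = 1%:M.
Proof.
move=> h; have [u hu] := choice h.
exists (\matrix_(a, b) u (delta_mx b 0) a 0).
apply/matrixP => a b; have := congr1 (fun M : 'cV_m => M a 0) (hu (delta_mx b 0)).
rewrite !mxE eqxx andbT => <-; apply: eq_bigr => k _; by rewrite mxE.
Qed.

(** A linear relation that is total and has zero kernel on both sides is the graph of an
    isomorphism. The spaces compared below are known only through embeddings in a common space, so
    their isomorphisms come from such relations. *)
Lemma linear_rel_iso m n (P : 'cV[F]_m -> 'cV[F]_n -> Prop) :
  (forall a y z y' z', P y z -> P y' z' -> P (a *: y + y') (a *: z + z')) ->
  (forall y, exists z, P y z) -> (forall z, exists y, P y z) ->
  (forall z, P 0 z -> z = 0) -> (forall y, P y 0 -> y = 0) ->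
  exists h hi, [/\ hi *m h = 1%:M, h *m hi = 1%:M & forall y, P y (h *m y)].
Proof.
move=> Pl Pt Ps P0 P0'.
have P00 : P 0 0 by have [z hz] := Pt 0; have e := P0 _ hz; rewrite e in hz.
have [t ht] := choice Pt.
pose h := \matrix_(a, b) t (delta_mx b 0) a 0.
have hP y : P y (h *m y).
  have -> : y = \sum_b y b 0 *: delta_mx b 0.
    apply/matrixP => a b; rewrite summxE (bigD1 a) //= big1 ?addr0.
      by rewrite !mxE !eqxx (ord1 b) eqxx mulr1.
    by move=> k ka; rewrite !mxE eq_sym (negbTE ka) mulr0.
  rewrite mulmx_sumr; elim: (index_enum _) => [|b s IH]; first by rewrite !big_nil.
  rewrite !big_cons -scalemxAr; apply: Pl => //.
  have -> : h *m delta_mx b 0 = t (delta_mx b 0).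
    by rewrite -colE; apply/matrixP => a k; rewrite !mxE (ord1 k).
  exact: ht.
have [r hr] : exists r, r *m h = 1%:M.
  by apply: linv_of_inj => y e; apply: P0'; rewrite -e.
have [s hs] : exists s, h *m s = 1%:M.
  apply: rinv_of_surj => z; have [y hy] := Ps z; exists y.
  have := Pl (-1) _ _ _ _ hy (hP y); rewrite scaleN1r addNr => /P0 /eqP.
  by rewrite scaleN1r addrC subr_eq0 => /eqP.
exists h, r; split => //.
by have <- : s = r by rewrite -[s]mul1mx -hr -mulmxA hs mulmx1.
Qed.

(** A finite direct sum given by its biproduct equations, which spares all computation with block
    indices. *)
Lemma biproduct (K : finType) (d : K -> nat) :
  exists (inj : forall k, 'M[F]_(\sum_l d l, d k))
         (prj : forall k, 'M[F]_(d k, \sum_l d l)),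
  [/\ forall k, prj k *m inj k = 1%:M,
      forall k l, k != l -> prj k *m inj l = 0
    & \sum_k inj k *m prj k = 1%:M].
Proof.
pose T := {k : K & 'I_(d k)}.
have e : #|{: T}| = (\sum_l d l)%N.
  rewrite card_tagged sumnE big_map big_enum /=.
  by apply: eq_bigr => k _; rewrite card_ord.
(* The dimension is replaced by the cardinality of the type of pairs (summand, coordinate), whose
   enumeration then indexes the basis. *)
case: _ / e.
pose inj k : 'M[F]_(#|{: T}|, d k) :=
  \matrix_(a, b) (enum_val a == Tagged (fun k => 'I_(d k)) b)%:R.
exists inj, (fun k => (inj k)^T); split.
- move=> k; apply/matrixP => a b; rewrite !mxE.
  rewrite (bigD1 (enum_rank (Tagged (fun k => 'I_(d k)) a))) //= big1 ?addr0.
    by rewrite !mxE enum_rankK eqxx mul1r eq_Tagged.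
  move=> l hl; rewrite !mxE; case: eqP => [el|]; last by rewrite mul0r.
  by rewrite -el enum_valK eqxx in hl.
- move=> k l kl; apply/matrixP => a b; rewrite !mxE big1 // => t _; rewrite !mxE.
  case: eqP => [->|]; last by rewrite mul0r.
  case: eqP => [/(congr1 (@tag _ _)) /= el|]; last by rewrite mulr0.
  by rewrite el eqxx in kl.
- apply/matrixP => a b; rewrite summxE mxE.
  rewrite (bigD1 (tag (enum_val a))) //= big1 ?addr0 => [|k hk].
    rewrite mxE (bigD1 (tagged (enum_val a))) //= big1 ?addr0 => [|j hj].
      rewrite !mxE; have -> : Tagged (fun k => 'I_(d k)) (tagged (enum_val a)) = enum_val a.
        by case: (enum_val a).
      by rewrite eqxx mul1r (inj_eq enum_val_inj) eq_sym.
    rewrite !mxE; case: eqP => [ea|]; last by rewrite mul0r.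
    have tE (t : T) (l : 'I_(d (tag t))) :
        t = Tagged (fun k => 'I_(d k)) l -> tagged t = l.
      by case: t l => ? ? l /= /eqP; rewrite eq_Tagged => /eqP.
    by rewrite (tE _ _ ea) eqxx in hj.
  rewrite mxE big1 // => j _; rewrite !mxE; case: eqP => [ea|]; last by rewrite mul0r.
  by rewrite ea eqxx in hk.
Qed.

Definition mximg m n (A : 'M[F]_(m, n)) (S : {vspace 'cV[F]_n}) :
  {vspace 'cV[F]_m} := (linfun (mulmx A) @: S)%VS.

Lemma mem_mximg m n (A : 'M[F]_(m, n)) (S : {vspace 'cV[F]_n}) u :
  u \in S -> A *m u \in mximg A S.
Proof.
have -> : A *m u = linfun (mulmx A) u by rewrite lfunE.
exact: memv_img.
Qed.

Lemma mximgP m n (A : 'M[F]_(m, n)) (S : {vspace 'cV[F]_n}) w :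
  w \in mximg A S -> exists2 u, u \in S & w = A *m u.
Proof. by move=> /memv_imgP [u hu ->]; exists u => //; rewrite lfunE. Qed.

Lemma dim_mximg m n (r : 'M[F]_(n, m)) (A : 'M[F]_(m, n)) (S : {vspace 'cV[F]_n}) :
  r *m A = 1%:M -> \dim (mximg A S) = \dim S.
Proof.
move=> h; apply: limg_dim_eq; apply/eqP; rewrite -subv0; apply/subvP => s.
rewrite memv_cap => /andP [_]; rewrite memv_ker lfunE /= memv0 => /eqP e.
by rewrite -[s]mul1mx -h -mulmxA e mulmx0.
Qed.

Lemma vspace_block (K : finType) (d : K -> nat) N
    (inj : forall k, 'M[F]_(N, d k)) (prj : forall k, 'M[F]_(d k, N)) :
  (forall k, prj k *m inj k = 1%:M) ->
  (forall k l, k != l -> prj k *m inj l = 0) ->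
  \sum_k inj k *m prj k = 1%:M ->
  forall S : forall k, {vspace 'cV[F]_(d k)},
  exists2 U : {vspace 'cV[F]_N}, forall w, w \in U <-> forall k, prj k *m w \in S k
  & \dim U = (\sum_k \dim (S k))%N.
Proof.
move=> h1 h0 hs S.
pose Vs k := mximg (inj k) (S k).
have pVs k l w : w \in Vs k -> prj l *m w \in S l /\ (k != l -> prj l *m w = 0).
  move=> /mximgP [u hu ->]; rewrite mulmxA.
  case: (eqVneq k l) hu => [<-|kl] hu; first by rewrite h1 mul1mx.
  by rewrite h0 1?eq_sym // mul0mx mem0v.
exists (\sum_k Vs k)%VS.
  move=> w; split => [/memv_sumP [u hu ->] k|h].
    rewrite mulmx_sumr; apply: memv_suml => l _.
    by have [] := pVs _ k _ (hu l isT).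
  rewrite -[w]mul1mx -hs mulmx_suml; apply: memv_sumr => k _.
  by rewrite -mulmxA; apply: mem_mximg; apply: h.
have : directv (\sum_k Vs k).
  apply/directv_sum_independent => u hu e k _.
  have e2 : prj k *m (\sum_k u k) = 0 by rewrite e mulmx0.
  move: e2; rewrite mulmx_sumr (bigD1 k) //= big1 ?addr0 => [|l lk]; last first.
    by case: (pVs _ k _ (hu l isT)) => _; apply.
  have [s hs' ->] := mximgP (hu k isT).
  by rewrite mulmxA h1 mul1mx => ->; rewrite mulmx0.
rewrite directvE /= => /eqP ->; apply: eq_bigr => k _.
exact: dim_mximg (h1 k).
Qed.

(** The columns of b are a basis of S and r is a retraction, so that membership in S becomes a
    matrix equation. *)
Lemma vspace_mx n (S : {vspace 'cV[F]_n}) :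
  exists (b : 'M[F]_(n, \dim S)) (r : 'M[F]_(\dim S, n)),
    r *m b = 1%:M /\ forall u, u \in S <-> b *m (r *m u) = u.
Proof.
pose M : 'M[F]_(\dim S, n) := \matrix_(k, l) (vbasis S)`_k l 0.
have rowM (k : 'I_(\dim S)) : (vbasis S)`_k = (row k M)^T.
  by apply/matrixP => a b; rewrite !mxE (ord1 b).
have comb (c : 'I_(\dim S) -> F) : \sum_k c k *: (vbasis S)`_k = ((\row_k c k) *m M)^T.
  rewrite mulmx_sum_row linear_sum; apply: eq_bigr => k _.
  by rewrite linearZ /= mxE -rowM.
have /row_freeP [r hr] : row_free M.
  apply: inj_row_free => z hz; apply/rowP => k; rewrite mxE.
  have /freeP fr := basis_free (vbasisP S); apply: (fr (fun k => z 0 k)).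
  rewrite comb; have -> : \row_k z 0 k = z by apply/rowP => l; rewrite mxE.
  by rewrite hz trmx0.
exists M^T, r^T; have e : r^T *m M^T = 1%:M by rewrite -trmx_mul hr trmx1.
split => // u; split=> [hu|<-].
  by rewrite (coord_vbasis hu) comb trmx_mul (mulmxA r^T) e mul1mx.
set z := r^T *m u; have -> : M^T *m z = \sum_k z^T 0 k *: (vbasis S)`_k.
  rewrite comb (_ : \row_k _ = z^T) ?trmx_mul ?trmxK //.
  by apply/rowP => k; rewrite mxE.
apply: memv_suml => k _; apply: memvZ; apply: vbasis_mem; apply: mem_nth.
by rewrite size_tuple.
Qed.

(** The annihilator for the standard bilinear pairing. It need not be a complement of S, because of
    isotropic vectors; only its dimension is complementary. *)
Lemma orth_vspace n (S : {vspace 'cV[F]_n}) :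
  exists S' : {vspace 'cV[F]_n},
    (forall u, u \in S' <-> forall s, s \in S -> s^T *m u = 0) /\
    (\dim S + \dim S' = n)%N.
Proof.
have [b [r [rb bP]]] := vspace_mx S.
pose L : 'Hom('cV[F]_n, 'cV[F]_(\dim S)) := linfun (mulmx b^T).
exists (lker L); split.
  move=> u; rewrite memv_ker lfunE /=; split=> [/eqP hu s /bP <-|h].
    by rewrite trmx_mul -mulmxA hu mulmx0.
  apply/eqP/row_matrixP => k; rewrite row_mul row0 -[row k _]trmxK.
  apply: h; apply/bP; rewrite -tr_col trmxK colE !mulmxA.
  by rewrite -[b *m r *m b]mulmxA rb mulmx1.
have e1 := limg_ker_dim L fullv.
have e2 : limg L = fullv.
  apply/eqP; rewrite eqEsubv subvf /=; apply/subvP => z _.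
  have -> : z = L (r^T *m z) by rewrite lfunE /= mulmxA -trmx_mul rb trmx1 mul1mx.
  by apply: memv_img; exact: memvf.
by move: e1; rewrite e2 (capv_idPr (subvf _)) !dimvf /dim /= !muln1 addnC.
Qed.

End LinearAlgebra.

(** * The reflection relation at a vertex *)

Section Local.
Variables (F : fieldType) (K : finType).

(* U is the sum of the F^(d k), A = a_i(x), B = b_i(x); A' and B' are those of x',
   and f is the identification U = U'. *)
Record lrefl (d d' : K -> nat) (n n' : nat)
    (A : forall k, 'M[F]_(d k, n)) (B : forall k, 'M[F]_(n, d k))
    (A' : forall k, 'M[F]_(d' k, n')) (B' : forall k, 'M[F]_(n', d' k))
    (f : forall k, 'M[F]_(d' k, d k)) (c : F) : Prop := LRefl {
  lrefl_inj : forall z : 'cV_n', (forall k, A' k *m z = 0) -> z = 0;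
  lrefl_ker : forall u : (forall k, 'cV_(d k)), \sum_k B k *m u k = 0 <->
                exists z, forall k, A' k *m z = f k *m u k;
  lrefl_surj : forall z, exists u : (forall k, 'cV_(d k)), \sum_k B k *m u k = z;
  lrefl_off : forall k l, k != l -> f k *m A k *m B l = A' k *m B' l *m f l;
  lrefl_diag : forall k, f k *m A k *m B k - A' k *m B' k *m f k = c *: f k
}.

Section Theory.
Variables (d d' : K -> nat) (n n' : nat).
Variables (A : forall k, 'M[F]_(d k, n)) (B : forall k, 'M[F]_(n, d k)).
Variables (A' : forall k, 'M[F]_(d' k, n')) (B' : forall k, 'M[F]_(n', d' k)).
Variables (f : forall k, 'M[F]_(d' k, d k)) (g : forall k, 'M[F]_(d k, d' k)).
Variable c : F.
Hypothesis gf : forall k, g k *m f k = 1%:M.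
Hypothesis fg : forall k, f k *m g k = 1%:M.

(** The converse direction evaluates the vector identity on families supported at one index. *)
Lemma lrefl_vecP :
  ((forall k l, k != l -> f k *m A k *m B l = A' k *m B' l *m f l) /\
   (forall k, f k *m A k *m B k - A' k *m B' k *m f k = c *: f k)) <->
  (forall (u : forall k, 'cV_(d k)) k,
    f k *m (A k *m \sum_l B l *m u l) - A' k *m \sum_l B' l *m (f l *m u l)
    = c *: (f k *m u k)).
Proof.
split=> [[h0 h1] u k|h].
  rewrite mulmxA !mulmx_sumr -sumrB (bigD1 k) //= big1 ?addr0 => [|l lk].
    by rewrite !mulmxA -mulmxBl h1 scalemxAl.
  by rewrite !mulmxA h0 1?eq_sym // subrr.
have E k l (w : 'cV_(d l)) : f k *m A k *m B l *m w - A' k *m B' l *m f l *m w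
   = c *: (f k *m dfwith (fun k => 0 : 'cV_(d k)) w k).
  have := h (dfwith (fun k => 0 : 'cV_(d k)) w) k.
  rewrite (bigD1 l) //= big1 ?addr0 => [|j jl]; last first.
    by rewrite dfwith_out 1?eq_sym // mulmx0.
  rewrite (bigD1 l) //= big1 ?addr0 => [|j jl]; last first.
    by rewrite dfwith_out 1?eq_sym // !mulmx0.
  by rewrite dfwith_in !mulmxA.
split=> [k l kl|k]; apply: mulmx_ext => w.
  apply/eqP; rewrite -subr_eq0; apply/eqP.
  by rewrite E dfwith_out 1?eq_sym // mulmx0 scaler0.
by rewrite mulmxBl E dfwith_in scalemxAl.
Qed.

Hypothesis H : lrefl A B A' B' f c.

Lemma lrefl_vec (u : forall k, 'cV_(d k)) k :
    f k *m (A k *m \sum_l B l *m u l) - A' k *m \sum_l B' l *m (f l *m u l)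
    = c *: (f k *m u k).
Proof.
by move: u k; apply/lrefl_vecP; split; [exact: lrefl_off H | exact: lrefl_diag H].
Qed.

Lemma lrefl_vec1 k l (w : 'cV_(d l)) :
  f k *m (A k *m (B l *m w)) - A' k *m (B' l *m (f l *m w))
    = c *: (f k *m dfwith (fun k => 0 : 'cV_(d k)) w k).
Proof.
have := lrefl_vec (dfwith (fun k => 0 : 'cV_(d k)) w) k.
rewrite (bigD1 l) //= big1 ?addr0 => [|j jl]; last first.
  by rewrite dfwith_out 1?eq_sym // mulmx0.
rewrite (bigD1 l) //= big1 ?addr0 => [|j jl]; last first.
  by rewrite dfwith_out 1?eq_sym // !mulmx0.
by rewrite dfwith_in.
Qed.

Lemma lrefl_comp0 (z : 'cV_n') : \sum_k B k *m (g k *m (A' k *m z)) = 0.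
Proof. by apply/(lrefl_ker H); exists z => k; rewrite mulmxA fg mul1mx. Qed.

(** From b a' = 0 one gets b a b = b (a' b' + c) = c b, and b is surjective. The moment map equation
    of x at i is thus part of the relation. *)
Lemma lrefl_BA : \sum_k B k *m A k = c%:M.
Proof.
apply: mulmx_ext => z; have [u <-] := lrefl_surj H z; set s := \sum_l B l *m u l.
have e k : A k *m s = g k *m (A' k *m \sum_l B' l *m (f l *m u l)) + c *: u k.
  have := lrefl_vec u k => /(congr1 (mulmx (g k))).
  rewrite mulmxBr -scalemxAr !(mulmxA (g k) (f k)) gf !mul1mx -/s => /eqP.
  by rewrite subr_eq addrC => /eqP.
rewrite mulmx_suml mul_scalar_mx.
under eq_bigr => k _ do rewrite -mulmxA e mulmxDr.
rewrite big_split /= lrefl_comp0 add0r scaler_sumr.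
by apply: eq_bigr => k _; rewrite scalemxAr.
Qed.

(** Dually, a' b' a' = (a b - c) a' = - c a', and a' is injective. *)
Lemma lrefl_BA' : \sum_k B' k *m A' k = (- c)%:M.
Proof.
apply: mulmx_ext => z; apply/eqP; rewrite -subr_eq0; apply/eqP.
apply: (lrefl_inj H) => k.
have := lrefl_vec (fun k => g k *m (A' k *m z)) k.
rewrite lrefl_comp0 mulmx0 mulmx0 sub0r mulmxA fg mul1mx mul_scalar_mx.
rewrite mulmxBr scaleNr mulmxN -scalemxAr => <-.
rewrite opprK mulmx_suml; apply/eqP; rewrite subr_eq0; apply/eqP; congr (_ *m _).
by apply: eq_bigr => l _; rewrite !mulmxA -(mulmxA _ (f l)) fg mulmx1.
Qed.

(** For c != 0 the scalars b a = c and b' a' = - c make a injective and b' surjective. Exactness in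
    the middle comes from a b - a' b' = c: if b' u = 0 then u = c^-1 a b u. *)
Lemma lrefl_inv : c != 0 -> lrefl A' B' A B g (- c).
Proof.
move=> c0; split.
- move=> z hz; have := lrefl_BA => /(congr1 (fun M => M *m z)).
  rewrite mulmx_suml big1 => [|k _]; last by rewrite -mulmxA hz mulmx0.
  rewrite mul_scalar_mx => /esym /(congr1 ( *:%R c^-1)).
  by rewrite scalerA mulVf // scale1r scaler0.
- move=> u; pose u0 k := g k *m u k.
  have fu0 k : f k *m u0 k = u k by rewrite mulmxA fg mul1mx.
  have V := lrefl_vec u0; split => [hu|[z hz]].
    exists (c^-1 *: \sum_l B l *m u0 l) => k.
    have := V k; rewrite (eq_bigr (fun l => B' l *m u l)) ?hu; last first.
      by move=> l _; rewrite fu0.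
    rewrite mulmx0 subr0 => /(congr1 (mulmx (g k))).
    rewrite mulmxA gf mul1mx -!scalemxAr mulmxA gf mul1mx => e.
    by rewrite e scalerA mulVf // scale1r.
  have [u1 hu1] := lrefl_surj H z.
  have V1 := lrefl_vec u1; pose z1 := \sum_l B' l *m (f l *m u1 l).
  have e l : u l = A' l *m z1 + c *: (f l *m u1 l).
    by rewrite -V1 hu1 hz mulmxA fg mul1mx addrC subrK.
  under eq_bigr => l _ do rewrite e mulmxDr mulmxA.
  rewrite big_split /= -mulmx_suml lrefl_BA' mul_scalar_mx scaleNr.
  by under [X in _ + X]eq_bigr => l _ do rewrite -scalemxAr; rewrite -scaler_sumr addNr.
- move=> z; exists (fun k => A' k *m (- c^-1 *: z)).
  under eq_bigr => k _ do rewrite mulmxA.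
  by rewrite -mulmx_suml lrefl_BA' mul_scalar_mx scalerA mulrNN mulfV // scale1r.
- move=> k l kl; have := lrefl_off H kl => /(congr1 (fun M => g k *m M *m g l)).
  rewrite !mulmxA gf mul1mx => ->.
  by rewrite -!mulmxA fg mulmx1.
- move=> k; have := lrefl_diag H k => /(congr1 (fun M => g k *m M *m g k)).
  rewrite mulmxBr mulmxBl !mulmxA gf mul1mx -!(mulmxA _ (f k) (g k)) fg mulmx1.
  rewrite -scalemxAr gf -scalemxAl mul1mx scaleNr => <-.
  by rewrite opprB.
Qed.

(* Split exactness of 0 -> n' -> U -> n -> 0, a form that can be transposed. *)
Lemma lrefl_split : exists (r : forall k, 'M[F]_(n', d k)) (s : forall k, 'M[F]_(d k, n)),
  [/\ \sum_k r k *m g k *m A' k = 1%:M, \sum_k B k *m s k = 1%:M,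
      forall k, g k *m A' k *m r k + s k *m B k = 1%:M
    & forall k l, k != l -> g k *m A' k *m r l + s k *m B l = 0].
Proof.
have [inj [prj [h1 h0 hs]]] := @biproduct F K d.
pose Ab := \sum_k inj k *m g k *m A' k; pose Bb := \sum_k B k *m prj k.
have pA k : prj k *m Ab = g k *m A' k.
  rewrite mulmx_sumr [LHS](bigD1 k) //= [X in _ + X]big1 ?addr0 => [|l lk].
    by rewrite !mulmxA h1 mul1mx.
  by rewrite !mulmxA h0 1?eq_sym // !mul0mx.
have pB k : Bb *m inj k = B k.
  rewrite mulmx_suml [LHS](bigD1 k) //= [X in _ + X]big1 ?addr0 => [|l lk].
    by rewrite -mulmxA h1 mulmx1.
  by rewrite -mulmxA h0 // mulmx0.
have [r hr] : exists r, r *m Ab = 1%:M.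
  apply: linv_of_inj => z hz; apply: (lrefl_inj H) => k.
  have -> : A' k = f k *m (prj k *m Ab) by rewrite pA mulmxA fg mul1mx.
  by rewrite -!mulmxA hz !mulmx0.
have [s hs'] : exists s, Bb *m s = 1%:M.
  apply: rinv_of_surj => z; have [u <-] := lrefl_surj H z.
  exists (\sum_k inj k *m u k); rewrite mulmx_sumr.
  by apply: eq_bigr => k _; rewrite mulmxA pB.
have BA0 : Bb *m Ab = 0.
  apply: mulmx_ext => z; rewrite mul0mx -[RHS](lrefl_comp0 z) mulmx_suml mulmx_suml.
  by apply: eq_bigr => k _; rewrite -!mulmxA (mulmxA (prj k)) pA -mulmxA.
(* The retraction is corrected by the projection s b, so that it kills the image of s; the two
   splittings then become complementary. *)
pose t := r *m (1%:M - s *m Bb).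
have At : Ab *m t + s *m Bb = 1%:M.
  rewrite /t; apply: mulmx_ext => w; rewrite mul1mx.
  pose w' := w - s *m (Bb *m w).
  have : \sum_k B k *m (prj k *m w') = 0.
    have -> : \sum_k B k *m (prj k *m w') = Bb *m w'.
      by rewrite mulmx_suml; apply: eq_bigr => k _; rewrite mulmxA.
    by rewrite mulmxBr !mulmxA hs' mul1mx subrr.
  move/(lrefl_ker H) => [z hz].
  have ew : w' = Ab *m z.
    rewrite -[w']mul1mx -hs !mulmx_suml; apply: eq_bigr => k _.
    by rewrite -!mulmxA hz (mulmxA (g k)) gf mul1mx.
  have -> : (Ab *m (r *m (1%:M - s *m Bb)) + s *m Bb) *m w = Ab *m (r *m w') + s *m (Bb *m w).
    by rewrite mulmxDl -!mulmxA mulmxBl mul1mx -mulmxA.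
  by rewrite ew (mulmxA r) hr mul1mx -ew subrK.
have tA : t *m Ab = 1%:M.
  by rewrite /t -mulmxA mulmxBl mul1mx -mulmxA BA0 mulmx0 subr0.
exists (fun k => t *m inj k), (fun k => prj k *m s); split.
- by rewrite -tA /Ab mulmx_sumr; apply: eq_bigr => k _; rewrite !mulmxA.
- by rewrite -hs' /Bb mulmx_suml; apply: eq_bigr => k _; rewrite !mulmxA.
- move=> k; have := congr1 (fun M => prj k *m M *m inj k) At.
  by rewrite mulmx1 h1 mulmxDr mulmxDl !mulmxA pA -(mulmxA _ Bb) pB => <-.
- move=> k l kl; have := congr1 (fun M => prj k *m M *m inj l) At.
  by rewrite mulmx1 h0 // mulmxDr mulmxDl !mulmxA pA -(mulmxA _ Bb) pB => <-.
Qed.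

(** The transpose of a split exact sequence is exact in the opposite order, so the source and target
    of the reflection change places. The signs are those of the transposition $\tau$. *)
Lemma lrefl_dual : lrefl (fun k => (B' k)^T) (fun k => - (A' k)^T)
  (fun k => (B k)^T) (fun k => - (A k)^T) (fun k => (f k)^T) c.
Proof.
have [r [s [rA Bs dg off]]] := lrefl_split; split.
- move=> z hz; apply: trmx_inj; rewrite trmx0 -[z^T]mulmx1 -Bs mulmx_sumr big1 // => k _.
  rewrite mulmxA; have -> : z^T *m B k = 0.
    by apply: trmx_inj; rewrite trmx_mul trmxK trmx0.
  by rewrite mul0mx.
- move=> u; split => [hu|[z hz]].
    have hu' : \sum_k (A' k)^T *m u k = 0.
      apply/eqP; rewrite -oppr_eq0 -sumrN; apply/eqP; rewrite -[RHS]hu.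
      by apply: eq_bigr => k _; rewrite mulNmx.
    exists (\sum_l (s l)^T *m ((f l)^T *m u l)) => k; rewrite mulmx_sumr.
    have e l : (B k)^T *m ((s l)^T *m ((f l)^T *m u l)) =
       (s l *m B k)^T *m ((f l)^T *m u l) by rewrite mulmxA trmx_mul.
    have e2 l : (g l *m A' l *m r k)^T *m ((f l)^T *m u l) = (r k)^T *m ((A' l)^T *m u l).
      rewrite -mulmxA trmx_mul (trmx_mul (A' l)) -!mulmxA; congr (_ *m (_ *m _)).
      by rewrite mulmxA -trmx_mul fg trmx1 mul1mx.
    have -> : (f k)^T *m u k = (f k)^T *m u k - (r k)^T *m \sum_l ((A' l)^T *m u l).
      by rewrite hu' mulmx0 subr0.
    rewrite mulmx_sumr; apply/eqP; rewrite -subr_eq opprK -big_split /=; apply/eqP.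
    rewrite (bigD1 k) //= big1 ?addr0 => [|l lk].
      by rewrite e -e2 -mulmxDl addrC -linearD /= dg trmx1 mul1mx.
    by rewrite e -e2 -mulmxDl addrC -linearD /= off // trmx0 mul0mx.
  have e k : - (A' k)^T *m u k = - ((B k *m (g k *m A' k))^T *m z).
    rewrite trmx_mul -mulmxA hz trmx_mul -mulmxA (mulmxA (g k)^T) -trmx_mul fg.
    by rewrite trmx1 mul1mx mulNmx.
  under eq_bigr => k _ do rewrite e.
  rewrite sumrN -mulmx_suml -linear_sum /=.
  have -> : \sum_k B k *m (g k *m A' k) = 0; last by rewrite trmx0 mul0mx oppr0.
  apply: mulmx_ext => w; rewrite mulmx_suml mul0mx -[RHS](lrefl_comp0 w).
  by apply: eq_bigr => k _; rewrite !mulmxA.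
- move=> z; exists (fun k => - ((r k *m g k)^T *m z)).
  rewrite -[RHS]mul1mx -[in RHS]trmx1 -rA linear_sum mulmx_suml.
  by apply: eq_bigr => k _; rewrite mulmxN mulNmx opprK mulmxA -trmx_mul.
- move=> k l kl; rewrite !mulmxN !mulNmx; congr (- _).
  by rewrite -!trmx_mul !mulmxA -(lrefl_off H) 1?eq_sym.
- move=> k; rewrite !mulmxN !mulNmx -!trmx_mul opprK addrC !mulmxA.
  by rewrite -linearB /= (lrefl_diag H) linearZ.
Qed.

(** Sn is the image under b of the sum U of the S k; it is stable under a because a b = a' b' + c.
    Since a' embeds T in the kernel of b on U, the rank formula gives the inequality. If c != 0,
    every w of this kernel is - c^-1 a' b' w with b' w in T, whence equality. *)
Lemma lrefl_dims (S : forall k, {vspace 'cV[F]_(d k)}) (T : {vspace 'cV[F]_n'}) :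
  (forall z k, z \in T -> g k *m (A' k *m z) \in S k) ->
  (forall k u, u \in S k -> B' k *m (f k *m u) \in T) ->
  exists Sn : {vspace 'cV[F]_n},
    [/\ (forall k u, u \in S k -> B k *m u \in Sn) /\
        (forall z k, z \in Sn -> A k *m z \in S k),
        (\dim Sn + \dim T <= \sum_k \dim (S k))%N,
        c != 0 -> (\dim Sn + \dim T = \sum_k \dim (S k))%N
      & (forall k, S k = fullv) -> Sn = fullv].
Proof.
move=> hA hB.
have [inj [prj [h1 h0 hs]]] := @biproduct F K d.
have [U UP dU] := vspace_block h1 h0 hs S.
pose Ab := \sum_k inj k *m g k *m A' k; pose Bb := \sum_k B k *m prj k.
have pA k : prj k *m Ab = g k *m A' k.
  rewrite mulmx_sumr [LHS](bigD1 k) //= [X in _ + X]big1 ?addr0 => [|l lk].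
    by rewrite !mulmxA h1 mul1mx.
  by rewrite !mulmxA h0 1?eq_sym // !mul0mx.
have BbE (w : 'cV_(\sum_l d l)) : Bb *m w = \sum_k B k *m (prj k *m w).
  by rewrite mulmx_suml; apply: eq_bigr => k _; rewrite mulmxA.
have pAE k z : prj k *m (Ab *m z) = g k *m (A' k *m z) by rewrite mulmxA pA mulmxA.
have [r hr] : exists r, r *m Ab = 1%:M.
  apply: linv_of_inj => z hz; apply: (lrefl_inj H) => k.
  have -> : A' k = f k *m (prj k *m Ab) by rewrite pA mulmxA fg mul1mx.
  by rewrite -!mulmxA hz !mulmx0.
have hT z : z \in T -> Ab *m z \in U by move=> hz; apply/UP => k; rewrite pAE hA.
have BA0 (z : 'cV_n') : Bb *m (Ab *m z) = 0.
  by rewrite BbE -[RHS](lrefl_comp0 z); apply: eq_bigr => k _; rewrite pAE.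
have kerE : (mximg Ab T <= U :&: lker (linfun (mulmx Bb)))%VS.
  apply/subvP => w /mximgP [z hz ->]; rewrite memv_cap hT //= memv_ker lfunE /=.
  by rewrite BA0.
have dimE := limg_ker_dim (linfun (mulmx Bb)) U.
exists (mximg Bb U); split.
- split=> [k u hu|z k /mximgP [w /UP hw ->]].
    have e l : prj l *m (inj k *m u) \in S l.
      rewrite mulmxA; case: (eqVneq l k) => [->|lk]; first by rewrite h1 mul1mx.
      by rewrite h0 // mul0mx mem0v.
    have -> : B k *m u = Bb *m (inj k *m u).
      rewrite BbE [RHS](bigD1 k) //= [X in _ + X]big1 ?addr0 => [|l lk]; first by rewrite (mulmxA (prj k)) h1 mul1mx.
      by rewrite (mulmxA (prj l)) h0 // mul0mx mulmx0.
    by apply: mem_mximg; apply/UP.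
  have V := lrefl_vec (fun k => prj k *m w) k.
  have -> : A k *m (Bb *m w) = g k *m (A' k *m \sum_l B' l *m (f l *m (prj l *m w)))
       + c *: (prj k *m w).
    move: V; rewrite -BbE => /(congr1 (mulmx (g k))); rewrite mulmxBr -scalemxAr.
    by rewrite !(mulmxA (g k) (f k)) gf !mul1mx => /eqP; rewrite subr_eq addrC => /eqP.
  apply: memvD; last by apply: memvZ; apply: hw.
  by apply: hA; apply: memv_suml => l _; apply: hB; apply: hw.
- rewrite -dU -dimE addnC leq_add2r -(dim_mximg T hr); exact: dimvS.
- move=> c0; rewrite -dU -dimE addnC; congr (_ + _)%N; rewrite -(dim_mximg T hr).
  apply/eqP; rewrite eqn_leq dimvS //=; apply: dimvS; apply/subvP => w.
  rewrite memv_cap memv_ker lfunE /= => /andP [/UP hw /eqP e].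
  have V k := lrefl_vec (fun k => prj k *m w) k.
  rewrite -[w]mul1mx -hs mulmx_suml.
  pose z := - c^-1 *: \sum_l B' l *m (f l *m (prj l *m w)).
  have -> : \sum_k inj k *m prj k *m w = Ab *m z.
    rewrite mulmx_suml; apply: eq_bigr => k _; rewrite -!mulmxA; congr (_ *m _).
    have := V k; rewrite -BbE e !mulmx0 sub0r => /(congr1 (fun M => c^-1 *: (g k *m M))).
    rewrite -scalemxAr scalerA mulVf // scale1r (mulmxA (g k) (f k)) gf mul1mx => <-.
    by rewrite /z -!scalemxAr mulmxN scalerN scaleNr.
  apply: mem_mximg; apply: memvZ; apply: memv_suml => l _; apply: hB; exact: hw.
- move=> hS; apply/eqP; rewrite eqEsubv subvf /=; apply/subvP => z _.
  have [u <-] := lrefl_surj H z.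
  have -> : \sum_k B k *m u k = Bb *m (\sum_k inj k *m u k).
    rewrite BbE; apply: eq_bigr => k _; congr (_ *m _).
    rewrite mulmx_sumr [RHS](bigD1 k) //= [X in _ + X]big1 ?addr0 => [|l lk]; first by rewrite mulmxA h1 mul1mx.
    by rewrite mulmxA h0 1?eq_sym // mul0mx.
  by apply: mem_mximg; apply/UP => k; rewrite hS memvf.
Qed.

End Theory.

(** Both a' identify their source with the kernel of b, which gives the isomorphism. As a' is
    injective, a' b' = a b - c then determines b'. *)
Lemma lrefl_unique (d d1 d2 : K -> nat) (n n1 n2 : nat)
  (A : forall k, 'M[F]_(d k, n)) (B : forall k, 'M[F]_(n, d k))
  (A1 : forall k, 'M[F]_(d1 k, n1)) (B1 : forall k, 'M[F]_(n1, d1 k))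
  (A2 : forall k, 'M[F]_(d2 k, n2)) (B2 : forall k, 'M[F]_(n2, d2 k))
  (f1 : forall k, 'M[F]_(d1 k, d k)) (g1 : forall k, 'M[F]_(d k, d1 k))
  (f2 : forall k, 'M[F]_(d2 k, d k)) (g2 : forall k, 'M[F]_(d k, d2 k)) (c : F) :
  (forall k, g1 k *m f1 k = 1%:M) -> (forall k, f1 k *m g1 k = 1%:M) ->
  (forall k, g2 k *m f2 k = 1%:M) -> (forall k, f2 k *m g2 k = 1%:M) ->
  lrefl A B A1 B1 f1 c -> lrefl A B A2 B2 f2 c ->
  exists h hi, [/\ hi *m h = 1%:M, h *m hi = 1%:M,
    forall k, A2 k *m h = f2 k *m g1 k *m A1 k
    & forall k, h *m B1 k = B2 k *m (f2 k *m g1 k)].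
Proof.
move=> gf1 fg1 gf2 fg2 H1 H2.
have [h [hi [e1 e2 hA]]] : exists h hi, [/\ hi *m h = 1%:M, h *m hi = 1%:M
   & forall z : 'cV_n1, forall k, A2 k *m (h *m z) = f2 k *m g1 k *m (A1 k *m z)].
  apply: (linear_rel_iso (P := fun z z2 => forall k, A2 k *m z2 = f2 k *m g1 k *m (A1 k *m z))).
  - move=> a y z y' z' hz hz' k.
    by rewrite !mulmxDr -!scalemxAr hz hz'.
  - move=> y; have := lrefl_comp0 fg1 H1 y => /(lrefl_ker H2) [z hz].
    by exists z => k; rewrite hz !mulmxA.
  - move=> z; have := lrefl_comp0 fg2 H2 z => /(lrefl_ker H1) [y hy].
    exists y => k; rewrite hy -!mulmxA (mulmxA (g1 k)) gf1 mul1mx mulmxA fg2.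
    by rewrite mul1mx.
  - by move=> z hz; apply: (lrefl_inj H2) => k; rewrite hz !mulmx0.
  - move=> y hy; apply: (lrefl_inj H1) => k.
    have := hy k => /esym /(congr1 (mulmx (f1 k *m g2 k))).
    by rewrite !mulmx0 !mulmxA -(mulmxA (f1 k)) gf2 mulmx1 fg1 mul1mx.
have hA2 k : A2 k *m h = f2 k *m g1 k *m A1 k.
  by apply: mulmx_ext => z; rewrite -!mulmxA hA !mulmxA.
exists h, hi; split => // k; apply/eqP; rewrite -subr_eq0; apply/eqP.
apply: mulmx_ext => w; rewrite mul0mx; apply: (lrefl_inj H2) => l.
rewrite mulmxBl mulmxBr -(mulmxA h) hA -!mulmxA.
have V1 := lrefl_vec1 H1 l (g1 k *m w); have V2 := lrefl_vec1 H2 l (g1 k *m w).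
move: V1; rewrite (mulmxA (f1 k)) fg1 mul1mx => /(congr1 (mulmx (f2 l *m g1 l))).
rewrite mulmxBr -scalemxAr !(mulmxA _ (f1 l)) -!(mulmxA _ (g1 l) (f1 l)) gf1 mulmx1.
rewrite -V2 -!mulmxA => /addrI /oppr_inj ->.
by rewrite subrr.
Qed.

Lemma lrefl_conj (d d' e e' : K -> nat) (n n' m m' : nat)
  (A : forall k, 'M[F]_(d k, n)) (B : forall k, 'M[F]_(n, d k))
  (A' : forall k, 'M[F]_(d' k, n')) (B' : forall k, 'M[F]_(n', d' k))
  (f : forall k, 'M[F]_(d' k, d k)) (c : F)
  (a : forall k, 'M[F]_(e k, d k)) (ai : forall k, 'M[F]_(d k, e k))
  (b : forall k, 'M[F]_(e' k, d' k)) (bi : forall k, 'M[F]_(d' k, e' k))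
  (h : 'M[F]_(m, n)) (hi : 'M[F]_(n, m)) (h' : 'M[F]_(m', n')) (hi' : 'M[F]_(n', m')) :
  (forall k, ai k *m a k = 1%:M) -> (forall k, a k *m ai k = 1%:M) ->
  (forall k, bi k *m b k = 1%:M) -> (forall k, b k *m bi k = 1%:M) ->
  hi *m h = 1%:M -> h *m hi = 1%:M -> hi' *m h' = 1%:M -> h' *m hi' = 1%:M ->
  lrefl A B A' B' f c ->
  lrefl (fun k => a k *m A k *m hi) (fun k => h *m B k *m ai k)
    (fun k => b k *m A' k *m hi') (fun k => h' *m B' k *m bi k)
    (fun k => b k *m f k *m ai k) c.
Proof.
move=> aia aai bib bbi hih hhi hih' hhi' H.
have sE (u : forall k, 'cV_(e k)) : \sum_k h *m B k *m ai k *m u k =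
    h *m \sum_k B k *m (ai k *m u k).
  by rewrite mulmx_sumr; apply: eq_bigr => k _; rewrite !mulmxA.
split.
- move=> z hz; have : hi' *m z = 0.
    apply: (lrefl_inj H) => k; have := hz k => /(congr1 (mulmx (bi k))).
    by rewrite mulmx0 !mulmxA bib mul1mx.
  by move=> /(congr1 (mulmx h')); rewrite mulmxA hhi' mul1mx mulmx0.
- move=> u; rewrite sE; split => [hu|[z hz]].
    have : \sum_k B k *m (ai k *m u k) = 0.
      by rewrite -[LHS]mul1mx -hih -mulmxA hu mulmx0.
    move/(lrefl_ker H) => [z hz]; exists (h' *m z) => k.
    by rewrite -!mulmxA (mulmxA hi') hih' mul1mx hz.
  suff -> : \sum_k B k *m (ai k *m u k) = 0 by rewrite mulmx0.
  apply/(lrefl_ker H); exists (hi' *m z) => k.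
  by have := hz k => /(congr1 (mulmx (bi k))); rewrite !mulmxA bib !mul1mx.
- move=> z; have [u hu] := lrefl_surj H (hi *m z).
  exists (fun k => a k *m u k); rewrite sE.
  under eq_bigr => k _ do rewrite (mulmxA (ai k)) aia mul1mx.
  by rewrite hu mulmxA hhi mul1mx.
- move=> k l kl; have := lrefl_off H kl => /(congr1 (fun M => b k *m M *m ai l)).
  rewrite !mulmxA => e0.
  rewrite -!(mulmxA _ (ai k) (a k)) aia mulmx1 -!(mulmxA _ hi h) hih mulmx1 e0.
  by rewrite -!(mulmxA _ hi' h') hih' mulmx1 -!(mulmxA _ (bi l) (b l)) bib mulmx1.
- move=> k; have := lrefl_diag H k => /(congr1 (fun M => b k *m M *m ai k)).
  rewrite mulmxBr mulmxBl !mulmxA -!scalemxAr -scalemxAl => e0.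
  rewrite -!(mulmxA _ (ai k) (a k)) aia mulmx1 -!(mulmxA _ hi h) hih mulmx1.
  by rewrite -!(mulmxA _ hi' h') hih' mulmx1 -!(mulmxA _ (bi k) (b k)) bib mulmx1 e0.
Qed.

(** The new space is the kernel of b and a' its inclusion. By the equation b a = c the endomorphism
    a b - c ([L] below) is killed by b, so it factors through that kernel, and b' is the factor. *)
Lemma lrefl_exists (d d' : K -> nat) (n n' : nat)
  (A : forall k, 'M[F]_(d k, n)) (B : forall k, 'M[F]_(n, d k))
  (f : forall k, 'M[F]_(d' k, d k)) (g : forall k, 'M[F]_(d k, d' k)) (c : F) :
  (forall k, g k *m f k = 1%:M) -> (forall k, f k *m g k = 1%:M) ->
  (n + n' = \sum_k d k)%N ->
  (forall z, exists u : (forall k, 'cV_(d k)), \sum_k B k *m u k = z) ->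
  \sum_k B k *m A k = c%:M ->
  exists A' B', @lrefl d d' n n' A B A' B' f c.
Proof.
move=> gf fg dn surj BA.
have [inj [prj [h1 h0 hs]]] := @biproduct F K d.
pose Bb := \sum_k B k *m prj k.
have BbE (w : 'cV_(\sum_l d l)) : Bb *m w = \sum_k B k *m (prj k *m w).
  by rewrite mulmx_suml; apply: eq_bigr => k _; rewrite mulmxA.
pose gl (u : forall k, 'cV_(d k)) := \sum_k inj k *m u k.
have prgl u k : prj k *m gl u = u k.
  rewrite mulmx_sumr [LHS](bigD1 k) //= [X in _ + X]big1 ?addr0 => [|l lk].
    by rewrite mulmxA h1 mul1mx.
  by rewrite mulmxA h0 1?eq_sym // mul0mx.
have [s hs'] : exists s, Bb *m s = 1%:M.
  apply: rinv_of_surj => z; have [u <-] := surj z; exists (gl u).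
  by rewrite BbE; apply: eq_bigr => k _; rewrite prgl.
have rkB : \rank Bb^T = n.
  by rewrite mxrank_tr; apply/eqP; apply/row_freeP; exists s.
pose Kr := kermx Bb^T.
have rK : \rank Kr = n' by rewrite mxrank_ker rkB -dn addKn.
pose Kb : 'M_(n', \sum_l d l) := castmx (rK, erefl _) (row_base Kr).
have eKb : (Kb :=: Kr)%MS.
  have cE m (e : \rank Kr = m) : (castmx (e, erefl _) (row_base Kr) :=: Kr)%MS.
    by case: m / e; rewrite castmx_id; exact: eq_row_base.
  exact: cE.
have /row_freeP [r hr] : row_free Kb by rewrite /row_free eKb rK.
pose Ab := Kb^T.
have rA : r^T *m Ab = 1%:M by rewrite -trmx_mul hr trmx1.
have BA0 : Bb *m Ab = 0.
  apply: trmx_inj; rewrite trmx_mul trmxK trmx0; apply/sub_kermxP.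
  by rewrite -/Kr eKb.
have kerB w : Bb *m w = 0 -> exists z : 'cV_n', w = Ab *m z.
  move=> hw; have : (w^T <= Kb)%MS.
    by rewrite eKb; apply/sub_kermxP; rewrite -trmx_mul hw trmx0.
  by move=> /submxP [D e]; exists D^T; rewrite -trmx_mul -e trmxK.
pose L := \sum_k inj k *m A k *m Bb - c%:M.
have BL : Bb *m L = 0.
  rewrite mulmxBr mul_mx_scalar mulmx_sumr.
  suff -> : \sum_k Bb *m (inj k *m A k *m Bb) = (\sum_k B k *m A k) *m Bb.
    by rewrite BA mul_scalar_mx subrr.
  rewrite mulmx_suml; apply: eq_bigr => k _; rewrite !mulmxA; congr (_ *m _ *m _).
  apply: mulmx_ext => w; rewrite -mulmxA BbE [LHS](bigD1 k) //= [X in _ + X]big1 ?addr0 => [|l lk].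
    by rewrite (mulmxA (prj k)) h1 mul1mx.
  by rewrite (mulmxA (prj l)) h0 // mul0mx mulmx0.
have AL : Ab *m (r^T *m L) = L.
  apply: mulmx_ext => w; have [|z hz] := kerB (L *m w); first by rewrite mulmxA BL mul0mx.
  by rewrite -!mulmxA hz (mulmxA r^T) rA mul1mx.
have pL k l : prj k *m L *m inj l = A k *m B l - c *: (prj k *m inj l).
  rewrite mulmxBr mulmxBl mul_mx_scalar -scalemxAl; congr (_ - _).
  rewrite mulmx_sumr mulmx_suml [LHS](bigD1 k) //= [X in _ + X]big1 ?addr0 => [|j jk].
    rewrite !mulmxA h1 mul1mx -mulmxA; congr (_ *m _).
    apply: mulmx_ext => w; rewrite -mulmxA BbE [LHS](bigD1 l) //= [X in _ + X]big1 ?addr0 => [|j jl].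
      by rewrite (mulmxA (prj l)) h1 mul1mx.
    by rewrite (mulmxA (prj j)) h0 // mul0mx mulmx0.
  by rewrite !mulmxA h0 1?eq_sym // !mul0mx.
have pAB k l : f k *m prj k *m Ab *m (r^T *m L *m inj l *m g l) *m f l
    = f k *m (prj k *m L *m inj l).
  rewrite -!mulmxA gf mulmx1; do 2!congr (_ *m _).
  by rewrite (mulmxA r^T) (mulmxA Ab) AL.
exists (fun k => f k *m prj k *m Ab), (fun k => r^T *m L *m inj k *m g k); split.
- move=> z hz; rewrite -[z]mul1mx -rA -mulmxA.
  have -> : Ab *m z = 0; last by rewrite mulmx0.
  rewrite -[_ *m z]mul1mx -hs mulmx_suml [LHS]big1 // => k _.
  have := hz k => /(congr1 (mulmx (g k))); rewrite !mulmxA gf mul1mx mulmx0 => e.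
  by rewrite -!mulmxA (mulmxA (prj k)) e mulmx0.
- move=> u; split => [hu|[z hz]].
    have [|z hz] := kerB (gl u).
      by rewrite BbE -[RHS]hu; apply: eq_bigr => k _; rewrite prgl.
    by exists z => k; rewrite -!mulmxA -hz prgl.
  have e k : u k = prj k *m (Ab *m z).
    by have := hz k => /(congr1 (mulmx (g k))); rewrite !mulmxA gf !mul1mx.
  under eq_bigr => k _ do rewrite e.
  by rewrite -BbE mulmxA BA0 mul0mx.
- exact: surj.
- move=> k l kl; rewrite pAB pL h0 // scaler0 subr0 -!mulmxA.
  by [].
- by move=> k; rewrite pAB pL h1 mulmxBr -mulmxA opprB addrC subrK -scalemxAr mulmx1.
Qed.
End Local.

(** * Isomorphisms of representations *)

Lemma sum_tagged (A : nmodType) (K : finType) (T : K -> finType) (F : {k : K & T k} -> A) :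
  \sum_t F t = \sum_k \sum_(x : T k) F (Tagged T x).
Proof. by rewrite sig_big_dep /=; apply: eq_bigr => -[]. Qed.

Lemma big_option (A : nmodType) (T : finType) (F : option T -> A) :
  \sum_k F k = F None + \sum_t F (Some t).
Proof.
rewrite (bigD1 None) //=; congr (_ + _).
rewrite (reindex_omap Some id) /=; first by apply: eq_bigl => t; rewrite eqxx.
by case.
Qed.

Section Riso.
Variables (R : realType) (G : dgraph) (w : vtx G -> nat).
Local Notation C := (R[i]).
Local Notation I := (vtx G).
Implicit Types (v : I -> int) (i j : I).

(* U_i = W_i (+) (sum over h with o(h) = i of V_(i(h))): the index None stands
   for the summand W_i. *)
Definition star_ix i : finType := option {j : I & arr i j}.

Definition sdim v i (k : star_ix i) : nat :=
  if k is Some e then `|v (tag e)|%N else w i.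

Definition lA v (x : rep R w v) i (k : star_ix i) : 'M[C]_(sdim v k, `|v i|) :=
  match k with Some e => rx x (tagged e) | None => rq x i end.

Definition lB v (x : rep R w v) i (k : star_ix i) : 'M[C]_(`|v i|, sdim v k) :=
  match k with Some e => (eps (tagged e))%:~R *: rx x (rv (tagged e)) | None => rp x i end.

Definition ufam v i (u : Uspace R w v i) (k : star_ix i) : 'cV[C]_(sdim v k) :=
  match k with Some e => u.2 (tag e) (tagged e) | None => u.1 end.

Definition famu v i (u : forall k : star_ix i, 'cV[C]_(sdim v k)) : Uspace R w v i :=
  (u None, fun j h => u (Some (Tagged (fun j => arr i j) h))).

Lemma famuK v i (u : forall k : star_ix i, 'cV[C]_(sdim v k)) k :
  ufam (famu u) k = u k.
Proof. by case: k => [[j h]|]. Qed.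

Lemma ufamK v i (u : Uspace R w v i) : famu (ufam u) = u.
Proof. by case: u. Qed.

Lemma bmapE v i (x : rep R w v) (u : Uspace R w v i) :
  bmap x u = \sum_k lB x k *m ufam u k.
Proof.
rewrite big_option /bmap; congr (_ + _); rewrite sum_tagged.
by apply: eq_bigr => j _; apply: eq_bigr => h _; rewrite scalemxAl.
Qed.

Lemma ufam_amap v i (x : rep R w v) y k : ufam (amap x y : Uspace R w v i) k = lA x k *m y.
Proof. by case: k => [[j h]|]. Qed.

Lemma eps_rvN i j (h : arr i j) : eps (rv h) = - eps h.
Proof. by apply/eqP; rewrite -addr_eq0 addrC eps_rv. Qed.

Lemma eps_sq i j (h : arr i j) : eps h * eps h = 1.
Proof. by case: (eps_sign h) => ->. Qed.

Lemma rv_bij i j : bijective (@rv G i j).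
Proof. by exists (@rv G j i); exact: rvK. Qed.

(** Passing from incoming to outgoing edges reverses each h and changes the sign of $\varepsilon$.
    Hence $\mu_i=-b_ia_i$, the origin of the minus signs in front of the parameters below. *)
Lemma muE v (x : rep R w v) i : mu x i = - \sum_(k : star_ix i) lB x k *m lA x k.
Proof.
rewrite big_option opprD addrC /mu; congr (_ - _).
rewrite -sumrN (sum_tagged (T := arr i)); apply: eq_bigr => j _.
rewrite (reindex (@rv G i j)) /=; last by apply: onW_bij; exact: rv_bij.
by apply: eq_bigr => h _; rewrite rvK eps_rvN mulrNz scaleNr scalemxAl.
Qed.

Lemma in_LambdaP v (zc : I -> C) (x : rep R w v) :
  in_Lambda zc x <-> forall i, \sum_(k : star_ix i) lB x k *m lA x k = (- zc i)%:M.
Proof.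
split=> h i; have := h i; rewrite muE; first by move/eqP; rewrite eqr_oppLR => /eqP ->; rewrite raddfN.
by move=> ->; rewrite raddfN opprK.
Qed.

Definition ufm v v' (f : forall j, 'M[C]_(`|v' j|, `|v j|)) i (k : star_ix i) :
  'M[C]_(sdim v' k, sdim v k) :=
  match k with Some e => f (tag e) | None => 1%:M end.

(** Two dimension vectors are allowed, so that the ends of different words can be compared before
    their vectors are known to agree. *)
Definition riso v v' (x : rep R w v) (y : rep R w v') : Prop :=
  exists (g : forall i, 'M[C]_(`|v' i|, `|v i|)) (g' : forall i, 'M[C]_(`|v i|, `|v' i|)),
  [/\ forall i, g' i *m g i = 1%:M, forall i, g i *m g' i = 1%:M,
      forall i j (h : arr i j), g j *m rx x h = rx y h *m g i,
      forall i, g i *m rp x i = rp y i & forall i, rq x i = rq y i *m g i].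

Lemma riso_refl v (x : rep R w v) : riso x x.
Proof.
exists (fun=> 1%:M), (fun=> 1%:M); split => *; rewrite ?mulmx1 ?mul1mx //.
Qed.

Lemma riso_sym v v' (x : rep R w v) (y : rep R w v') : riso x y -> riso y x.
Proof.
move=> [g [g' [h1 h2 hx hp hq]]]; exists g', g; split => //.
- move=> i j h; have := hx i j h => /(congr1 (fun M => g' j *m M *m g' i)).
  by rewrite !mulmxA h1 mul1mx -!mulmxA h2 mulmx1.
- by move=> i; rewrite -hp mulmxA h1 mul1mx.
- by move=> i; rewrite hq -mulmxA h2 mulmx1.
Qed.

Lemma riso_trans v v' v'' (x : rep R w v) (y : rep R w v') (z : rep R w v'') :
  riso x y -> riso y z -> riso x z.
Proof.
move=> [g [g' [h1 h2 hx hp hq]]] [f [f' [e1 e2 fx fp fq]]].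
exists (fun i => f i *m g i), (fun i => g' i *m f' i); split.
- by move=> i; rewrite -mulmxA (mulmxA (f' i)) e1 mul1mx h1.
- by move=> i; rewrite -mulmxA (mulmxA (g i)) h2 mul1mx e2.
- by move=> i j h; rewrite -mulmxA hx mulmxA fx mulmxA.
- by move=> i; rewrite -mulmxA hp fp.
- by move=> i; rewrite hq fq mulmxA.
Qed.

Lemma riso_dim v v' (x : rep R w v) (y : rep R w v') i :
  riso x y -> `|v i|%N = `|v' i|%N.
Proof.
move=> [g [g' [h1 h2 _ _ _]]]; apply/eqP; rewrite eqn_leq.
apply/andP; split.
  have := mulmx1_min (h1 i); done.
have := mulmx1_min (h2 i); done.
Qed.

End Riso.

(** * Reflections of representations *)

Lemma lrefl_ext (F : fieldType) (K : finType) (d d' : K -> nat) (n n' : nat)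
  (A A1 : forall k, 'M[F]_(d k, n)) (B B1 : forall k, 'M[F]_(n, d k))
  (A' A1' : forall k, 'M[F]_(d' k, n')) (B' B1' : forall k, 'M[F]_(n', d' k))
  (f f1 : forall k, 'M[F]_(d' k, d k)) (c : F) :
  (forall k, A k = A1 k) -> (forall k, B k = B1 k) ->
  (forall k, A' k = A1' k) -> (forall k, B' k = B1' k) ->
  (forall k, f k = f1 k) ->
  lrefl A B A' B' f c -> lrefl A1 B1 A1' B1' f1 c.
Proof.
move=> /(@boolp.functional_extensionality_dep _ _ _ _) <- /(@boolp.functional_extensionality_dep _ _ _ _) <-.
move=> /(@boolp.functional_extensionality_dep _ _ _ _) <- /(@boolp.functional_extensionality_dep _ _ _ _) <-.
by move=> /(@boolp.functional_extensionality_dep _ _ _ _) <-.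
Qed.

Section Hrefl.
Variables (R : realType) (G : dgraph) (w : vtx G -> nat).
Local Notation C := (R[i]).
Local Notation I := (vtx G).
Local Notation rep := (rep R w).
Implicit Types (v : I -> int) (i j : I).

(** The identifications f and g away from i replace the casts of [refl_rel], which makes the
    relation invariant under isomorphism at both ends. At i the spaces have different dimensions in
    general, so f and g are unconstrained there. *)
Record hrefl_at v v' i (c : C) (x : rep v) (y : rep v')
    (f : forall j, 'M[C]_(`|v' j|, `|v j|)) (g : forall j, 'M[C]_(`|v j|, `|v' j|)) : Prop :=
  HreflAt {
  hrefl_gf : forall j, j != i -> g j *m f j = 1%:M;
  hrefl_fg : forall j, j != i -> f j *m g j = 1%:M;
  hrefl_x : forall j k (h : arr j k), j != i -> k != i -> f k *m rx x h = rx y h *m f j;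
  hrefl_p : forall j, j != i -> f j *m rp x j = rp y j;
  hrefl_q : forall j, j != i -> rq x j = rq y j *m f j;
  hrefl_loc : lrefl (lA x (i := i)) (lB x (i := i)) (lA y (i := i)) (lB y (i := i))
                (ufm w f (i := i)) c }.

Definition hrefl v v' i (c : C) (x : rep v) (y : rep v') : Prop :=
  exists f g, hrefl_at i c x y f g.

Lemma tag_neq i (e : {j : I & arr i j}) : tag e != i.
Proof. exact: arr_neq (tagged e). Qed.

Lemma ufmK v v' i (f : forall j, 'M[C]_(`|v' j|, `|v j|)) (g : forall j, 'M[C]_(`|v j|, `|v' j|)) :
  (forall j, j != i -> g j *m f j = 1%:M) ->
  forall k : star_ix i, ufm w g k *m ufm w f k = 1%:M.
Proof. by move=> h [e|] /=; rewrite ?mulmx1 // h // tag_neq. Qed.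

Lemma ufm_comp v v' v'' i (f : forall j, 'M[C]_(`|v' j|, `|v j|))
  (g : forall j, 'M[C]_(`|v'' j|, `|v' j|)) (k : star_ix i) :
  ufm w (fun j => g j *m f j) k = ufm w g k *m ufm w f k.
Proof. by case: k => [e|] //=; rewrite mulmx1. Qed.

Lemma rxlB v (x : rep v) i j (h : arr j i) :
  rx x h = (eps (rv h))%:~R *: lB x (Some (Tagged (fun j => arr i j) (rv h))).
Proof. by rewrite /= scalerA -intrM eps_sq scale1r rvK. Qed.

Lemma riso_lA v v' (x : rep v) (y : rep v') g :
  (forall i j (h : arr i j), g j *m rx x h = rx y h *m g i) ->
  (forall i, rq x i = rq y i *m g i) ->
  forall i (k : star_ix i), ufm w g k *m lA x k = lA y k *m g i.
Proof. by move=> hx hq i [e|] /=; rewrite ?mul1mx. Qed.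

Lemma riso_lB v v' (x : rep v) (y : rep v') g :
  (forall i j (h : arr i j), g j *m rx x h = rx y h *m g i) ->
  (forall i, g i *m rp x i = rp y i) ->
  forall i (k : star_ix i), g i *m lB x k = lB y k *m ufm w g k.
Proof. by move=> hx hp i [e|] /=; rewrite ?mulmx1 // -scalemxAr -scalemxAl hx. Qed.

Lemma hrefl_at_riso v v' v1 v1' i c (x : rep v) (y : rep v') (x1 : rep v1) (y1 : rep v1')
    f fi g g' l l' :
  [/\ forall i, g' i *m g i = 1%:M, forall i, g i *m g' i = 1%:M,
      forall i j (h : arr i j), g j *m rx x h = rx x1 h *m g i,
      forall i, g i *m rp x i = rp x1 i & forall i, rq x i = rq x1 i *m g i] ->
  [/\ forall i, l' i *m l i = 1%:M, forall i, l i *m l' i = 1%:M,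
      forall i j (h : arr i j), l j *m rx y h = rx y1 h *m l i,
      forall i, l i *m rp y i = rp y1 i & forall i, rq y i = rq y1 i *m l i] ->
  hrefl_at i c x y f fi ->
  hrefl_at i c x1 y1 (fun j => l j *m f j *m g' j) (fun j => g j *m fi j *m l' j).
Proof.
move=> [e1 e2 hx hp hq] [e1' e2' hx' hp' hq'] [gf fg fx fp fq loc]; split.
- move=> j ji; rewrite -!mulmxA (mulmxA (l' j)) e1' mul1mx (mulmxA (fi j)) gf //.
  by rewrite mul1mx e2.
- move=> j ji; rewrite -!mulmxA (mulmxA (g' j)) e1 mul1mx (mulmxA (f j)) fg //.
  by rewrite mul1mx e2'.
- move=> j k h ji ki.
  have -> : rx x1 h = g k *m rx x h *m g' j by rewrite hx -mulmxA e2 mulmx1.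
  rewrite -!mulmxA (mulmxA (g' k)) e1 mul1mx (mulmxA (f k)) fx //.
  by rewrite !mulmxA hx'.
- move=> j ji; rewrite -!mulmxA -hp (mulmxA (g' j)) e1 mul1mx fp //.
- move=> j ji; rewrite !mulmxA -hq' -fq // hq -mulmxA e2 mulmx1 //.
- have := lrefl_conj (a := ufm w g (i := i)) (ai := ufm w g' (i := i))
    (b := ufm w l (i := i)) (bi := ufm w l' (i := i))
    (h := g i) (hi := g' i) (h' := l i) (hi' := l' i) _ _ _ _ _ _ _ _ loc.
  move=> /(_ (ufmK (fun j _ => e1 j)) (ufmK (fun j _ => e2 j))
    (ufmK (fun j _ => e1' j)) (ufmK (fun j _ => e2' j)) (e1 i) (e2 i) (e1' i) (e2' i)).
  apply: lrefl_ext => k.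
  + by rewrite (riso_lA hx hq) -mulmxA e2 mulmx1.
  + by rewrite (riso_lB hx hp) -mulmxA (ufmK (i := i) (fun j _ => e2 j)) mulmx1.
  + by rewrite (riso_lA hx' hq') -mulmxA e2' mulmx1.
  + by rewrite (riso_lB hx' hp') -mulmxA (ufmK (i := i) (fun j _ => e2' j)) mulmx1.
  + by rewrite -!ufm_comp.
Qed.

Lemma hrefl_riso v v' v1 v1' i c (x : rep v) (y : rep v') (x1 : rep v1) (y1 : rep v1') :
  riso x x1 -> riso y y1 -> hrefl i c x y -> hrefl i c x1 y1.
Proof.
move=> [g [g' hg]] [l [l' hl]] [f [fi hf]].
by do 2!eexists; exact: (hrefl_at_riso hg hl hf).
Qed.

Lemma hrefl_inv v v' i c (x : rep v) (y : rep v') :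
  c != 0 -> hrefl i c x y -> hrefl i (- c) y x.
Proof.
move=> c0 [f [fi [gf fg fx fp fq loc]]]; exists fi, f; split => //.
- move=> j k h ji ki; have := fx j k h ji ki => /(congr1 (fun M => fi k *m M *m fi j)).
  by rewrite !mulmxA gf // mul1mx -!mulmxA fg // mulmx1.
- by move=> j ji; rewrite -fp // mulmxA gf // mul1mx.
- by move=> j ji; rewrite fq // -mulmxA fg // mulmx1.
- exact: lrefl_inv (ufmK gf) (ufmK fg) loc c0.
Qed.

Lemma eps_unit i j (h : arr i j) : (eps h)%:~R != 0 :> C.
Proof. by case: (eps_sign h) => ->; rewrite ?oppr_eq0 ?oner_eq0 // mulrN1z oppr_eq0 oner_eq0. Qed.

(** The isomorphism of [lrefl_unique] at i is completed by [f2 j *m g1 j] elsewhere. Edges leaving i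
    are read off a_i, those entering i off b_i through their reversals. *)
Lemma hrefl_unique v v1 v2 i c (x : rep v) (y1 : rep v1) (y2 : rep v2) :
  hrefl i c x y1 -> hrefl i c x y2 -> riso y1 y2.
Proof.
move=> [f1 [g1 [gf1 fg1 fx1 fp1 fq1 loc1]]] [f2 [g2 [gf2 fg2 fx2 fp2 fq2 loc2]]].
have [h [hi [e1 e2 hA hB]]] := lrefl_unique (ufmK gf1) (ufmK fg1) (ufmK gf2) (ufmK fg2) loc1 loc2.
pose g := dfwith (T := fun j => 'M[C]_(`|v2 j|, `|v1 j|)) (fun j => f2 j *m g1 j) h.
pose gi := dfwith (T := fun j => 'M[C]_(`|v1 j|, `|v2 j|)) (fun j => f1 j *m g2 j) hi.
have gi_i : g i = h by rewrite /g dfwith_in.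
have gj j : j != i -> g j = f2 j *m g1 j by move=> ji; rewrite /g dfwith_out 1?eq_sym.
have ug k : ufm w g k = ufm w f2 k *m ufm w g1 k :> 'M_(_, sdim w v1 (k : star_ix i)).
  by case: k => [e|] /=; rewrite ?mulmx1 // gj // tag_neq.
have Eo k (l : arr i k) : g k *m rx y1 l = rx y2 l *m g i.
  have := hA (Some (Tagged (fun j => arr i j) l)); rewrite -ug /= => <-.
  by rewrite gi_i.
have Ei j (l : arr j i) : g i *m rx y1 l = rx y2 l *m g j.
  have := hB (Some (Tagged (fun j => arr i j) (rv l))); rewrite -ug => e.
  by rewrite gi_i (rxlB y1 l) (rxlB y2 l) -scalemxAr e -[RHS]scalemxAl.
have x1 j k (l : arr j k) : j != i -> k != i -> rx y1 l = f1 k *m rx x l *m g1 j.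
  by move=> ji ki; rewrite fx1 // -mulmxA fg1 // mulmx1.
exists g, gi; split.
- move=> j; case: (eqVneq j i) => [->|ji]; first by rewrite gi_i /gi dfwith_in.
  rewrite gj // /gi dfwith_out 1?eq_sym // -!mulmxA (mulmxA (g2 j)) gf2 // mul1mx.
  by rewrite fg1.
- move=> j; case: (eqVneq j i) => [->|ji]; first by rewrite gi_i /gi dfwith_in.
  rewrite gj // /gi dfwith_out 1?eq_sym // -!mulmxA (mulmxA (g1 j)) gf1 // mul1mx.
  by rewrite fg2.
- move=> j k l; case: (eqVneq j i) => [ji|ji]; first by move: l; rewrite ji => l; exact: Eo.
  case: (eqVneq k i) => [ki|ki]; first by move: l; rewrite ki => l; exact: Ei.
  rewrite !gj // x1 // -!mulmxA (mulmxA (g1 k)) gf1 // mul1mx mulmxA fx2 //.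
  by rewrite mulmxA.
- move=> j; case: (eqVneq j i) => [->|ji].
    by have := hB None; rewrite gi_i /= mulmx1 mulmx1.
  by rewrite gj // -fp1 // -mulmxA (mulmxA (g1 j)) gf1 // mul1mx fp2.
- move=> j; case: (eqVneq j i) => [->|ji].
    by have := hA None; rewrite gi_i /= !mul1mx => ->.
  by rewrite gj // mulmxA -fq2 // fq1 // -mulmxA fg1 // mulmx1.
Qed.

(** At i this is b' a' = - c. At j != i only the loops through i change, and the diagonal relation
    shifts each by c; their number is the number of edges between i and j, as in the formula for
    s_i. *)
Lemma hrefl_Lambda v v' i (z : I -> C) (x : rep v) (y : rep v') :
  hrefl i (srefl i z i) x y -> in_Lambda z x -> in_Lambda (srefl i z) y.
Proof.
move=> [f [g [gf fg fx fp fq loc]]] /in_LambdaP hx; apply/in_LambdaP => j.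
case: (eqVneq j i) => [->|ji]; first exact: lrefl_BA' (ufmK fg) loc.
pose t (k : star_ix j) : bool := if k is Some e then tag e == i else false.
have E (k : star_ix j) : lB y k *m lA y k =
   f j *m (lB x k *m lA x k) *m g j + (t k)%:R *: (srefl i z i)%:M.
  case: k => [[k h]|] /=; last first.
    by rewrite scale0r addr0 -fp // [rq x j]fq // !mulmxA -!mulmxA fg // mulmx1.
  case: (eqVneq k i) => [ki|ki]; last first.
    rewrite scale0r addr0 -scalemxAl -[in RHS]scalemxAl -scalemxAr -scalemxAl; congr (_ *: _).
    by rewrite !mulmxA fx // -!mulmxA; congr (_ *m _); rewrite mulmxA fx // -mulmxA fg // mulmx1.
  subst k; rewrite scale1r.
  have := lrefl_diag loc (Some (Tagged (fun j => arr i j) (rv h))) => /=.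
  rewrite !rvK -!scalemxAr -!scalemxAl eps_rvN mulrNz !scaleNr opprK => e.
  have {e} := congr1 (fun M => M *m g j) e.
  rewrite mulmxDl mulNmx -!scalemxAl fg // scalemx1 -!mulmxA fg // mulmx1 => <-.
  by rewrite -[X in f j *m X]scalemxAl -scalemxAr -!mulmxA addNKr.
rewrite (eq_bigr _ (fun k _ => E k)) big_split /= -mulmx_suml -mulmx_sumr hx.
rewrite mul_mx_scalar -scalemxAl fg // -scaler_suml scalemx1 scale_scalar_mx -raddfD /=.
congr (_%:M); rewrite srefl_same mulrN -opprD; congr (- _).
rewrite srefl_neq 1?eq_sym //; congr (_ + _); rewrite big_option add0r sum_tagged /=.
rewrite (bigD1 i) //= [X in _ + X]big1 ?addr0; last first.
  by move=> k /negbTE ki; rewrite big1 // => h _; rewrite ki.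
by rewrite eqxx sumr_const card_arrC mulr_natl.
Qed.

End Hrefl.

(** Without loops, the edges out of i, into i and away from i form disjoint classes, so a dependent
    family can be prescribed on each class separately. *)
Lemma edge_cases (G : dgraph) (P : forall j k : vtx G, arr j k -> Type) (i : vtx G)
    (Fo : forall k (h : arr i k), P i k h) (Fi : forall j (h : arr j i), P j i h)
    (Fr : forall j k (h : arr j k), P j k h) :
  exists F : forall j k (h : arr j k), P j k h,
  [/\ forall k h, F i k h = Fo k h, forall j h, F j i h = Fi j h
    & forall j k h, j != i -> k != i -> F j k h = Fr j k h].
Proof.
pose H j := dfwith (T := fun k => forall h : arr j k, P j k h) (Fr j) (Fi j).
pose F := dfwith (T := fun j => forall k (h : arr j k), P j k h) H Fo.
exists F; split => [k h|j h|j k h ji ki].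
- by rewrite /F dfwith_in.
- by rewrite /F dfwith_out ?/H ?dfwith_in // arr_neq.
- by rewrite /F dfwith_out 1?eq_sym // /H dfwith_out 1?eq_sym.
Qed.

Section Idm.
Variable F : fieldType.

(** Defined for all sizes, it stands for a cast without requiring a proof that the sizes agree. *)
Definition idm m n : 'M[F]_(m, n) := pid_mx m.

Lemma idm_id n : idm n n = 1%:M.
Proof. exact: pid_mx_1. Qed.

Lemma idmK m n : m = n -> idm m n *m idm n m = 1%:M.
Proof. by move=> ->; rewrite /idm pid_mx_1 mulmx1. Qed.

Lemma castmx_idm m m' n n' (e : (m = m') * (n = n')) (A : 'M[F]_(m, n)) :
  castmx e A = idm m' m *m A *m idm n n'.
Proof.
case: e => em en; case: m' / em; case: n' / en.
by rewrite castmx_id /idm !pid_mx_1 mulmx1 mul1mx.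
Qed.

End Idm.

(** * Existence of reflected representations *)

Section Exists.
Variables (R : realType) (G : dgraph) (w : vtx G -> nat).
Local Notation C := (R[i]).
Local Notation I := (vtx G).
Local Notation rep := (rep R w).
Implicit Types (v : I -> int) (i j : I).

Lemma hrefl_at_ext v v' i c (x : rep v) (y : rep v') f g f1 g1 :
  (forall j, j != i -> f j = f1 j) -> (forall j, j != i -> g j = g1 j) ->
  hrefl_at i c x y f g -> hrefl_at i c x y f1 g1.
Proof.
move=> ef eg [gf fg fx fp fq loc]; split.
- by move=> j ji; rewrite -eg // -ef // gf.
- by move=> j ji; rewrite -eg // -ef // fg.
- by move=> j k h ji ki; rewrite -!ef // fx.
- by move=> j ji; rewrite -ef // fp.
- by move=> j ji; rewrite -ef // fq.
- apply: lrefl_ext loc => // -[e|] //=; by rewrite ef // tag_neq.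
Qed.

Definition idmf v v' : forall j, 'M[C]_(`|v' j|, `|v j|) := fun j => idm C _ _.

(** Bridge between the relation of the definitions, with its casts and vectors of U_i, and the
    matrix relation on which all further arguments rest. *)
Lemma refl_relP v i c (x : rep v) (x' : rep (star1 w i v)) :
  refl_rel c x x' <-> hrefl_at i c x x' (idmf v _) (idmf _ v).
Proof.
pose v' := star1 w i v.
have dv j : j != i -> `|v j|%N = `|v' j|%N by exact: dim_star1.
have gf j : j != i -> idmf v' v j *m idmf v v' j = 1%:M by move=> ji; apply: idmK; apply: dv.
have fg j : j != i -> idmf v v' j *m idmf v' v j = 1%:M by move=> ji; apply: idmK; rewrite dv.
have uE (u : Uspace R w v i) k : ufam (Ucast u) k = ufm w (idmf v v') k *m ufam u k.
  case: k => [[j h]|] /=; last by rewrite mul1mx.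
  by rewrite castmx_idm idm_id mulmx1.
have uinj v0 (u u' : Uspace R w v0 i) : (forall k, ufam u k = ufam u' k) -> u = u'.
  move=> h; rewrite -[u]ufamK -[u']ufamK /famu; congr (_, _) => //=.
  - exact: (h None).
  - apply: boolp.functional_extensionality_dep => j.
    apply: funext => l; exact: (h (Some (Tagged (fun j => arr i j) l))).
have bE (u : Uspace R w v i) : bmap x' (Ucast u) =
    \sum_k lB x' k *m (ufm w (idmf v v') k *m ufam u k).
  by rewrite bmapE; apply: eq_bigr => k _; rewrite uE.
split.
- move=> [[ex ep eq_] [ainj ker surj] vec]; split => //.
  + move=> j k h ji ki; rewrite ex castmx_idm -!mulmxA -/(idmf v' v j) .
    by rewrite (_ : idm C `|v j|%N `|v' j|%N *m _ = 1%:M) ?mulmx1 //; exact: gf.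
  + by move=> j ji; rewrite ep castmx_idm idm_id mulmx1.
  + move=> j ji; rewrite eq_ castmx_idm idm_id mul1mx.
    by rewrite -mulmxA (_ : idm C `|v j|%N `|v' j|%N *m _ = 1%:M) ?mulmx1 //; exact: gf.
  + have [h0 h1] : (forall k l : star_ix i, k != l ->
        ufm w (idmf v v') k *m lA x k *m lB x l = lA x' k *m lB x' l *m ufm w (idmf v v') l) /\
        (forall k : star_ix i, ufm w (idmf v v') k *m lA x k *m lB x k -
          lA x' k *m lB x' k *m ufm w (idmf v v') k = c *: ufm w (idmf v v') k).
      apply/(@lrefl_vecP _ (star_ix i) (sdim w v (i := i)) (sdim w v' (i := i))) => u k.
      have [e1 e2] := vec (famu u).
      have uk l : ufam (famu u) l = u l := famuK u l.
      have bx : bmap x (famu u) = \sum_l lB x l *m u l.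
        by rewrite bmapE; apply: eq_bigr => l _; rewrite uk.
      have bx' : bmap x' (Ucast (famu u)) = \sum_l lB x' l *m (ufm w (idmf v v') l *m u l).
        by rewrite bE; apply: eq_bigr => l _; rewrite uk.
      rewrite -bx -bx' -[lA x k *m _]ufam_amap -[lA x' k *m _]ufam_amap.
      rewrite -[in RHS](uk k) -!uE.
      by case: k => [[j h]|]; [exact: e2 | exact: e1].
    split => //.
    * move=> z hz; apply: ainj; apply: uinj => k.
      by rewrite !ufam_amap hz mulmx0.
    * move=> u.
      have bx : bmap x (famu u) = \sum_l lB x l *m u l.
        by rewrite bmapE; apply: eq_bigr => l _; rewrite famuK.
      rewrite -bx ker; split => -[z hz]; exists z.
        by move=> k; rewrite -ufam_amap hz uE famuK.
      by apply: uinj => k; rewrite ufam_amap hz uE famuK.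
    * move=> z; have [u <-] := surj z; exists (ufam u); by rewrite bmapE.
- move=> [_ _ fx fp fq loc]; split.
  + split.
    * move=> j k h ji ki; rewrite castmx_idm -/(idmf v' v j) -/(idmf v v' k) fx //.
      by rewrite -mulmxA fg // mulmx1.
    * by move=> j ji; rewrite castmx_idm -/(idmf v v' j) fp // idm_id mulmx1.
    * move=> j ji; rewrite castmx_idm fq // idm_id mul1mx.
      by rewrite -mulmxA fg // mulmx1.
  + split.
    * move=> z1 z2 e; apply/eqP; rewrite -subr_eq0; apply/eqP; apply: (lrefl_inj loc) => k.
      by rewrite mulmxBr -!ufam_amap e subrr.
    * move=> u; rewrite bmapE (lrefl_ker loc); split => -[z hz]; exists z.
        by apply: uinj => k; rewrite ufam_amap hz uE.
      by move=> k; rewrite -ufam_amap hz uE.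
    * move=> z; have [u <-] := lrefl_surj loc z; exists (famu u).
      by rewrite bmapE; apply: eq_bigr => k _; rewrite famuK.
  + move=> u ab ab'.
    have e k : ufam ab k - ufam ab' k = c *: ufam (Ucast u) k.
      rewrite !uE ufam_amap [ufam ab' k]ufam_amap bE bmapE.
      by have := lrefl_vec loc (ufam u) k.
    by split; [exact: (e None) | move=> j h; exact: (e (Some (Tagged (fun j => arr i j) h)))].
Qed.

Lemma rep_transport v v' (y : rep v) (l : forall j, 'M[C]_(`|v' j|, `|v j|))
    (l' : forall j, 'M[C]_(`|v j|, `|v' j|)) :
  (forall j, l' j *m l j = 1%:M) -> (forall j, l j *m l' j = 1%:M) ->
  exists y1 : rep v',
  [/\ forall i, l' i *m l i = 1%:M, forall i, l i *m l' i = 1%:M,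
      forall i j (h : arr i j), l j *m rx y h = rx y1 h *m l i,
      forall i, l i *m rp y i = rp y1 i & forall i, rq y i = rq y1 i *m l i].
Proof.
move=> e1 e2.
exists (@Rep R G w v' (fun i j h => l j *m rx y h *m l' i) (fun i => l i *m rp y i)
         (fun i => rq y i *m l' i)); split => //=.
- by move=> i j h; rewrite -!mulmxA e1 mulmx1.
- by move=> i; rewrite -!mulmxA e1 mulmx1.
Qed.

(** Transporting y along [idmf v v' j *m g j] away from i turns the identifications into the
    standard ones, so a reflection is always isomorphic to one in the sense of the definitions. *)
Lemma hrefl_star1 v i c (x : rep v) (y : rep (star1 w i v)) :
  hrefl i c x y -> exists2 y', riso y y' & refl_rel (i := i) c x y'.
Proof.
move=> [f [g H]]; pose v' := star1 w i v.
have dv j : j != i -> `|v j|%N = `|v' j|%N by exact: dim_star1.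
pose l := dfwith (T := fun j => 'M[C]_(`|v' j|, `|v' j|))
   (fun j => idmf v v' j *m g j) (1%:M : 'M_`|v' i|).
pose l' := dfwith (T := fun j => 'M[C]_(`|v' j|, `|v' j|))
   (fun j => f j *m idmf v' v j) (1%:M : 'M_`|v' i|).
have li : l i = 1%:M by rewrite /l dfwith_in.
have li' : l' i = 1%:M by rewrite /l' dfwith_in.
have lj j : j != i -> l j = idmf v v' j *m g j by move=> ji; rewrite /l dfwith_out 1?eq_sym.
have lj' j : j != i -> l' j = f j *m idmf v' v j by move=> ji; rewrite /l' dfwith_out 1?eq_sym.
have id1 j : j != i -> idmf v' v j *m idmf v v' j = 1%:M by move=> ji; apply: idmK; apply: dv.
have id2 j : j != i -> idmf v v' j *m idmf v' v j = 1%:M by move=> ji; apply: idmK; rewrite dv.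
have [|| y1 hy] := @rep_transport _ _ y l l'.
- move=> j; case: (eqVneq j i) => [->|ji]; first by rewrite li li' mulmx1.
  by rewrite lj // lj' // -mulmxA (mulmxA (idmf v' v j)) id1 // mul1mx (hrefl_fg H).
- move=> j; case: (eqVneq j i) => [->|ji]; first by rewrite li li' mulmx1.
  by rewrite lj // lj' // -mulmxA (mulmxA (g j)) (hrefl_gf H) // mul1mx id2.
exists y1; first by exists l, l'.
have hx : [/\ forall i, 1%:M *m 1%:M = 1%:M :> 'M[C]_`|v i|,
      forall i, 1%:M *m 1%:M = 1%:M :> 'M[C]_`|v i|,
      forall i j (h : arr i j), 1%:M *m rx x h = rx x h *m 1%:M,
      forall i, 1%:M *m rp x i = rp x i & forall i, rq x i = rq x i *m 1%:M].
  by split => *; rewrite ?mulmx1 ?mul1mx.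
apply/refl_relP; apply: hrefl_at_ext (hrefl_at_riso hx hy H) => j ji /=.
- by rewrite mulmx1 lj // -mulmxA (hrefl_gf H) // mulmx1.
- by rewrite mul1mx lj' // mulmxA (hrefl_gf H) // mul1mx.
Qed.

Lemma hrefl_exists v v' i c (x : rep v) :
  (forall j, j != i -> `|v j|%N = `|v' j|%N) ->
  (`|v i| + `|v' i| = \sum_(k : star_ix i) sdim w v k)%N ->
  (forall z, exists u : (forall k : star_ix i, 'cV_(sdim w v k)), \sum_k lB x k *m u k = z) ->
  \sum_(k : star_ix i) lB x k *m lA x k = c%:M ->
  exists y : rep v', hrefl i c x y.
Proof.
move=> dv dN surj BA.
pose f := idmf v v'; pose g := idmf v' v.
have gf j : j != i -> g j *m f j = 1%:M by move=> ji; apply: idmK; apply: dv.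
have fg j : j != i -> f j *m g j = 1%:M by move=> ji; apply: idmK; rewrite dv.
have [A' [B' loc]] := lrefl_exists (d' := sdim w v' (i := i)) (f := ufm w f (i := i))
   (g := ufm w g (i := i)) (ufmK w gf) (ufmK w fg) dN surj BA.
pose ix j (h : arr i j) : star_ix i := Some (Tagged (fun j => arr i j) h).
(* The three families are the components of a', those of b' with the sign of b_i removed, and the
   edges of x away from i. *)
have [X [Xo Xi Xr]] := @edge_cases G (fun j k _ => 'M[C]_(`|v' k|, `|v' j|)) i
  (fun k h => A' (ix k h)) (fun j h => (eps (rv h))%:~R *: B' (ix j (rv h)))
  (fun j k h => f k *m rx x h *m g j).
pose y := @Rep R G w v' X
  (dfwith (T := fun j => 'M[C]_(`|v' j|, w j)) (fun j => f j *m rp x j) (B' None))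
  (dfwith (T := fun j => 'M[C]_(w j, `|v' j|)) (fun j => rq x j *m g j) (A' None)).
exists y, f, g; split => //.
- by move=> j k h ji ki /=; rewrite Xr // -!mulmxA gf // mulmx1.
- by move=> j ji /=; rewrite dfwith_out 1?eq_sym.
- by move=> j ji /=; rewrite dfwith_out 1?eq_sym // -mulmxA gf // mulmx1.
- apply: lrefl_ext loc => // -[[j h]|] /=; rewrite ?Xo ?Xi ?dfwith_in //.
  by rewrite rvK scalerA -intrM eps_sq scale1r.
Qed.

End Exists.

(** * Semistability under reflections *)

Lemma sumPosz (T : finType) (P : pred T) (F : T -> nat) :
  (\sum_(t | P t) F t)%N%:Z = \sum_(t | P t) (F t)%:Z.
Proof. exact: (big_morph Posz PoszD (erefl _)). Qed.

Section Semistable.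
Variables (R : realType) (G : dgraph) (w : vtx G -> nat).
Local Notation C := (R[i]).
Local Notation I := (vtx G).
Local Notation rep := (rep R w).
Implicit Types (v : I -> int) (i j : I).

(** D is the part of the framing carried by S. With D = 0 these are the stable subspaces inside ker
    q, with D = W those containing im p, so both semistability conditions are handled at once. *)
Definition fsub v (x : rep v) (D : forall i, {vspace 'cV[C]_(w i)}) (S : gsub R v) : Prop :=
  [/\ stable x S, forall i u, u \in D i -> rp x i *m u \in S i
    & forall i u, u \in S i -> rq x i *m u \in D i].

Definition fr0 : forall i, {vspace 'cV[C]_(w i)} := fun=> 0%VS.
Definition fr1 : forall i, {vspace 'cV[C]_(w i)} := fun=> fullv.

Definition theta v (xi : I -> R) (S : gsub R v) : R := \sum_i xi i *+ \dim (S i).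

Lemma fsub0P v (x : rep v) S :
  fsub x fr0 S <-> stable x S /\ (forall i u, u \in S i -> rq x i *m u = 0).
Proof.
split=> [[h1 _ h]|[h1 h]].
  by split => // i u hu; have := h i u hu; rewrite memv0 => /eqP.
split => // i u; last by move=> /h ->; exact: mem0v.
by rewrite memv0 => /eqP ->; rewrite mulmx0 mem0v.
Qed.

Lemma fsub1P v (x : rep v) S :
  fsub x fr1 S <-> stable x S /\ (forall i (u : 'cV[C]_(w i)), rp x i *m u \in S i).
Proof.
split=> [[h1 h _]|[h1 h]]; first by split => // i u; apply: h; exact: memvf.
by split => // i u _; exact: memvf.
Qed.

Lemma semistableP v (xi : I -> R) (x : rep v) :
  semistable xi x <->
  (forall S, fsub x fr0 S -> theta xi S <= 0) /\
  (forall S, fsub x fr1 S -> theta xi S <= \sum_i xi i *~ v i).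
Proof.
split=> -[h0 h1]; split.
- by move=> S /fsub0P [a b]; exact: h0.
- by move=> S /fsub1P [a b]; exact: h1.
- by move=> S a b; apply: h0; apply/fsub0P.
- by move=> S a b; apply: h1; apply/fsub1P.
Qed.

Definition sstable v (xi : I -> R) (x : rep v) : Prop :=
  [/\ semistable xi x,
     forall S, fsub x fr0 S -> theta xi S = 0 -> forall i, S i = 0%VS
   & forall S, fsub x fr1 S -> theta xi S = \sum_i xi i *~ v i -> forall i, S i = fullv].

Lemma dim_cV n : \dim {:'cV[C]_n} = n.
Proof. by rewrite dimvf /dim /= muln1. Qed.

Definition sfr v i (D : forall i, {vspace 'cV[C]_(w i)}) (S : gsub R v) (k : star_ix i) :
   {vspace 'cV[C]_(sdim w v k)} :=
  match k with Some e => S (tag e) | None => D i end.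

Lemma sum_star v i (D : forall i, {vspace 'cV[C]_(w i)}) (S : gsub R v) :
  (\sum_(k : star_ix i) \dim (sfr D S k) =
   \dim (D i) + \sum_j #|arr i j| * \dim (S j))%N.
Proof.
rewrite big_option sum_tagged /=; congr (_ + _)%N; apply: eq_bigr => j _.
by rewrite sum_nat_const.
Qed.

(** A subobject is pulled back along g away from i; at i it is the space given by [lrefl_dims], the
    image under b_i of the part of U_i lying in S. *)
Lemma fsub_hrefl v v' i c (x : rep v) (y : rep v') D (S' : gsub R v') :
  hrefl i c x y -> fsub y D S' ->
  exists S : gsub R v,
  [/\ fsub x D S, forall j, j != i -> \dim (S j) = \dim (S' j),
   (\dim (S i) + \dim (S' i) <= \dim (D i) + \sum_j #|arr i j| * \dim (S j))%N
   & c != 0 -> (\dim (S i) + \dim (S' i) = \dim (D i) + \sum_j #|arr i j| * \dim (S j))%N].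
Proof.
move=> [f [g [gf fg fx fp fq loc]]] [st hp hq].
pose S0 : gsub R v := fun j => mximg (g j) (S' j).
have S0P j u : j != i -> u \in S0 j <-> f j *m u \in S' j.
  move=> ji; split=> [/mximgP [s hs ->]|h]; first by rewrite mulmxA fg // mul1mx.
  by rewrite -[u]mul1mx -(gf j ji) -mulmxA; exact: mem_mximg.
have ugf := ufmK w gf; have ufg := ufmK w fg.
have sP (k : star_ix i) u : u \in sfr D S0 k <-> ufm w f k *m u \in sfr D S' k.
  by case: k u => [e|] u /=; rewrite ?mul1mx // S0P ?tag_neq.
have SA z k : z \in S' i -> ufm w g k *m (lA y k *m z) \in sfr D S0 (k : star_ix i).
  move=> hz; apply/sP; rewrite mulmxA ufg mul1mx.
  by case: k => [[k h]|] /=; [exact: st | exact: hq].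
have SB (k : star_ix i) u : u \in sfr D S0 k -> lB y k *m (ufm w f k *m u) \in S' i.
  move=> /sP; case: k u => [[k h]|] u /= hu; last exact: hp.
  by rewrite -scalemxAl; apply: memvZ; exact: st.
have [Sn [[hB hA] dle deq _]] := lrefl_dims ugf ufg loc SA SB.
pose S : gsub R v := dfwith S0 Sn.
have Si : S i = Sn by rewrite /S dfwith_in.
have Sj j : j != i -> S j = S0 j by move=> ji; rewrite /S dfwith_out 1?eq_sym.
have sE (k : star_ix i) : sfr D S k = sfr D S0 k by case: k => [e|] //=; rewrite Sj ?tag_neq.
exists S; split.
- split.
  + move=> j k h u; case: (eqVneq j i) => [ji|ji].
      move: u h; rewrite ji => u h; rewrite Si => hu.
      by rewrite Sj ?(arr_neq h) //; exact: (hA u (Some (Tagged (fun j => arr i j) h))).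
    case: (eqVneq k i) => [ki|ki].
      move: h; rewrite ki Si Sj // => h hu; rewrite rxlB -scalemxAl; apply: memvZ.
      exact: (hB (Some (Tagged (fun j => arr i j) (rv h)))).
    rewrite !Sj // => /S0P - /(_ ji) hu; apply/S0P => //.
    by rewrite mulmxA fx // -mulmxA; exact: st.
  + move=> j u hu; case: (eqVneq j i) => [ji|ji].
      by move: u hu; rewrite ji Si => u hu; exact: (hB None).
    by rewrite Sj //; apply/S0P => //; rewrite mulmxA fp //; exact: hp.
  + move=> j u; case: (eqVneq j i) => [ji|ji].
      by move: u; rewrite ji Si => u hu; exact: (hA u None).
    by rewrite Sj // => /S0P - /(_ ji) hu; rewrite fq // -mulmxA; exact: hq.
- by move=> j ji; rewrite Sj //; exact: dim_mximg (fg j ji).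
- move: dle; rewrite -(eq_bigr _ (fun k _ => congr1 (fun V => \dim V) (sE k))).
  by rewrite sum_star Si.
- move=> /deq; rewrite -(eq_bigr _ (fun k _ => congr1 (fun V => \dim V) (sE k))).
  by rewrite sum_star Si.
Qed.

(** The last factor is the defect at i: it vanishes when b_i is the linear reflection of a, and
    otherwise records the framing or a loss of dimension. *)
Lemma srefl_pairing i (xi : I -> R) (a b : I -> int) :
  (forall j, j != i -> a j = b j) ->
  \sum_j srefl i xi j *~ b j = \sum_j xi j *~ a j
    + xi i *~ (\sum_j #|arr i j|%:Z * a j - a i - b i).
Proof.
move=> e; rewrite (bigD1 i) //= (bigD1 i (F := fun j => xi j *~ a j)) //= srefl_same.
have -> : \sum_(j | j != i) srefl i xi j *~ b j =
   \sum_(j | j != i) (xi j *~ a j + xi i *~ (#|arr i j|%:Z * a j)).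
  apply: eq_bigr => j ji; rewrite -e // srefl_neq 1?eq_sym // mulrzDl; congr (_ + _).
  by rewrite pmulrn -mulrzA.
rewrite big_split /= -mulrz_sumr [in RHS](bigD1 i (F := fun j => #|arr i j|%:Z * a j)) //=.
have -> : #|arr i i| = 0%N by apply: eq_card0 => h; case: (arr_irr h).
rewrite mul0r add0r !mulrzBr mulNrz.
move: (xi i *~ a i) (xi i *~ b i) (xi i *~ _) (\sum_(j | _) _) => p q s t.
ring.
Qed.

(** n is the dimension lost in [fsub_hrefl]. It is 0 if c != 0, and for $\xi_i<0$ its contribution
    $\xi_in$ is nonpositive, so semistability inequalities pass from x to y and equality forces n =
    0. *)
Lemma theta_hrefl v v' i c xi (x : rep v) (y : rep v') D (S' : gsub R v') :
  xi i < 0 \/ c != 0 ->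
  hrefl i c x y -> fsub y D S' ->
  exists (S : gsub R v) (n : nat),
  [/\ fsub x D S, forall j, j != i -> \dim (S j) = \dim (S' j),
   (\dim (S i) + \dim (S' i) + n = \dim (D i) + \sum_j #|arr i j| * \dim (S j))%N,
   theta (srefl i xi) S' = theta xi S + xi i *+ n - xi i *+ \dim (D i)
   & xi i *+ n <= 0 /\ (xi i *+ n = 0 -> n = 0%N)].
Proof.
move=> dir /fsub_hrefl h /h [S [fS dS dle deq]].
exists S, ((\dim (D i) + \sum_j #|arr i j| * \dim (S j)) - (\dim (S i) + \dim (S' i)))%N.
have n0 : c != 0 -> ((\dim (D i) + \sum_j #|arr i j| * \dim (S j)) -
    (\dim (S i) + \dim (S' i)))%N = 0%N by move=> /deq ->; rewrite subnn.
split => //.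
- by rewrite subnKC.
- rewrite /theta.
  have := @srefl_pairing i xi (fun j => (\dim (S j))%:Z) (fun j => (\dim (S' j))%:Z).
  move=> /(_ (fun j ji => congr1 Posz (dS j ji))).
  rewrite -[\sum_j srefl i xi j *~ _]/(\sum_j srefl i xi j *+ \dim (S' j)).
  rewrite -[\sum_j xi j *~ _]/(\sum_j xi j *+ \dim (S j)) => ->.
  rewrite -[RHS]addrA; congr (_ + _).
  rewrite !pmulrn -mulrzBr; congr (_ *~ _); rewrite -subzn //.
  rewrite !PoszD sumPosz; under [in RHS]eq_bigr => j _ do rewrite PoszM.
  by move: (\sum_j _) (\dim (D i))%:Z (\dim (S i))%:Z (\dim (S' i))%:Z => p q s t; ring.
- case: dir => [xi0|/n0 ->]; last by rewrite mulr0n.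
  split; first by rewrite mulrn_wle0 // ltW.
  by move/eqP; rewrite mulrn_eq0 (lt_eqF xi0) orbF => /eqP.
Qed.

Lemma star1_pairing v i (xi : I -> R) :
  \sum_j srefl i xi j *~ star1 w i v j = \sum_j xi j *~ v j - xi i *+ w i.
Proof.
rewrite (@srefl_pairing i xi v (star1 w i v)); last by move=> j /negbTE ji; rewrite /star1 ji.
congr (_ + _); rewrite pmulrn -mulrNz; congr (_ *~ _).
rewrite /star1 eqxx (bigD1 i) //= (bigD1 i (F := fun k => cartan i k * v k)) //= cartanii.
have -> : #|arr i i| = 0%N by apply: eq_card0 => h; case: (arr_irr h).
have -> : \sum_(k | k != i) cartan i k * v k = - \sum_(k | k != i) #|arr i k|%:Z * v k.
  by rewrite -sumrN; apply: eq_bigr => k ki; rewrite cartan_neq 1?eq_sym // mulNr.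
by set s := \sum_(k | _) _; lia.
Qed.

Lemma star1_dim v i : (forall j, 0 <= v j) -> (forall j, 0 <= star1 w i v j) ->
  (`|v i| + `|star1 w i v i| = w i + \sum_j #|arr i j| * `|v j|)%N.
Proof.
move=> v0 v'0; apply/eqP; rewrite -eqz_nat !PoszD !gez0_abs // sumPosz.
under eq_bigr => j _ do rewrite PoszM gez0_abs //.
rewrite /star1 eqxx (bigD1 i) //= (bigD1 i (F := fun k => #|arr i k|%:Z * v k)) //= cartanii.
have -> : #|arr i i| = 0%N by apply: eq_card0 => h; case: (arr_irr h).
have -> : \sum_(k | k != i) cartan i k * v k = - \sum_(k | k != i) #|arr i k|%:Z * v k.
  by rewrite -sumrN; apply: eq_bigr => k ki; rewrite cartan_neq 1?eq_sym // mulNr.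
by apply/eqP; set s := \sum_(k | _) _; lia.
Qed.

Lemma semistable_hrefl v i c xi (x : rep v) (y : rep (star1 w i v)) :
  xi i < 0 \/ c != 0 -> hrefl i c x y ->
  semistable xi x -> semistable (srefl i xi) y.
Proof.
move=> dir hxy /semistableP [h0 h1]; apply/semistableP; split => S' hS'.
  have [S [n [fS _ _ -> [xn _]]]] := theta_hrefl dir hxy hS'.
  by rewrite dimv0 mulr0n subr0 -[leRHS]addr0 lerD // h0.
have [S [n [fS _ _ -> [xn _]]]] := theta_hrefl dir hxy hS'.
rewrite star1_pairing dim_cV lerD2r -[leRHS]addr0; apply: lerD => //; exact: h1.
Qed.

(** Equality for S' forces equality for S. The stability of x then fixes all dimensions of S, and
    the dimension formula of [theta_hrefl] fixes that of S' at i. *)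
Lemma sstable_hrefl v i c xi (x : rep v) (y : rep (star1 w i v)) :
  (forall j, 0 <= v j) -> (forall j, 0 <= star1 w i v j) ->
  xi i < 0 \/ c != 0 -> hrefl i c x y ->
  sstable xi x -> sstable (srefl i xi) y.
Proof.
move=> v0 v'0 dir hxy [ss s0 s1]; split; first exact: semistable_hrefl hxy ss.
- move=> S' hS' t0.
  have [S [n [fS dS dn e [xn _]]]] := theta_hrefl dir hxy hS'.
  have /semistableP [h0 _] := ss.
  have tS : theta xi S = 0.
    apply/eqP; rewrite eq_le h0 //=; move: e; rewrite t0 dimv0 mulr0n subr0 => /esym /eqP.
    by rewrite addr_eq0 => /eqP ->; rewrite oppr_ge0.
  have S0 := s0 S fS tS.
  move=> j; apply/eqP; rewrite -dimv_eq0; case: (eqVneq j i) => [->|ji]; last first.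
    by rewrite -dS // S0 dimv0.
  move: dn; rewrite S0 !dimv0 big1 => [|k _]; last by rewrite S0 dimv0 muln0.
  by rewrite !add0n => /eqP; rewrite addn_eq0 => /andP [].
- move=> S' hS' t0.
  have [S [n [fS dS dn e [xn xn0]]]] := theta_hrefl dir hxy hS'.
  have /semistableP [_ h1] := ss; have l1 := h1 S fS.
  move: e; rewrite t0 star1_pairing dim_cV => /addIr e.
  have tS : theta xi S = \sum_j xi j *~ v j.
    apply/eqP; rewrite eq_le l1 /= e -[leRHS]addr0; exact: lerD.
  have S1 := s1 S fS tS.
  have n0 : n = 0%N.
    by apply: xn0; apply: (addrI (\sum_j xi j *~ v j)); rewrite addr0 -{1}tS -e.
  move=> j; apply/eqP; rewrite eqEdim subvf /= dim_cV.
  case: (eqVneq j i) => [->|ji]; last first.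
    by rewrite -dS // S1 dim_cV (dim_star1 w v ji).
  move: dn; rewrite n0 S1 !dim_cV addn0.
  under eq_bigr => k _ do rewrite S1 dim_cV.
  by rewrite -star1_dim // => /addnI ->.
Qed.

End Semistable.

(** * Transposition *)

Lemma dep_choice (A : Type) (T : A -> Type) (P : forall a, T a -> Prop) :
  (forall a, exists y, P a y) -> exists f : forall a, T a, forall a, P a (f a).
Proof. by move=> h; exists (fun a => sval (cid (h a))) => a; exact: svalP. Qed.

Section Tau.
Variables (R : realType) (G : dgraph) (w : vtx G -> nat).
Local Notation C := (R[i]).
Local Notation I := (vtx G).
Local Notation rep := (rep R w).
Implicit Types (v : I -> int) (i j : I).
Variable B : forall i, 'M[C]_(w i).
Hypothesis hB : forall i, B i \in unitmx.

(** The form on V is the identity; by [transpose_riso] any other nondegenerate choice gives an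
    isomorphic representation. *)
Definition tau1 v (x : rep v) : rep v := transpose (fun=> 1%:M) B x.

Lemma tau1_x v (x : rep v) i j (h : arr i j) : rx (tau1 x) h = (eps h)%:~R *: (rx x (rv h))^T.
Proof. by rewrite /= /adjmx invmx1 mulmx1 mul1mx. Qed.

Lemma tau1_p v (x : rep v) i : rp (tau1 x) i = - ((rq x i)^T *m B i).
Proof. by rewrite /= /adjmx invmx1 mul1mx. Qed.

Lemma tau1_q v (x : rep v) i : rq (tau1 x) i = invmx (B i) *m (rp x i)^T.
Proof. by rewrite /= /adjmx mulmx1. Qed.

Lemma transpose_riso v A (x : rep v) : (forall i, A i \in unitmx) ->
  riso (transpose A B x) (tau1 x).
Proof.
move=> hA; exists A, (fun i => invmx (A i)); split.
- by move=> i; rewrite mulVmx.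
- by move=> i; rewrite mulmxV.
- move=> i j h; rewrite tau1_x /= /adjmx -scalemxAr -scalemxAl; congr (_ *: _).
  by rewrite -mulmxA mulKVmx.
- by move=> i; rewrite tau1_p /= /adjmx mulmxN -mulmxA mulKVmx.
- by move=> i; rewrite tau1_q /= /adjmx.
Qed.

Lemma tau1_riso v v' (x : rep v) (y : rep v') : riso x y -> riso (tau1 x) (tau1 y).
Proof.
move=> [g [g' [e1 e2 hx hp hq]]].
exists (fun i => (g' i)^T), (fun i => (g i)^T); split.
- by move=> i; rewrite -trmx_mul e1 trmx1.
- by move=> i; rewrite -trmx_mul e2 trmx1.
- move=> i j h; rewrite !tau1_x -scalemxAr -scalemxAl -!trmx_mul; congr (_ *: _^T).
  have := hx j i (rv h) => /(congr1 (fun M => g' i *m M *m g' j)).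
  by rewrite !mulmxA e1 mul1mx -!mulmxA e2 mulmx1.
- move=> i; rewrite !tau1_p mulmxN mulmxA -trmx_mul; congr (- (_^T *m _)).
  by rewrite hq -mulmxA e2 mulmx1.
- by move=> i; rewrite !tau1_q -mulmxA -trmx_mul -hp mulmxA e1 mul1mx.
Qed.

(** The automorphism of U_i by which a_i and b_i of the transpose differ from the transposes of b_i
    and a_i up to sign; it comes from the form on W_i. *)
Definition tfr v i (k : star_ix i) : 'M[C]_(sdim w v k) :=
  match k with Some e => 1%:M | None => invmx (B i) end.
Definition tfrV v i (k : star_ix i) : 'M[C]_(sdim w v k) :=
  match k with Some e => 1%:M | None => B i end.

Lemma tfrK v i (k : star_ix i) : tfrV v k *m tfr v k = 1%:M.
Proof. by case: k => [e|] /=; rewrite ?mulmx1 ?mulmxV. Qed.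

Lemma tfrVK v i (k : star_ix i) : tfr v k *m tfrV v k = 1%:M.
Proof. by case: k => [e|] /=; rewrite ?mulmx1 ?mulVmx. Qed.

Lemma tau1_lA v (x : rep v) i (k : star_ix i) : lA (tau1 x) k = tfr v k *m (lB x k)^T.
Proof.
case: k => [[j h]|] /=; last by rewrite -tau1_q.
by rewrite linearZ /= /adjmx invmx1 mulmx1 !mul1mx.
Qed.

Lemma tau1_lB v (x : rep v) i (k : star_ix i) : lB (tau1 x) k = - (lA x k)^T *m tfrV v k.
Proof.
case: k => [[j h]|]; last by rewrite mulNmx -tau1_p.
rewrite /= /adjmx invmx1 !mulmx1 mul1mx rvK scalerA -intrM eps_rvN mulrN eps_sq.
by rewrite mulrN1z scaleN1r.
Qed.

Lemma tau1_Lambda v (z : I -> C) (x : rep v) :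
  in_Lambda z x -> in_Lambda (fun i => - z i) (tau1 x).
Proof.
move=> /in_LambdaP h; apply/in_LambdaP => i; rewrite opprK.
have -> : \sum_(k : star_ix i) lB (tau1 x) k *m lA (tau1 x) k =
   - (\sum_(k : star_ix i) lB x k *m lA x k)^T.
  rewrite linear_sum -sumrN; apply: eq_bigr => k _ /=.
  rewrite tau1_lA tau1_lB -mulmxA (mulmxA (tfrV v k)) tfrK mul1mx mulNmx.
  by rewrite -trmx_mul.
by rewrite h tr_scalar_mx raddfN opprK.
Qed.

(** By [lrefl_dual] the transposes are related in the opposite order, with the same constant c. *)
Lemma hrefl_tau v v' i c (x : rep v) (y : rep v') :
  hrefl i c x y -> hrefl i c (tau1 y) (tau1 x).
Proof.
move=> [f [g [gf fg fx fp fq loc]]].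
exists (fun j => (f j)^T), (fun j => (g j)^T); split.
- by move=> j ji; rewrite -trmx_mul fg // trmx1.
- by move=> j ji; rewrite -trmx_mul gf // trmx1.
- move=> j k h ji ki; rewrite !tau1_x -scalemxAr -scalemxAl -!trmx_mul; congr (_ *: _^T).
  by rewrite fx.
- move=> j ji; rewrite !tau1_p mulmxN mulmxA -trmx_mul; congr (- (_^T *m _)).
  by rewrite fq.
- by move=> j ji; rewrite !tau1_q -mulmxA -trmx_mul fp.
- have := lrefl_dual (ufmK w gf) (ufmK w fg) loc.
  move=> /(lrefl_conj (a := tfr v' (i := i)) (ai := tfrV v' (i := i))
    (b := tfr v (i := i)) (bi := tfrV v (i := i))
    (h := 1%:M) (hi := 1%:M) (h' := 1%:M) (hi' := 1%:M)
    (tfrK v' (i := i)) (tfrVK v' (i := i)) (tfrK v (i := i)) (tfrVK v (i := i))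
    (mulmx1 _) (mulmx1 _) (mulmx1 _) (mulmx1 _)).
  apply: lrefl_ext => k.
  + by rewrite mulmx1 tau1_lA.
  + by rewrite mul1mx tau1_lB.
  + by rewrite mulmx1 tau1_lA.
  + by rewrite mul1mx tau1_lB.
  + case: k => [e|] /=; first by rewrite mul1mx mulmx1.
    by rewrite trmx1 mulmx1 mulVmx.
Qed.

(** Annihilators exchange the subspaces inside ker q for the transpose with those containing im p
    for x. *)
Lemma fsub_tau0 v (x : rep v) (S : gsub R v) : fsub (tau1 x) (fr0 R w) S ->
  exists T : gsub R v, fsub x (fr1 R w) T /\ forall i, (\dim (S i) + \dim (T i) = `|v i|)%N.
Proof.
move=> /fsub0P [st hq]; have [T hT] := dep_choice (fun i => orth_vspace (S i)).
exists T; split; last by move=> i; case: (hT i).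
have TP i u : u \in T i <-> forall s, s \in S i -> s^T *m u = 0 by case: (hT i).
apply/fsub1P; split.
- move=> i j h u /TP hu; apply/TP => s hs.
  have := st j i (rv h) s hs; rewrite tau1_x rvK -scalemxAl => e.
  rewrite mulmxA -[s^T *m _]trmxK trmx_mul trmxK; apply: hu.
  by rewrite -[X in X \in _](scalerK (eps_unit R (rv h))) memvZ.
- move=> i u; apply/TP => s hs; rewrite mulmxA.
  have e0 : invmx (B i) *m ((rp x i)^T *m s) = 0 by rewrite mulmxA -tau1_q; exact: hq.
  have := congr1 (mulmx (B i)) e0; rewrite mulKVmx // mulmx0 => e.
  have -> : s^T *m rp x i = 0 by apply: trmx_inj; rewrite trmx_mul trmxK e trmx0.
  by rewrite mul0mx.
Qed.

Lemma fsub_tau1 v (x : rep v) (S : gsub R v) : fsub (tau1 x) (fr1 R w) S ->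
  exists T : gsub R v, fsub x (fr0 R w) T /\ forall i, (\dim (S i) + \dim (T i) = `|v i|)%N.
Proof.
move=> /fsub1P [st hp]; have [T hT] := dep_choice (fun i => orth_vspace (S i)).
exists T; split; last by move=> i; case: (hT i).
have TP i u : u \in T i <-> forall s, s \in S i -> s^T *m u = 0 by case: (hT i).
apply/fsub0P; split.
- move=> i j h u /TP hu; apply/TP => s hs.
  have := st j i (rv h) s hs; rewrite tau1_x rvK -scalemxAl => e.
  rewrite mulmxA -[s^T *m _]trmxK trmx_mul trmxK; apply: hu.
  by rewrite -[X in X \in _](scalerK (eps_unit R (rv h))) memvZ.
- move=> i u /TP hu; apply: trmx_inj; rewrite trmx_mul trmx0.
  apply: mulmx_ext => b; rewrite mul0mx -mulmxA.
  have := hu _ (hp i (- invmx (B i) *m b)).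
  rewrite tau1_p mulNmx mulNmx mulmxN opprK -mulmxA mulKVmx // => /(congr1 trmx).
  by rewrite trmx_mul trmxK trmx0.
Qed.

Lemma theta_compl v xi (S T : gsub R v) : (forall i, 0 <= v i) ->
  (forall i, (\dim (S i) + \dim (T i) = `|v i|)%N) ->
  theta (fun i => - xi i) S = theta xi T - \sum_i xi i *~ v i.
Proof.
move=> v0 h; rewrite /theta -sumrB; apply: eq_bigr => i _.
have -> : xi i *~ v i = xi i *+ (\dim (S i) + \dim (T i)) by rewrite h pmulrn gez0_abs.
by rewrite mulrnDr mulNrn addrC opprD subrK.
Qed.

Lemma semistable_tau v xi (x : rep v) : (forall i, 0 <= v i) ->
  semistable xi x -> semistable (fun i => - xi i) (tau1 x).
Proof.
move=> v0 /semistableP [h0 h1]; apply/semistableP; split => S.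
  by move=> /fsub_tau0 [T [fT d]]; rewrite (theta_compl _ v0 d) subr_le0 h1.
move=> /fsub_tau1 [T [fT d]]; rewrite (theta_compl _ v0 d).
have -> : \sum_i (- xi i) *~ v i = - \sum_i xi i *~ v i.
  by rewrite -sumrN; apply: eq_bigr => i _; rewrite mulNrz.
by rewrite gerDr h0.
Qed.

Lemma sstable_tau v xi (x : rep v) : (forall i, 0 <= v i) ->
  sstable xi x -> sstable (fun i => - xi i) (tau1 x).
Proof.
move=> v0 [ss s0 s1]; split; first exact: semistable_tau.
- move=> S /fsub_tau0 [T [fT d]]; rewrite (theta_compl _ v0 d) => /eqP.
  rewrite subr_eq0 => /eqP /(s1 T fT) hT i.
  apply/eqP; rewrite -dimv_eq0; have := d i; rewrite hT dim_cV.
  by rewrite -[RHS]add0n => /addIn ->.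
- move=> S /fsub_tau1 [T [fT d]]; rewrite (theta_compl _ v0 d).
  have -> : \sum_i (- xi i) *~ v i = - \sum_i xi i *~ v i.
    by rewrite -sumrN; apply: eq_bigr => i _; rewrite mulNrz.
  rewrite -[RHS]add0r => /addIr /(s0 T fT) hT i.
  by apply/eqP; rewrite eqEdim subvf /= dim_cV; have := d i; rewrite hT dimv0 addn0 => ->.
Qed.

Lemma sslocus_tau v zeta (x : rep v) : sslocus zeta x -> sslocus (popp zeta) (tau1 x).
Proof. by move=> [v0 hL ss]; split; [|exact: tau1_Lambda|exact: semistable_tau]. Qed.

End Tau.

(** * The square of the transposition *)

Section Neg.
Variables (R : realType) (G : dgraph) (w : vtx G -> nat).
Local Notation C := (R[i]).
Local Notation I := (vtx G).
Local Notation rep := (rep R w).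
Implicit Types (v : I -> int) (i j : I).

(** This need not be isomorphic to x: acting by -1 on V restores p and q, but not the edges. It is
    therefore carried along explicitly. *)
Definition neg v (x : rep v) : rep v :=
  @Rep R G w v (fun i j h => - rx x h) (fun i => - rp x i) (fun i => - rq x i).

Lemma negK v (x : rep v) : neg (neg x) = x.
Proof.
case: x => x p q; rewrite /neg /=; congr Rep.
- do 2!(apply: boolp.functional_extensionality_dep => ?).
  by apply: funext => h; rewrite opprK.
- by apply: boolp.functional_extensionality_dep => ?; rewrite opprK.
- by apply: boolp.functional_extensionality_dep => ?; rewrite opprK.
Qed.

Lemma neg_lA v (x : rep v) i (k : star_ix i) : lA (neg x) k = - lA x k.
Proof. by case: k => [e|]. Qed.

Lemma neg_lB v (x : rep v) i (k : star_ix i) : lB (neg x) k = - lB x k.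
Proof. by case: k => [e|] //=; rewrite scalerN. Qed.

Lemma neg_Lambda v (z : I -> C) (x : rep v) : in_Lambda z x -> in_Lambda z (neg x).
Proof.
move=> /in_LambdaP h; apply/in_LambdaP => i; rewrite -h; apply: eq_bigr => k _.
by rewrite neg_lA neg_lB mulmxN mulNmx opprK.
Qed.

Lemma neg_fsub v (x : rep v) D S : fsub (neg x) D S <-> fsub x D S.
Proof.
split=> -[st hp hq]; split.
- by move=> i j h u hu; have := st i j h u hu; rewrite /= mulNmx memvN.
- by move=> i u hu; have := hp i u hu; rewrite /= mulNmx memvN.
- by move=> i u hu; have := hq i u hu; rewrite /= mulNmx memvN.
- by move=> i j h u hu; have := st i j h u hu; rewrite /= mulNmx memvN.
- by move=> i u hu; have := hp i u hu; rewrite /= mulNmx memvN.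
- by move=> i u hu; have := hq i u hu; rewrite /= mulNmx memvN.
Qed.

Lemma neg_semistable v xi (x : rep v) : semistable xi x -> semistable xi (neg x).
Proof.
move=> /semistableP [h0 h1]; apply/semistableP; split => S /neg_fsub; [exact: h0|exact: h1].
Qed.

Lemma neg_sstable v xi (x : rep v) : sstable xi x -> sstable xi (neg x).
Proof.
by move=> [ss h0 h1]; split; [exact: neg_semistable | move=> S /neg_fsub; exact: h0
  | move=> S /neg_fsub; exact: h1].
Qed.

Lemma neg_riso v v' (x : rep v) (y : rep v') : riso x y -> riso (neg x) (neg y).
Proof.
move=> [g [g' [e1 e2 hx hp hq]]]; exists g, g'; split => //=.
- by move=> i j h; rewrite mulmxN mulNmx hx.
- by move=> i; rewrite mulmxN hp.
- by move=> i; rewrite mulNmx hq.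
Qed.

Lemma hrefl_neg v v' i c (x : rep v) (y : rep v') :
  hrefl i c x y -> hrefl i c (neg x) (neg y).
Proof.
move=> [f [g [gf fg fx fp fq loc]]]; exists f, g; split => //=.
- by move=> j k h ji ki; rewrite mulmxN mulNmx fx.
- by move=> j ji; rewrite mulmxN fp.
- by move=> j ji; rewrite mulNmx fq.
have sN v0 (z : rep v0) (u : forall k : star_ix i, 'cV_(sdim w v0 k)) :
   \sum_k lB (neg z) k *m u k = - \sum_k lB z k *m u k.
  by rewrite -sumrN; apply: eq_bigr => k _; rewrite neg_lB mulNmx.
case: loc => inj ker surj off dg; split.
- move=> z hz; apply: inj => k; have := hz k; rewrite neg_lA mulNmx => /eqP.
  by rewrite oppr_eq0 => /eqP.
- move=> u; rewrite sN; split => [/eqP|[z hz]].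
    rewrite oppr_eq0 => /eqP /ker [z hz]; exists (- z) => k.
    by rewrite neg_lA mulNmx mulmxN opprK.
  apply/eqP; rewrite oppr_eq0; apply/eqP/ker; exists (- z) => k.
  by have := hz k; rewrite neg_lA mulmxN mulNmx.
- move=> z; have [u hu] := surj (- z); exists u; by rewrite sN hu opprK.
- by move=> k l kl; rewrite !neg_lA !neg_lB !(mulmxN, mulNmx, opprK) off.
- by move=> k; rewrite !neg_lA !neg_lB !(mulmxN, mulNmx, opprK) dg.
Qed.

Lemma tau1_tau1 v (x : rep v) : tau1 (fun=> 1%:M) (tau1 (fun=> 1%:M) x) = neg x.
Proof.
rewrite /neg /tau1 {1}/transpose; congr Rep.
- do 2!(apply: boolp.functional_extensionality_dep => ?); apply: funext => h.
  rewrite /= /adjmx !invmx1 !mulmx1 !mul1mx linearZ /= trmxK rvK scalerA -intrM.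
  by rewrite eps_rvN mulrN eps_sq mulrN1z scaleN1r.
- apply: boolp.functional_extensionality_dep => i.
  by rewrite /= /adjmx !invmx1 !mulmx1 !mul1mx trmxK.
- apply: boolp.functional_extensionality_dep => i.
  by rewrite /= /adjmx !invmx1 !mulmx1 !mul1mx linearN /= trmxK.
Qed.

End Neg.

(** * The functors S_i on representations *)

Section Step.
Variables (R : realType) (G : dgraph) (w : vtx G -> nat).
Local Notation C := (R[i]).
Local Notation I := (vtx G).
Local Notation rep := (rep R w).
Implicit Types (v : I -> int) (i j : I) (zeta : param R G).

Lemma star1K i v : star1 w i (star1 w i v) = v.
Proof.
apply: funext => j; rewrite {1}/star1; case: (eqVneq j i) => [->|ji]; last first.
  by rewrite /star1 (negbTE ji).
have ti : star1 w i v i = v i - \sum_k cartan i k * v k + (w i)%:Z by rewrite /star1 eqxx.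
rewrite (bigD1 i) //= ti.
have -> : \sum_(k | k != i) cartan i k * star1 w i v k = \sum_(k | k != i) cartan i k * v k.
  by apply: eq_bigr => k /negbTE ki; rewrite /star1 ki.
by rewrite (bigD1 i) //= cartanii; ring.
Qed.

Lemma pact1K i zeta : pact [:: i] (pact [:: i] zeta) = zeta.
Proof. by case: zeta => a b; rewrite /pact /= !sreflK. Qed.

Lemma popp_pact r zeta : popp (pact r zeta) = pact r (popp zeta).
Proof.
have h (A : zmodType) (u : I -> A) : (fun i => - wact r u i) = wact r (fun i => - u i).
  elim: r => //= i s <-; apply: funext => j; by rewrite /srefl mulNrz opprD.
by rewrite /popp /pact /= !h.
Qed.

Lemma poppK zeta : popp (popp zeta) = zeta.
Proof.
by case: zeta => a b; rewrite /popp /=; congr pair; apply: funext => i; rewrite opprK.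
Qed.

Definition dir zeta i : Prop := zeta.1 i < 0 \/ zeta.2 i != 0.

(** The constant of a direct step is $s_i(\zeta_{\mathbb C})^{(i)}=-\zeta_{\mathbb C}^{(i)}$. An
    inverse step is a direct one from y for the parameter $s_i\zeta$, whose constant is
    $\zeta_{\mathbb C}^{(i)}$. *)
Definition step i zeta v v' (x : rep v) (y : rep v') : Prop :=
  (dir zeta i /\ hrefl i (- zeta.2 i) x y) \/ (0 < zeta.1 i /\ hrefl i (zeta.2 i) y x).

Definition defd zeta i : Prop := zeta.1 i != 0 \/ zeta.2 i != 0.

Lemma step_defd i zeta v v' (x : rep v) (y : rep v') : step i zeta x y -> defd zeta i.
Proof.
move=> [[[h|h] _]|[h _]]; [left|right|left] => //; first by rewrite lt_eqF.
by rewrite gt_eqF.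
Qed.

Lemma defdP zeta i : defd zeta i -> dir zeta i \/ dir (popp zeta) i.
Proof.
move=> [h|h]; last by left; right.
case: (ltgtP (zeta.1 i) 0) h => // h _; first by left; left.
by right; left; rewrite /= oppr_lt0.
Qed.

Lemma step_sym i zeta v v' (x : rep v) (y : rep v') :
  step i zeta x y -> step i (pact [:: i] zeta) y x.
Proof.
move=> [[[h|h] H]|[h H]].
- by right; rewrite /= !srefl_same oppr_gt0.
- left; split; first by right; rewrite /= srefl_same oppr_eq0.
  by rewrite /= srefl_same; apply: hrefl_inv H; rewrite oppr_eq0.
- by left; split; [left; rewrite /= srefl_same oppr_lt0 | rewrite /= srefl_same opprK].
Qed.

Lemma step_riso i zeta v v' v1 v1' (x : rep v) (y : rep v') (x1 : rep v1) (y1 : rep v1') :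
  riso x x1 -> riso y y1 -> step i zeta x y -> step i zeta x1 y1.
Proof.
by move=> ex ey [[d h]|[d h]]; [left|right]; split => //; apply: hrefl_riso h.
Qed.

(** The two clauses of [step] overlap where $\xi_i>0$ and $\zeta_{\mathbb C}^{(i)}\ne0$; there the
    constant is nonzero and the relation can be inverted. *)
Lemma step_dir i zeta v v' (x : rep v) (y : rep v') :
  dir zeta i -> step i zeta x y -> hrefl i (- zeta.2 i) x y.
Proof.
move=> d [[_ h] //|[p h]]; case: d => [n|n]; first by rewrite ltNge ltW in n.
exact: hrefl_inv.
Qed.

Lemma dirN zeta i : dir (popp zeta) i <-> 0 < zeta.1 i \/ zeta.2 i != 0.
Proof. by rewrite /dir /= oppr_lt0 oppr_eq0. Qed.

Lemma step_tau (B : forall i, 'M[C]_(w i)) i zeta v v' (x : rep v) (y : rep v') :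
  (forall i, B i \in unitmx) ->
  step i zeta x y -> step i (popp zeta) (tau1 B x) (tau1 B y).
Proof.
move=> hB [[[h|h] H]|[h H]].
- by right; rewrite /= oppr_gt0; split => //; exact: hrefl_tau.
- left; split; first by apply/dirN; right.
  by apply: hrefl_inv (hrefl_tau hB H); rewrite oppr_eq0.
- left; split; first by apply/dirN; left.
  by rewrite /= opprK; exact: hrefl_tau.
Qed.

Local Notation E1 := (fun i : I => 1%:M : 'M[C]_(w i)).

Lemma E1_unit i : E1 i \in unitmx.
Proof. exact: unitmx1. Qed.

Lemma neg_inj v v' (x : rep v) (y : rep v') : riso (neg x) (neg y) -> riso x y.
Proof. by move/neg_riso; rewrite !negK. Qed.

Lemma tau1_inj v v' (x : rep v) (y : rep v') : riso (tau1 E1 x) (tau1 E1 y) -> riso x y.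
Proof. by move/(tau1_riso E1); rewrite !tau1_tau1; exact: neg_inj. Qed.

(** In the inverse direction y is a cokernel rather than a kernel; transposition makes the step
    direct, and it reflects isomorphism. *)
Lemma step_unique i zeta v v1 v2 (x : rep v) (y1 : rep v1) (y2 : rep v2) :
  step i zeta x y1 -> step i zeta x y2 -> riso y1 y2.
Proof.
move=> s1 s2; case: (defdP (step_defd s1)) => d.
  exact: hrefl_unique (step_dir d s1) (step_dir d s2).
apply: tau1_inj.
exact: hrefl_unique (step_dir d (step_tau E1_unit s1)) (step_dir d (step_tau E1_unit s2)).
Qed.

Lemma step_sslocus_dir i zeta v v' (x : rep v) (y : rep v') : v' = star1 w i v ->
  dir zeta i -> step i zeta x y -> (forall j, 0 <= v' j) ->
  sslocus zeta x -> sslocus (pact [:: i] zeta) y.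
Proof.
move=> e; subst v' => d s v'0 [v0 L ss]; have H := step_dir d s; split => //.
  by apply: hrefl_Lambda L; rewrite srefl_same.
apply: semistable_hrefl H ss; case: d => h; [by left|right].
by rewrite oppr_eq0.
Qed.

Lemma step_sstable_dir i zeta v v' (x : rep v) (y : rep v') : v' = star1 w i v ->
  dir zeta i -> step i zeta x y -> (forall j, 0 <= v j) -> (forall j, 0 <= v' j) ->
  sstable zeta.1 x -> sstable (pact [:: i] zeta).1 y.
Proof.
move=> e; subst v' => d s v0 v'0 ss; have H := step_dir d s.
apply: sstable_hrefl H ss => //; case: d => h; [by left|right].
by rewrite oppr_eq0.
Qed.

Lemma neg_sslocus zeta v (x : rep v) : sslocus zeta x -> sslocus zeta (neg x).
Proof. by move=> [v0 L ss]; split; [|exact: neg_Lambda|exact: neg_semistable]. Qed.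

Lemma step_sslocus i zeta v v' (x : rep v) (y : rep v') : v' = star1 w i v ->
  step i zeta x y -> (forall j, 0 <= v' j) ->
  sslocus zeta x -> sslocus (pact [:: i] zeta) y.
Proof.
move=> e s v'0 ss; case: (defdP (step_defd s)) => d; first exact: step_sslocus_dir s v'0 ss.
have := step_sslocus_dir e d (step_tau E1_unit s) v'0 (sslocus_tau E1_unit ss).
by rewrite -popp_pact => /(sslocus_tau E1_unit) /neg_sslocus; rewrite poppK tau1_tau1 negK.
Qed.

Lemma step_sstable i zeta v v' (x : rep v) (y : rep v') : v' = star1 w i v ->
  step i zeta x y -> (forall j, 0 <= v j) -> (forall j, 0 <= v' j) ->
  sstable zeta.1 x -> sstable (pact [:: i] zeta).1 y.
Proof.
move=> e s v0 v'0 ss; case: (defdP (step_defd s)) => d; first exact: step_sstable_dir s v0 v'0 ss.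
have ss' : sstable (popp zeta).1 (tau1 E1 x) by exact: (sstable_tau E1_unit v0 ss).
have := step_sstable_dir e d (step_tau E1_unit s) v0 v'0 ss'.
rewrite -popp_pact => /(sstable_tau E1_unit v'0) /neg_sstable; rewrite tau1_tau1 negK.
by rewrite -[(pact [:: i] zeta).1](congr1 fst (poppK (pact [:: i] zeta))).
Qed.

(** If $\zeta_{\mathbb C}^{(i)}\ne0$, then b_i a_i is an invertible scalar. If $\xi_i<0$, replacing
    V_i by the image of b_i gives a stable subspace containing im p, and semistability forbids a
    smaller dimension. *)
Lemma lB_surj i zeta v (x : rep v) : dir zeta i -> sslocus zeta x ->
  forall z, exists u : (forall k : star_ix i, 'cV_(sdim w v k)), \sum_k lB x k *m u k = z.
Proof.
move=> d [v0 /in_LambdaP L ss] z.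
case: d => [n|n]; last first.
  exists (fun k => lA x k *m ((- zeta.2 i)^-1 *: z)).
  under eq_bigr => k _ do rewrite mulmxA.
  by rewrite -mulmx_suml L mul_scalar_mx scalerA mulfV ?oppr_eq0 // scale1r.
pose V := (\sum_(k : star_ix i) mximg (lB x k) fullv)%VS.
pose T : gsub R v := dfwith (fun j => fullv : {vspace 'cV[C]_`|v j|}) V.
have Ti : T i = V by rewrite /T dfwith_in.
have Tj j : j != i -> T j = fullv by move=> ji; rewrite /T dfwith_out 1?eq_sym.
have lBV (k : star_ix i) u : lB x k *m u \in V.
  by apply: (subvP (sumv_sup k isT (subvv _))); apply: mem_mximg; exact: memvf.
have fT : fsub x (fr1 R w) T.
  apply/fsub1P; split.
    move=> j k h u _; case: (eqVneq k i) => [ki|ki]; last by rewrite Tj // memvf.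
    by move: h; rewrite ki => h; rewrite Ti rxlB -scalemxAl; apply: memvZ;
    exact: (lBV (Some (Tagged (fun j => arr i j) (rv h)))).
  move=> j u; case: (eqVneq j i) => [ji|ji]; last by rewrite Tj // memvf.
  by move: u; rewrite ji Ti => u; exact: (lBV None).
have /semistableP [_ h1] := ss; have := h1 T fT.
rewrite /theta (bigD1 i) //= [leRHS](bigD1 i) //=.
have -> : \sum_(j | j != i) zeta.1 j *+ \dim (T j) = \sum_(j | j != i) zeta.1 j *~ v j.
  by apply: eq_bigr => j ji; rewrite Tj // dim_cV pmulrn gez0_abs.
rewrite lerD2r Ti => le.
have {}le : (`|v i| <= \dim V)%N.
  rewrite leqNgt; apply/negP => lt.
  have e : zeta.1 i *~ v i = zeta.1 i *+ `|v i|%N by rewrite pmulrn gez0_abs.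
  move: le; rewrite e leNgt => /negP; apply.
  by rewrite ltr_nMn2l.
have zV : z \in V.
  suff -> : V = fullv by exact: memvf.
  by apply/eqP; rewrite eqEdim subvf /= dim_cV.
have /memv_sumP [u hu ->] := zV.
have hx (k : star_ix i) : exists t, u k = lB x k *m t.
  by have [t _ e] := mximgP (hu k isT); exists t.
have [t ht] := dep_choice hx.
by exists t; apply: eq_bigr => k _; rewrite -ht.
Qed.

Lemma sum_sdim v i : (\sum_(k : star_ix i) sdim w v k = w i + \sum_j #|arr i j| * `|v j|)%N.
Proof.
rewrite big_option sum_tagged /=; congr (_ + _)%N; apply: eq_bigr => j _.
by rewrite sum_nat_const.
Qed.

(** Surjectivity of b_i bounds dim V_i by dim U_i, so the entry of s_i * v at i is nonnegative; it
    is the dimension of the kernel that [hrefl_exists] needs. *)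
Lemma step_exists_dir i zeta v (x : rep v) : dir zeta i -> sslocus zeta x ->
  (forall j, 0 <= star1 w i v j) /\ exists y : rep (star1 w i v), step i zeta x y.
Proof.
move=> d ss; have surj := lB_surj d ss; have [v0 /in_LambdaP L _] := ss.
have le : (`|v i| <= w i + \sum_j #|arr i j| * `|v j|)%N.
  rewrite -sum_sdim; have [inj [prj [h1 h0 hs]]] := @biproduct C (star_ix i) (sdim w v (i := i)).
  have [s hs'] : exists s, (\sum_k lB x k *m prj k) *m s = 1%:M.
    apply: rinv_of_surj => z; have [u <-] := surj z; exists (\sum_k inj k *m u k).
    rewrite mulmx_suml; apply: eq_bigr => k _; rewrite -mulmxA; congr (_ *m _).
    rewrite mulmx_sumr [LHS](bigD1 k) //= [X in _ + X]big1 ?addr0 => [|l lk].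
      by rewrite mulmxA h1 mul1mx.
    by rewrite mulmxA h0 1?eq_sym // mul0mx.
  exact: mulmx1_min hs'.
have v'0 j : 0 <= star1 w i v j.
  rewrite /star1; case: (eqVneq j i) => // _.
  rewrite (bigD1 i) //= cartanii.
  have -> : \sum_(k | k != i) cartan i k * v k = - \sum_k #|arr i k|%:Z * v k.
    rewrite [in RHS](bigD1 i) //= (_ : #|arr i i| = 0%N) ?mul0r ?add0r -?sumrN; last first.
      by apply: eq_card0 => h; case: (arr_irr h).
    by apply: eq_bigr => k ki; rewrite cartan_neq 1?eq_sym // mulNr.
  move: le; rewrite -lez_nat PoszD sumPosz gez0_abs //.
  under eq_bigr => k _ do rewrite PoszM gez0_abs //.
  by move: (\sum_k _) => s; lia.
split => //.
have [y hy] : exists y : rep (star1 w i v), hrefl i (- zeta.2 i) x y.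
  apply: hrefl_exists => //; first by move=> j ji; exact: dim_star1.
  by rewrite sum_sdim star1_dim.
by exists y; left.
Qed.

Lemma step_exists i zeta v (x : rep v) : defd zeta i -> sslocus zeta x ->
  (forall j, 0 <= star1 w i v j) /\ exists y : rep (star1 w i v), step i zeta x y.
Proof.
move=> /defdP [d|d] ss; first exact: step_exists_dir d ss.
have [v'0 [y hy]] := step_exists_dir d (sslocus_tau E1_unit ss).
split => //; exists (neg (tau1 E1 y)).
have := step_tau E1_unit hy; rewrite poppK tau1_tau1 => s.
(* Transposing twice produces [neg x]; negating both ends of the step returns to x. *)
have N : step i zeta (neg (neg x)) (neg (tau1 E1 y)).
  by case: s => [[a b]|[a b]]; [left|right]; split => //; exact: hrefl_neg.
by rewrite negK in N.
Qed.

Definition Stab zeta v : Prop := forall x : rep v, sslocus zeta x -> sstable zeta.1 x.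

(** A representation for the reflected parameter is reflected back to where stability is known, and
    the stability is pushed forward again. *)
Lemma Stab_step i zeta v : defd zeta i -> Stab zeta v ->
  Stab (pact [:: i] zeta) (star1 w i v).
Proof.
move=> d st y ssy.
have d' : defd (pact [:: i] zeta) i by rewrite /defd /= !srefl_same !oppr_eq0.
have [v0 [x hx]] := step_exists d' ssy.
have ssx := step_sslocus erefl hx v0 ssy.
have [y0 _ _] := ssy.
have sx := step_sym hx; rewrite pact1K in sx ssx.
move: x hx v0 ssx sx; rewrite star1K => x hx v0 ssx sx.
exact: step_sstable erefl sx v0 y0 (st x ssx).
Qed.

End Step.

(** * Generic parameters: semistable representations are stable *)

Section Flatten.
Variables (F : fieldType) (K : finType) (m n : K -> nat).

Definition fl_ix : finType := {k : K & ('I_(m k) * 'I_(n k))%type}.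

(** A family of matrices is flattened into one row, so that a linear system in families is given by
    a single matrix and its rank can be counted. *)
Definition fl (A : forall k, 'M[F]_(m k, n k)) : 'rV[F]_#|{: fl_ix}| :=
  \row_t A (tag (enum_val t)) (tagged (enum_val t)).1 (tagged (enum_val t)).2.

Definition unfl (r : 'rV[F]_#|{: fl_ix}|) k : 'M[F]_(m k, n k) :=
  \matrix_(a, b) r 0 (enum_rank (Tagged (fun k => ('I_(m k) * 'I_(n k))%type) (a, b))).

Lemma unflK A k : unfl (fl A) k = A k.
Proof. by apply/matrixP => a b; rewrite !mxE enum_rankK. Qed.

Lemma flK r : fl (unfl r) = r.
Proof.
apply/rowP => t; rewrite !mxE -[in RHS](enum_valK t); congr (r 0 (enum_rank _)).
by case: (enum_val t) => k [a b].
Qed.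

Lemma unfl_lin a r s k : unfl (a *: r + s) k = a *: unfl r k + unfl s k.
Proof. by apply/matrixP => x y; rewrite !mxE. Qed.

Lemma fl_lin a A B : fl (fun k => a *: A k + B k) = a *: fl A + fl B.
Proof. by apply/rowP => t; rewrite !mxE. Qed.

Lemma card_fl : #|{: fl_ix}| = (\sum_k m k * n k)%N.
Proof.
rewrite card_tagged sumnE big_map big_enum /=.
by apply: eq_bigr => k _; rewrite card_prod !card_ord.
Qed.

Lemma fl_ext A B : (forall k, A k = B k) -> fl A = fl B.
Proof. by move=> h; apply/rowP => t; rewrite !mxE h. Qed.

Lemma fl_dot A B : fl A *m (fl B)^T = (\sum_k \tr (A k *m (B k)^T))%:M.
Proof.
apply/matrixP => x y; rewrite (ord1 x) (ord1 y) [RHS]mxE eqxx mulr1n mxE.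
under eq_bigr => t _ do rewrite !mxE.
rewrite (reindex (@enum_rank fl_ix)) /=; last by apply: onW_bij; exact: enum_rank_bij.
under eq_bigr => t _ do rewrite enum_rankK.
rewrite sum_tagged; apply: eq_bigr => k _; rewrite -(pair_bigA _ (fun a b => A k a b * B k a b)) /=.
apply: eq_bigr => a _; rewrite mxE; by apply: eq_bigr => b _; rewrite mxE.
Qed.

End Flatten.

Lemma linear_mx (F : fieldType) m n (f : 'rV[F]_m -> 'rV[F]_n) :
  (forall a u v, f (a *: u + v) = a *: f u + f v) ->
  exists D, forall u, u *m D = f u.
Proof.
move=> fl; have f0 : f 0 = 0.
  by have := fl (-1) 0 0; rewrite scaler0 addr0 scaleN1r addNr.
exists (\matrix_i f (delta_mx 0 i)) => u.
rewrite mulmx_sum_row {2}(row_sum_delta u).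
elim: (index_enum _) => [|i s IH]; first by rewrite !big_nil f0.
by rewrite !big_cons fl IH rowK.
Qed.

(** * The Crawley-Boevey inequality for unframed representations *)

Section CrawleyBoevey.
Variables (R : realType) (G : dgraph) (w : vtx G -> nat).
Local Notation C := (R[i]).
Local Notation I := (vtx G).
Local Notation rep := (rep R w).
Implicit Types (v : I -> int) (i j : I).

Lemma sum_rv (A : nmodType) (F : forall i j, arr i j -> A) :
  \sum_(i : I) \sum_(j : I) \sum_(h : arr i j) F i j h =
  \sum_(i : I) \sum_(j : I) \sum_(h : arr i j) F j i (rv h).
Proof.
rewrite exchange_big; apply: eq_bigr => i _; apply: eq_bigr => j _.
by rewrite (reindex (@rv G i j)) //=; apply: onW_bij; exact: rv_bij.
Qed.

Section Unframed.
Variables (v : I -> int) (X : rep v) (z : I -> C).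
Hypotheses (p0 : forall i, rp X i = 0) (L : in_Lambda z X).

Lemma unframed_sum i :
  \sum_(j : I) \sum_(h : arr i j) (eps h)%:~R *: (rx X (rv h) *m rx X h) = (- z i)%:M.
Proof.
have /in_LambdaP/(_ i) := L; rewrite big_option sum_tagged /= p0 mul0mx add0r => <-.
by apply: eq_bigr => j _; apply: eq_bigr => h _; rewrite scalemxAl.
Qed.

(** In the sum of the traces of the moment map equations the terms of h and of its reversal cancel,
    by cyclicity and the opposite signs. *)
Lemma unframed_trace : \sum_i z i *+ `|v i|%N = 0.
Proof.
pose T := \sum_(i : I) \sum_(j : I) \sum_(h : arr i j) (eps h)%:~R * \tr (rx X (rv h) *m rx X h).
have e1 : T = - \sum_i z i *+ `|v i|%N.
  rewrite -sumrN; apply: eq_bigr => i _.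
  rewrite -mulNrn -mxtrace_scalar -unframed_sum !raddf_sum /=; apply: eq_bigr => j _.
  by rewrite raddf_sum /=; apply: eq_bigr => h _; rewrite mxtraceZ.
have e2 : T = - T.
  rewrite {1}/T (sum_rv (fun i j h => (eps h)%:~R * \tr (rx X (rv h) *m rx X h))) /T -sumrN.
  apply: eq_bigr => i _; rewrite -sumrN; apply: eq_bigr => j _; rewrite -sumrN.
  by apply: eq_bigr => h _; rewrite rvK eps_rvN mulrNz mulNr mxtrace_mulC.
apply/eqP; rewrite -oppr_eq0 -e1; move/eqP: e2.
by rewrite -addr_eq0 -mulr2n mulrn_eq0.
Qed.

(* The tangent map f |-> f x - x f of the action has isotropic image for the
   symplectic form on the space of representations. *)
Lemma unframed_isotropic (f g : forall i, 'M[C]_`|v i|) :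
  \sum_(i : I) \sum_(j : I) \sum_(h : arr i j) (eps h)%:~R *
    \tr ((f j *m rx X h - rx X h *m f i) *m (g i *m rx X (rv h) - rx X (rv h) *m g j)) = 0.
Proof.
pose S (F : forall i j, arr i j -> C) :=
  \sum_(i : I) \sum_(j : I) \sum_(h : arr i j) (eps h)%:~R * F i j h.
have SD F1 F2 : S (fun i j h => F1 i j h + F2 i j h) = S F1 + S F2.
  rewrite -big_split; apply: eq_bigr => i _; rewrite -big_split; apply: eq_bigr => j _.
  by rewrite -big_split; apply: eq_bigr => h _; rewrite mulrDr.
have Srv F : S F = - S (fun i j h => F j i (rv h)).
  rewrite {1}/S (sum_rv (fun i j h => (eps h)%:~R * F i j h)) /S -sumrN.
  apply: eq_bigr => i _; rewrite -sumrN; apply: eq_bigr => j _; rewrite -sumrN.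
  by apply: eq_bigr => h _; rewrite eps_rvN mulrNz mulNr.
have Sext F1 F2 : (forall i j h, F1 i j h = F2 i j h) -> S F1 = S F2.
  by move=> e; do 3![apply: eq_bigr => ? _]; rewrite e.
pose M i := \sum_(j : I) \sum_(h : arr i j) (eps h)%:~R *: (rx X (rv h) *m rx X h).
have SM (a b : forall i, 'M[C]_`|v i|) :
    S (fun i j h => \tr (a i *m (rx X (rv h) *m rx X h) *m b i)) = \sum_i - z i * \tr (a i *m b i).
  apply: eq_bigr => i _; rewrite -mxtraceZ -[_ *: _]mul_scalar_mx.
  rewrite mulmxA -scalar_mxC -unframed_sum mulmx_sumr mulmx_suml raddf_sum /=.
  apply: eq_bigr => j _; rewrite mulmx_sumr mulmx_suml raddf_sum /=.
  by apply: eq_bigr => h _; rewrite -scalemxAr -scalemxAl mxtraceZ.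
(* The pairing expands into four sums. Two cancel by edge reversal and cyclicity of the trace; by
   the moment map equation the other two are opposite multiples of the same sum of
   $z_i\,\mathrm{tr}(f_ig_i)$. *)
have -> : \sum_(i : I) \sum_(j : I) \sum_(h : arr i j) (eps h)%:~R *
    \tr ((f j *m rx X h - rx X h *m f i) *m (g i *m rx X (rv h) - rx X (rv h) *m g j)) =
   (S (fun i j h => \tr (f j *m rx X h *m g i *m rx X (rv h))) +
    S (fun i j h => \tr (rx X h *m f i *m rx X (rv h) *m g j))) +
   (S (fun i j h => - \tr (f j *m (rx X h *m rx X (rv h)) *m g j)) +
    S (fun i j h => - \tr (f i *m g i *m (rx X (rv h) *m rx X h) *m 1%:M))).
  rewrite -!SD; apply: eq_bigr => i _; apply: eq_bigr => j _; apply: eq_bigr => h _.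
  congr (_ * _); rewrite mulmxBl !mulmxBr !raddfB /= mulmx1.
  have -> : \tr (f i *m g i *m (rx X (rv h) *m rx X h)) =
      \tr (rx X h *m f i *m (g i *m rx X (rv h))).
    by rewrite -[rx X h *m f i *m _]mulmxA [RHS]mxtrace_mulC !mulmxA.
  by rewrite !mulmxA opprK [X in _ + X = _]addrC addrACA.
have -> : S (fun i j h => \tr (f j *m rx X h *m g i *m rx X (rv h))) =
    - S (fun i j h => \tr (rx X h *m f i *m rx X (rv h) *m g j)).
  rewrite Srv; congr (- _); apply: Sext => i j h; rewrite rvK.
  by rewrite [LHS]mxtrace_mulC !mulmxA.
rewrite addNr add0r Srv.
have -> : S (fun i j h => - \tr (f i *m (rx X (rv h) *m rx X (rv (rv h))) *m g i)) =
   S (fun i j h => - \tr (f i *m (rx X (rv h) *m rx X h) *m g i)).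
  by apply: Sext => i j h; rewrite rvK.
have SN F : S (fun i j h => - F i j h) = - S F.
  rewrite /S -sumrN; apply: eq_bigr => i _; rewrite -sumrN; apply: eq_bigr => j _.
  by rewrite -sumrN; apply: eq_bigr => h _; rewrite mulrN.
rewrite !SN opprK SM SM -sumrB big1 // => i _.
by rewrite mulmx1 subrr.
Qed.

End Unframed.

(** D is the tangent map f |-> f x - x f. Its kernel is at most a line by the hypothesis on
    endomorphisms, so its rank is at least $\sum_i\gamma_i^2-1$. Its image is isotropic, so twice
    the rank is at most $\sum_h\gamma_{o(h)}\gamma_{i(h)}$. The difference of the two bounds is the
    inequality. *)
Lemma unframed_root v (X : rep v) (z : I -> C) :
  (forall i, rp X i = 0) -> (forall i, rq X i = 0) -> in_Lambda z X ->
  (forall f : (forall i, 'M[C]_`|v i|),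
     (forall i j (h : arr i j), f j *m rx X h = rx X h *m f i) ->
     exists a, forall i, f i = a%:M) ->
  \sum_i \sum_j `|v i|%N%:Z * cartan i j * `|v j|%N%:Z <= 2.
Proof.
move=> p0 q0 L schur.
pose d i := `|v i|%N.
pose Ed : finType := {i : I & {j : I & arr i j}}.
pose src (e : Ed) : I := tag e; pose tgt (e : Ed) : I := tag (tagged e).
pose ed (e : Ed) : arr (src e) (tgt e) := tagged (tagged e).
pose m0 := d; pose m1 e := d (tgt e); pose n1 e := d (src e).
pose phi (r : 'rV[C]_#|{: fl_ix m0 m0}|) : 'rV[C]_#|{: fl_ix m1 n1}| :=
  fl (fun e => (unfl r (tgt e) : 'M[C]_(d (tgt e))) *m rx X (ed e) -
         rx X (ed e) *m unfl r (src e)).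
have [D hD] : exists D, forall u, u *m D = phi u.
  apply: linear_mx => a u t; rewrite -fl_lin; apply: fl_ext => e.
  rewrite !unfl_lin mulmxDl mulmxDr -scalemxAl -scalemxAr scalerBr.
  by rewrite opprD addrACA.
pose rve (e : Ed) : Ed := Tagged (fun i => {j : I & arr i j})
   (Tagged (fun j => arr (tgt e) j) (rv (ed e))).
(* Composed with the standard pairing of rows, this gives the symplectic form
   $\sum_h\varepsilon(h)\,\mathrm{tr}(x_hy_{\bar h})$; its matrix J is invertible because reversal
   of edges is. *)
pose sg (r : 'rV[C]_#|{: fl_ix m1 n1}|) : 'rV[C]_#|{: fl_ix m1 n1}| :=
  fl (fun e => (eps (ed e))%:~R *: (unfl r (rve e) : 'M[C]_(d (src e), d (tgt e)))^T).
have [J hJ] : exists J, forall u, u *m J = sg u.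
  apply: linear_mx => a u t; rewrite -fl_lin; apply: fl_ext => e.
  by rewrite unfl_lin linearD /= linearZ /= scalerDr scalerA mulrC -scalerA.
have freeJ : row_free J.
  apply: inj_row_free => u; rewrite hJ => /(congr1 (fun r => unfl r)) e0.
  rewrite -[u]flK; rewrite (_ : 0 = fl (fun e => 0)); last first.
    by apply/rowP => t; rewrite !mxE.
  apply: fl_ext => -[i [j h]].
  have := congr1 (fun f => f (Tagged (fun i => {j : I & arr i j})
   (Tagged (fun i => arr j i) (rv h)))) e0.
  rewrite unflK /= /rve /ed /tgt /src /= rvK => e1.
  have {}e1 : (eps (rv h))%:~R *: (unfl u (Tagged (fun i => {j : I & arr i j})
     (Tagged (fun i0 => arr i i0) h)))^T = 0.
    by rewrite e1; apply/matrixP => x y; rewrite !mxE.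
  apply: trmx_inj; rewrite trmx0.
  by rewrite -[LHS](scalerK (eps_unit R (rv h))) e1 scaler0.
have iso : D *m (D *m J)^T = 0.
  suff h (f g : 'rV[C]_#|{: fl_ix m0 m0}|) : (f *m D) *m (g *m D *m J)^T = 0.
    apply/row_matrixP => i; rewrite row0 rowE; apply: trmx_inj; rewrite trmx0.
    apply/row_matrixP => j; rewrite row0 rowE.
    have := h (delta_mx 0 i) (delta_mx 0 j) => /(congr1 trmx).
    by rewrite trmx0 => <-; rewrite !trmx_mul !trmxK !mulmxA.
  rewrite hJ !hD fl_dot.
  have := unframed_isotropic p0 L (unfl f) (unfl g).
  have -> : \sum_(e : Ed) \tr (((unfl f (tgt e) : 'M[C]_(d (tgt e))) *m rx X (ed e) -
         rx X (ed e) *m unfl f (src e)) *m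
       ((eps (ed e))%:~R *: (unfl (phi g) (rve e) : 'M[C]_(d (src e), d (tgt e)))^T)^T)
     = \sum_(i : I) \sum_(j : I) \sum_(h : arr i j) (eps h)%:~R *
    \tr ((unfl f j *m rx X h - rx X h *m unfl f i) *m
        (unfl g i *m rx X (rv h) - rx X (rv h) *m unfl g j)); last by move=> ->; rewrite raddf0.
  rewrite sum_tagged; apply: eq_bigr => i _; rewrite sum_tagged; apply: eq_bigr => j _.
  apply: eq_bigr => h _ /=; rewrite linearZ /= trmxK -scalemxAr mxtraceZ; congr (_ * \tr (_ *m _)).
  by rewrite /phi unflK.
(* An isotropic subspace has at most half the dimension of the space. *)
have rk1 := mulmx0_rank_max iso.
rewrite mxrank_tr mxrankMfree // in rk1.
have kerle : (\rank (kermx D) <= 1)%N.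
  have : (kermx D <= fl (fun i => 1%:M : 'M[C]_(d i)))%MS.
    apply/row_subP => k; set u := row k _.
    have : u *m D = 0 by apply/sub_kermxP; exact: row_sub.
    rewrite hD => /(congr1 (fun r => unfl r)) e0.
    have [a ha] : exists a, forall i, unfl u i = a%:M.
      apply: schur => i j h.
      have := congr1 (fun f => f (Tagged (fun i => {j : I & arr i j})
         (Tagged (fun j => arr i j) h))) e0.
      rewrite unflK /= => e1; apply/eqP; rewrite -subr_eq0; apply/eqP.
      by rewrite [LHS]e1; apply/matrixP => x y; rewrite !mxE.
    apply/submxP; exists a%:M; rewrite mul_scalar_mx -[LHS]flK.
    by rewrite (fl_ext ha); apply/rowP => t; rewrite !mxE mulr_natr.
  by move/mxrankS => h; exact: leq_trans h (rank_leq_row _).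
rewrite mxrank_ker in kerle.
have c0 := card_fl m0 m0; have c1 := card_fl m1 n1.
have N1 : (\sum_(e : Ed) m1 e * n1 e = \sum_i \sum_j #|arr i j| * (d i * d j))%N.
  rewrite sum_tagged; apply: eq_bigr => i _; rewrite sum_tagged; apply: eq_bigr => j _.
  transitivity (\sum_(h : arr i j) d i * d j)%N; last by rewrite sum_nat_const.
  by apply: eq_bigr => h _; rewrite /m1 /n1 /= mulnC.
have -> : \sum_i \sum_j `|v i|%N%:Z * cartan i j * `|v j|%N%:Z =
   2 * (\sum_i d i * d i)%N%:Z - (\sum_(e : Ed) m1 e * n1 e)%N%:Z.
  rewrite N1 !sumPosz mulr_sumr -sumrB; apply: eq_bigr => i _.
  rewrite sumPosz (bigD1 i) //= [in RHS](bigD1 i) //= cartanii.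
  have -> : #|arr i i| = 0%N by apply: eq_card0 => h; case: (arr_irr h).
  rewrite mul0n add0r -sumrN -/(d i); congr (_ + _).
    by rewrite PoszM mulrC mulrA mulrC -!mulrA mulrC; ring.
  apply: eq_bigr => j ji; rewrite cartan_neq 1?eq_sym // !PoszM -/(d j); ring.
move: kerle rk1 c0 c1; move: (\rank D) => r.
move: (\sum_(e : Ed) m1 e * n1 e)%N (\sum_i d i * d i)%N => s1 s0 kerle rk1 c0 c1.
rewrite c0 in kerle; rewrite c1 in rk1; lia.
Qed.

End CrawleyBoevey.

(** * Stability for generic parameters *)

Section Generic.
Variables (R : realType) (G : dgraph) (w : vtx G -> nat).
Local Notation C := (R[i]).
Local Notation I := (vtx G).
Local Notation rep := (rep R w).
Implicit Types (v : I -> int) (i j : I) (zeta : param R G).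

Lemma subrep v (x : rep v) (z : I -> C) (S : gsub R v) :
  fsub x (fr0 R w) S -> in_Lambda z x ->
  exists (X : rep (fun i => (\dim (S i))%:Z)) (b : forall i, 'M[C]_(`|v i|, \dim (S i)))
         (r : forall i, 'M[C]_(\dim (S i), `|v i|)),
  [/\ (forall i, r i *m b i = 1%:M) /\ (forall i u, b i *m u \in S i),
      forall i j (h : arr i j), b j *m rx X h = rx x h *m b i,
      forall i, rp X i = 0, forall i, rq X i = 0 & in_Lambda z X].
Proof.
move=> /fsub0P [st hq] L.
have [b hb] := dep_choice (fun i => vspace_mx (S i)).
have [r hr] := dep_choice hb.
have rb i : r i *m b i = 1%:M by case: (hr i).
have SP i u : u \in S i <-> b i *m (r i *m u) = u by case: (hr i).
have bS i (u : 'cV_(\dim (S i))) : b i *m u \in S i by apply/SP; rewrite (mulmxA (r i)) rb mul1mx.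
pose X : rep (fun i => (\dim (S i))%:Z) := @Rep R G w (fun i => (\dim (S i))%:Z)
  (fun i j h => r j *m rx x h *m b i) (fun=> 0) (fun=> 0).
have bX i j (h : arr i j) : b j *m rx X h = rx x h *m b i.
  apply: mulmx_ext => u; rewrite /= -!mulmxA.
  by apply/SP; apply: st; exact: bS.
exists X, b, r; split => //.
apply/in_LambdaP => i; move/in_LambdaP: L => /(_ i) /(congr1 (fun M => r i *m M *m b i)).
rewrite mul_mx_scalar -scalemxAl rb scalemx1 => <-.
rewrite mulmx_sumr mulmx_suml; apply: eq_bigr => -[[j h]|] _; last first.
  have -> : lA X (None : star_ix i) = 0 by [].
  have -> : r i *m (lB x (None : star_ix i) *m lA x None) *m b i =
     r i *m rp x i *m (rq x i *m b i) by rewrite /= !mulmxA.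
  have -> : rq x i *m b i = 0.
    by apply: mulmx_ext => u; rewrite mul0mx -mulmxA; apply: hq; exact: bS.
  by rewrite !mulmx0.
have -> : r i *m (lB x (Some (Tagged (fun j => arr i j) h)) *m lA x (Some (Tagged (fun j => arr i j) h))) *m b i
  = (eps h)%:~R *: (r i *m (rx x (rv h) *m (rx x h *m b i))).
  by rewrite /= -scalemxAl -scalemxAr -scalemxAl !mulmxA.
rewrite -bX (mulmxA (rx x _)) -bX -mulmxA (mulmxA (r i)) rb mul1mx.
by rewrite /= -scalemxAl.
Qed.

Lemma closed_eigen n (f : 'M[C]_n) : (0 < n)%N ->
  exists a, exists2 u : 'cV[C]_n, u != 0 & (f - a%:M) *m u = 0.
Proof.
move=> n0; have [a ra] : exists a, root (char_poly f) a.
  by apply/closed_rootP; rewrite size_char_poly eqSS -lt0n.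
move: ra; rewrite -eigenvalue_root_char => /eigenvalueP [u hu u0].
exists a; apply/not_exists2P => h.
have [r hr] : exists r, r *m (f - a%:M) = 1%:M.
  apply: linv_of_inj => z hz; apply/eqP/negP => /negP z0.
  by case: (h z).
move/negP: u0; apply; apply/eqP; rewrite -[u]mulmx1 -(mulmx1C hr) mulmxA.
by rewrite mulmxBr hu mul_mx_scalar subrr mul0mx.
Qed.

(** Induction on the total dimension makes S minimal among the nonzero subspaces of value 0. Its
    endomorphisms are then scalars, as [unframed_root] requires; the eigenvalue exists because the
    field is algebraically closed. *)
Lemma no_destabilizing zeta v (x : rep v) : generic zeta v -> sslocus zeta x ->
  forall S, fsub x (fr0 R w) S -> theta zeta.1 S = 0 -> forall i, S i = 0%VS.
Proof.
move=> gen [v0 L ss] S.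
have [m] := ubnP (\sum_i \dim (S i))%N; elim: m S => // m IH S lt fS tS.
apply: contrapT => /existsNP [i0 hi0].
have [X [b [r [[rb bS] bX p0 q0 LX]]]] := subrep fS L.
pose d i := \dim (S i).
have sub_fsub (T : gsub R (fun i => (d i)%:Z)) : stable X T ->
    fsub x (fr0 R w) (fun i => mximg (b i) (T i)).
  move=> stT; have [st hq] : stable x S /\ (forall i u, u \in S i -> rq x i *m u = 0) by apply/fsub0P.
  apply/fsub0P; split.
    move=> i j h u /mximgP [t ht ->]; rewrite mulmxA -bX -mulmxA.
    by apply: mem_mximg; apply: stT.
  by move=> i u /mximgP [t ht ->]; apply: hq; exact: bS.
have dimT (T : gsub R (fun i => (d i)%:Z)) i : \dim (mximg (b i) (T i)) = \dim (T i).
  exact: dim_mximg (rb i).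
have /semistableP [s0 _] := ss.
have schur (f : forall i, 'M[C]_(d i)) : (forall i j (h : arr i j), f j *m rx X h = rx X h *m f i) ->
     exists a, forall i, f i = a%:M.
  move=> cf; have d0 : (0 < d i0)%N.
    by rewrite lt0n dimv_eq0; apply/eqP.
  have [a [u u0 hu]] := closed_eigen (f i0) d0; exists a.
  pose N i := f i - a%:M.
  have cN i j (h : arr i j) : N j *m rx X h = rx X h *m N i.
    by rewrite mulmxBl mulmxBr cf mul_mx_scalar mul_scalar_mx.
  pose Lf i : 'Hom('cV[C]_(d i), 'cV[C]_(d i)) := linfun (mulmx (N i)).
  have LE i t : Lf i t = N i *m t by rewrite lfunE.
  pose T1 : gsub R (fun i => (d i)%:Z) := fun i => lker (Lf i).
  pose T2 : gsub R (fun i => (d i)%:Z) := fun i => limg (Lf i).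
  have st1 : stable X T1.
    move=> i j h t; rewrite !memv_ker !LE => /eqP ht.
    by rewrite mulmxA cN -mulmxA ht mulmx0.
  have st2 : stable X T2.
    move=> i j h t /memv_imgP [t' _ ->]; rewrite LE mulmxA -cN -mulmxA -LE.
    by apply: memv_img; exact: memvf.
  have dT i : (\dim (T1 i) + \dim (T2 i) = d i)%N.
    by have := limg_ker_dim (Lf i) fullv; rewrite (capv_idPr (subvf _)) [in RHS]dim_cV.
  have t1 := s0 _ (sub_fsub _ st1); have t2 := s0 _ (sub_fsub _ st2).
  (* Kernel and image of f - a both have nonpositive value, and these add up to the value 0 of S.
     The kernel thus has value 0 and contains an eigenvector, so minimality makes it all of S. *)
  have t12 : theta zeta.1 (fun i => mximg (b i) (T1 i)) + theta zeta.1 (fun i => mximg (b i) (T2 i)) = 0.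
    rewrite -tS /theta -big_split; apply: eq_bigr => i _ /=.
    by rewrite !dimT -mulrnDr dT.
  have t1e : theta zeta.1 (fun i => mximg (b i) (T1 i)) = 0.
    apply/eqP; rewrite eq_le t1 /=; move/eqP: t12; rewrite addr_eq0 => /eqP ->.
    by rewrite oppr_ge0.
  have full : forall i, T1 i = fullv.
    have [lt'|ge] := ltnP (\sum_i \dim (mximg (b i) (T1 i))) (\sum_i d i).
      have := IH _ (leq_trans lt' lt) (sub_fsub _ st1) t1e i0 => /eqP.
      rewrite -dimv_eq0 dimT dimv_eq0 => /eqP e.
      have : u \in T1 i0 by rewrite memv_ker LE hu.
      by rewrite e memv0 (negbTE u0).
    move=> i; apply/eqP; rewrite eqEdim subvf /= dim_cV -/(d i).
    rewrite leqNgt; apply/negP => lti; move: ge; rewrite leqNgt => /negP; apply.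
    rewrite (bigD1 i) //= [ltnRHS](bigD1 i) //= dimT -addSn; apply: leq_add => //.
    by apply: leq_sum => j _; rewrite dimT; apply: leq_trans (eq_leq (dT j)); exact: leq_addr.
  move=> i; apply/eqP; rewrite -subr_eq0; apply/eqP; apply: mulmx_ext => t.
  have : t \in T1 i by rewrite full memvf.
  by rewrite memv_ker LE mul0mx => /eqP.
have br : bounded_root v d.
  split.
  - by exists i0; rewrite dimv_eq0; apply/eqP.
  - exact: (unframed_root p0 q0 LX schur).
  - by move=> i; rewrite -(gez0_abs (v0 i)) lez_nat -[leqRHS](dim_cV R); apply: dimvS; exact: subvf.
case: gen => /(_ d br) /eqP; apply; first exact: tS.
exact: (unframed_trace p0 LX).
Qed.

Lemma generic_popp zeta v : generic zeta v -> generic (popp zeta) v.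
Proof.
have N (A : zmodType) (u : I -> A) (gamma : I -> nat) :
    \sum_i (- u i) *+ gamma i = - \sum_i u i *+ gamma i.
  by rewrite -sumrN; apply: eq_bigr => i _; rewrite mulNrn.
by move=> [h|h]; [left|right] => gamma /h; rewrite N oppr_eq0.
Qed.

(** The condition on subspaces containing im p becomes the other one for annihilators in the
    transpose. The double transpose is [neg x], which has the same subobjects as x. *)
Lemma generic_Stab zeta v : generic zeta v -> Stab w zeta v.
Proof.
move=> gen x ssx; have [v0 L ss] := ssx; split => //.
  exact: no_destabilizing gen ssx.
move=> T fT tT i.
have fT' : fsub (tau1 (fun i => 1%:M : 'M_(w i)) (tau1 (fun i => 1%:M : 'M_(w i)) x)) (fr1 R w) T.
  by rewrite tau1_tau1; apply/neg_fsub.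
have [S [fS dS]] := fsub_tau1 (@E1_unit R G w) fT'.
have ssx' := sslocus_tau (@E1_unit R G w) ssx.
have tS : theta (popp zeta).1 S = 0.
  rewrite (theta_compl _ v0 (T := T)) ?tT ?subrr // => j.
  by rewrite addnC dS.
have S0 := no_destabilizing (generic_popp gen) ssx' fS tS i.
by apply/eqP; rewrite eqEdim subvf /= dim_cV; have := dS i; rewrite S0 dimv0 addn0 => ->.
Qed.

End Generic.

(** * Points of the quotient are isomorphism classes *)

(** An injective linear map is bounded below: r = r D E for a right inverse E of D, and the entries
    of E bound r. The added 1 keeps K positive. *)
Lemma row_free_bound (F : numFieldType) m n (D : 'M[F]_(m, n)) : row_free D ->
  exists2 K : F, 0 < K & forall (r : 'rV_m) t, 0 <= t ->
    (forall j, `|(r *m D) 0 j| <= t) -> \sum_i `|r 0 i| <= K * t.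
Proof.
move=> /row_freeP [E hE]; exists (1 + \sum_i \sum_j `|E j i|).
  by rewrite ltr_wpDr // sumr_ge0 // => i _; rewrite sumr_ge0.
move=> r t t0 h.
have rE i : r 0 i = \sum_j (r *m D) 0 j * E j i.
  by rewrite -{1}[r]mulmx1 -hE mulmxA mxE.
rewrite mulrDl mul1r ler_wpDl // mulr_suml; apply: ler_sum => i _.
rewrite rE (le_trans (ler_norm_sum _ _ _)) // mulr_suml; apply: ler_sum => j _.
by rewrite normrM mulrC ler_wpM2l.
Qed.

Section GIT.
Variables (R : realType) (G : dgraph) (w : vtx G -> nat).
Local Notation C := (R[i]).
Local Notation I := (vtx G).
Local Notation rep := (rep R w).
Implicit Types (v : I -> int) (i j : I) (zeta : param R G).

(* A morphism (f, a) from x to z acts by the scalar a on W. *)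
Definition fr_morph v (x z : rep v) (f : forall i, 'M[C]_`|v i|) (a : C) : Prop :=
  [/\ forall i j (h : arr i j), f j *m rx x h = rx z h *m f i,
      forall i, f i *m rp x i = a *: rp z i & forall i, a *: rq x i = rq z i *m f i].

(* The equations of a morphism from x to z are a linear system; near a point of the
   orbit of x it has a solution with a = 1, so it cannot be injective at z. *)
Lemma limit_morph v (x z : rep v) : orbit_closure x z ->
  exists f a, fr_morph x z f a /\ (a != 0 \/ exists i, f i != 0).
Proof.
move=> oc.
pose d i := `|v i|%N.
pose K0 : finType := option I.
pose m0 (k : K0) := if k is Some i then d i else 1%N.
pose Ed : finType := {i : I & {j : I & arr i j}}.
pose K1 : finType := (Ed + (I + I))%type.
pose m1 (k : K1) := match k with inl e => d (tag (tagged e)) | inr (inl i) => d i | inr (inr i) => w i end.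
pose n1 (k : K1) := match k with inl e => d (tag e) | inr (inl i) => w i | inr (inr i) => d i end.
pose N0 := #|{: fl_ix m0 m0}|; pose N1 := #|{: fl_ix m1 n1}|.
pose fF (r : 'rV[C]_N0) i : 'M[C]_(d i) := unfl r (Some i).
pose fa (r : 'rV[C]_N0) : C := (unfl r None : 'M[C]_1) 0 0.
pose ph (t : rep v) (r : 'rV[C]_N0) (k : K1) : 'M[C]_(m1 k, n1 k) :=
  match k with
  | inl e => fF r (tag (tagged e)) *m rx x (tagged (tagged e)) - rx t (tagged (tagged e)) *m fF r (tag e)
  | inr (inl i) => fF r i *m rp x i - fa r *: rp t i
  | inr (inr i) => fa r *: rq x i - rq t i *m fF r i
  end.
have fF_lin c r s i : fF (c *: r + s) i = c *: fF r i + fF s i by rewrite /fF unfl_lin.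
have fa_lin c r s : fa (c *: r + s) = c * fa r + fa s by rewrite /fa unfl_lin !mxE.
have [D hD] : exists D, forall u, u *m D = fl (ph z u).
  apply: linear_mx => c u s; rewrite -fl_lin; apply: fl_ext => -[e|[i|i]] /=.
  - by rewrite !fF_lin mulmxDl mulmxDr -scalemxAl -scalemxAr scalerBr opprD addrACA.
  - by rewrite fF_lin fa_lin mulmxDl scalerDl -scalemxAl -scalerA scalerBr opprD addrACA.
  - by rewrite fF_lin fa_lin mulmxDr scalerDl -scalemxAr -scalerA scalerBr opprD addrACA.
have [fr|nfr] := boolP (row_free D); last first.
  have [r hr r0] : exists2 r : 'rV[C]_N0, r *m D = 0 & r != 0.
    apply/not_exists2P => h; move/negP: nfr; apply; apply: inj_row_free => r hr.
    by apply/eqP/negP => /negP r0; case: (h r).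
  exists (fF r), (fa r).
  have ph0 k : ph z r k = 0.
    rewrite -[LHS]unflK -hD hr; by apply/matrixP => a b; rewrite !mxE.
  split.
    split.
    - move=> i j h; have := ph0 (inl (Tagged (fun i => {j : I & arr i j}) (Tagged (fun j => arr i j) h))).
      by move/eqP; rewrite subr_eq0 => /eqP.
    - by move=> i; have := ph0 (inr (inl i)) => /eqP; rewrite subr_eq0 => /eqP.
    - by move=> i; have := ph0 (inr (inr i)) => /eqP; rewrite subr_eq0 => /eqP.
  case: (eqVneq (fa r) 0) => [a0|]; [right|by left].
  apply: contrapT => /forallNP h; case/eqP: r0; rewrite -[r]flK.
  rewrite (fl_ext (B := fun k => 0)); first by apply/rowP => t; rewrite !mxE.
  move=> [i|]; first by apply/eqP/negP => /negP hi; exact: (h i).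
  by apply/matrixP => a b; rewrite (ord1 a) (ord1 b) -/(fa r) a0 mxE.
have [K K0' hK] := row_free_bound fr.
pose M : C := (1 + \sum_i d i)%:R.
(* If D is injective, this tolerance gives a contradiction. For r the coordinates of (g, 1) and S
   the sum of their norms, the entries of r D are at most M e S, since M bounds the number of terms
   in a product. Hence S <= K M e S = S / 2, whereas S >= 1 because a = 1. *)
have e0 : 0 < (2 * (K * M))^-1 by rewrite invr_gt0 !mulr_gt0 ?ltr0n.
have [g gu [cx cp cq]] := oc _ e0.
set e := (2 * (K * M))^-1 in e0 cx cp cq.
pose r : 'rV[C]_N0 := fl (fun k : K0 => match k return 'M[C]_(m0 k, m0 k) with
   Some i => g i | None => 1%:M end).
have rF i : fF r i = g i by rewrite /fF /r unflK.
have ra : fa r = 1 by rewrite /fa /r unflK mxE.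
pose S := \sum_t `|r 0 t|.
have S0 : 0 <= S by rewrite sumr_ge0.
have leS k a b : `|unfl r k a b| <= S.
  rewrite mxE /S (bigD1 (enum_rank (Tagged (fun k => ('I_(m0 k) * 'I_(m0 k))%type) (a, b)))) //=.
  by rewrite lerDl sumr_ge0.
have leM i : (d i)%:R * (e * S) <= M * (e * S).
  apply: ler_wpM2r; first by rewrite mulr_ge0 // ltW.
  by rewrite /M ler_nat (bigD1 i) //= addnCA leq_addr.
have leM1 : e * S <= M * (e * S).
  apply: ler_peMl; first by rewrite mulr_ge0 // ltW.
  by rewrite /M ler1n.
have mulle m i n (P : 'M[C]_(m, d i)) (Q : 'M[C]_(d i, n)) a b :
    (forall c, `|P a c| <= e) -> (forall c, `|Q c b| <= S) -> `|(P *m Q) a b| <= M * (e * S).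
  move=> hP hQ; rewrite mxE (le_trans (ler_norm_sum _ _ _)) //.
  apply: le_trans (leM i).
  have -> : (d i)%:R * (e * S) = \sum_(c < d i) e * S by rewrite sumr_const card_ord mulr_natl.
  by apply: ler_sum => c _; rewrite normrM ler_pM.
have bound (j : 'I_N1) : `|(r *m D) 0 j| <= M * (e * S).
  rewrite hD mxE; case: (enum_val j) => -[ed|[i|i]] [a b] /=.
  - have gx := cx _ _ (tagged (tagged ed)).
    have -> : fF r (tag (tagged ed)) *m rx x (tagged (tagged ed)) =
        rx (Defs.gact g x) (tagged (tagged ed)) *m fF r (tag ed).
      by rewrite !rF /= mulmxKV.
    by rewrite -mulmxBl; apply: mulle => c; [rewrite mxE [X in _ + X]mxE; exact: ltW | exact: leS].
  - rewrite rF ra scale1r mxE [X in _ + X]mxE; apply: le_trans leM1.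
    have S1 : 1 <= S by have := leS None 0 0; rewrite -/(fa r) ra normr1.
    by rewrite (le_trans (ltW (cp i a b))) // ler_peMr // ltW.
  - have -> : fa r *: rq x i = rq (Defs.gact g x) i *m fF r i.
      by rewrite ra scale1r rF /= mulmxKV.
    by rewrite -mulmxBl; apply: mulle => c; [rewrite mxE [X in _ + X]mxE; exact: ltW | exact: leS].
have := hK r _ _ bound; rewrite -/S => /(_ _) le.
have {}le : S <= K * (M * (e * S)) by apply: le; rewrite !mulr_ge0 // ltW.
have KM : K * M != 0 by rewrite mulf_neq0 // gt_eqF.
have h2 : K * (M * (e * S)) = 2^-1 * S.
  have -> : e * S = (K * M)^-1 * (2^-1 * S) by rewrite /e invfM mulrA [2^-1 * _]mulrC.
  by rewrite mulrA mulVKf.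
rewrite h2 in le.
have S00 : S = 0.
  apply/eqP; rewrite eq_le S0 andbT.
  have : S - 2^-1 * S <= 0 by rewrite subr_le0.
  have e2 : 1 - 2^-1 = 2^-1 :> C.
    by apply/eqP; rewrite subr_eq -mulr2n -[2^-1 *+ 2]mulr_natr mulVf // pnatr_eq0.
  rewrite -{1}[S]mul1r -mulrBl e2.
  by rewrite pmulr_rle0 // invr_gt0 ltr0n.
exists (fF r), (fa r).
have := leS None 0 0; rewrite -/(fa r) ra normr1 S00.
by rewrite ler10.
Qed.

(** The values of ker f in x and im f in z add up to $\xi\cdot\mathbf v$. If a != 0, ker f lies in
    ker q and im f contains im p, so both inequalities are equalities and stability of x gives ker f
    = 0. If a = 0 the two conditions are exchanged and stability gives ker f = V, that is f = 0,
    which was excluded. *)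
Lemma orbit_closure_riso zeta v (x z : rep v) :
  sslocus zeta x -> sslocus zeta z -> sstable zeta.1 x -> orbit_closure x z -> riso x z.
Proof.
move=> [v0 _ ssx] [_ _ ssz] [_ x0 x1] /limit_morph [f [a [[fx fp fq] nz]]].
have /semistableP [sx0 sx1] := ssx; have /semistableP [sz0 sz1] := ssz.
pose L i : 'Hom('cV[C]_`|v i|, 'cV[C]_`|v i|) := linfun (mulmx (f i)).
have LE i t : L i t = f i *m t by rewrite lfunE.
pose T1 : gsub R v := fun i => lker (L i).
pose T2 : gsub R v := fun i => limg (L i).
have st1 : stable x T1.
  move=> i j h t; rewrite !memv_ker !LE => /eqP ht.
  by rewrite mulmxA fx -mulmxA ht mulmx0.
have st2 : stable z T2.
  move=> i j h t /memv_imgP [t' _ ->]; rewrite LE mulmxA -fx -mulmxA -LE.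
  by apply: memv_img; exact: memvf.
have dT i : (\dim (T1 i) + \dim (T2 i) = `|v i|)%N.
  by have := limg_ker_dim (L i) fullv; rewrite (capv_idPr (subvf _)) [in RHS]dim_cV.
have tT : theta zeta.1 T1 + theta zeta.1 T2 = \sum_i zeta.1 i *~ v i.
  rewrite /theta -big_split; apply: eq_bigr => i _ /=.
  by rewrite -mulrnDr dT pmulrn gez0_abs.
case: (eqVneq a 0) nz => [a0|a0] nz; last first.
  have f1 : fsub x (fr0 R w) T1.
    apply/fsub0P; split=> // i u; rewrite memv_ker LE => /eqP hu.
    have := fq i => /(congr1 (fun M => M *m u)); rewrite -mulmxA hu mulmx0 -scalemxAl => /eqP.
    by rewrite scaler_eq0 (negbTE a0) => /eqP.
  have f2 : fsub z (fr1 R w) T2.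
    apply/fsub1P; split=> // i u.
    have -> : rp z i *m u = L i (a^-1 *: (rp x i *m u)).
      by rewrite LE -scalemxAr mulmxA fp -scalemxAl scalerA mulVf // scale1r.
    by apply: memv_img; exact: memvf.
  have t1 : theta zeta.1 T1 = 0.
    apply/eqP; rewrite eq_le sx0 //= -(addrK (theta zeta.1 T2) (theta zeta.1 T1)) tT.
    by rewrite subr_ge0 sz1.
  have T10 := x0 _ f1 t1.
  have hex i : exists r, r *m f i = 1%:M.
    apply: linv_of_inj => u hu.
    have : u \in T1 i by rewrite memv_ker LE hu.
    by rewrite T10 memv0 => /eqP.
  have [r hr] := dep_choice hex.
  exists (fun i => a^-1 *: f i), (fun i => a *: r i); split.
  - by move=> i; rewrite -scalemxAl -scalemxAr scalerA mulfV // scale1r hr.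
  - by move=> i; rewrite -scalemxAl -scalemxAr scalerA mulVf // scale1r (mulmx1C (hr i)).
  - by move=> i j h; rewrite -scalemxAl fx scalemxAr.
  - by move=> i; rewrite -scalemxAl fp scalerA mulVf // scale1r.
  - by move=> i; rewrite -scalemxAr -fq scalerA mulVf // scale1r.
have f1 : fsub x (fr1 R w) T1.
  apply/fsub1P; split=> // i u; rewrite memv_ker LE mulmxA fp a0 scale0r mul0mx //.
have f2 : fsub z (fr0 R w) T2.
  apply/fsub0P; split=> // i u /memv_imgP [t _ ->].
  by rewrite LE mulmxA -fq a0 scale0r mul0mx.
have t1 : theta zeta.1 T1 = \sum_i zeta.1 i *~ v i.
  apply/eqP; rewrite eq_le sx1 //= -tT gerDl sz0 //.
have T1f := x1 _ f1 t1.
case: nz => [/eqP // |[i /eqP []]]; apply: mulmx_ext => u; rewrite mul0mx.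
have : u \in T1 i by rewrite T1f memvf.
by rewrite memv_ker LE => /eqP.
Qed.

Lemma git_eq_riso zeta v (x y : rep v) : Stab w zeta v -> git_eq zeta x y -> riso x y.
Proof.
move=> st; elim=> [a b [sa sb [z [sz oa ob]]]|a|a b _ h|a b c _ h1 _ h2].
- apply: riso_trans (orbit_closure_riso sa sz (st _ sa) oa) _; apply: riso_sym.
  exact: orbit_closure_riso sb sz (st _ sb) ob.
- exact: riso_refl.
- exact: riso_sym.
- exact: riso_trans h1 h2.
Qed.

Lemma riso_closure v (x y : rep v) : riso x y -> orbit_closure x y.
Proof.
move=> [g [g' [e1 e2 hx hp hq]]] e e0.
have gV i : invmx (g i) = g' i.
  have u : g i \in unitmx by case: (mulmx1_unit (e2 i)).
  by rewrite -[invmx _]mul1mx -(e1 i) -mulmxA mulmxV // mulmx1.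
exists g; first by move=> i; case: (mulmx1_unit (e2 i)).
split => /= *; rewrite ?gV ?hx ?hp ?hq -?mulmxA ?e2 ?mulmx1 ?subrr ?normr0 //.
Qed.

Lemma cls_riso zeta v v' (x : rep v) (y : rep v') :
  sslocus zeta x -> sslocus zeta y -> riso x y -> cls zeta x = cls zeta y.
Proof.
move=> sx sy e; have [v0 _ _] := sx; have [v'0 _ _] := sy.
have ev : v = v'.
  apply: funext => i; rewrite -(gez0_abs (v0 i)) -(gez0_abs (v'0 i)); congr Posz.
  exact: riso_dim e.
subst v'; rewrite /cls; congr QPoint.
have g : git_eq zeta x y.
  apply: rst_step; split => //; exists y; split => //; first exact: riso_closure.
  exact: riso_closure (riso_refl y).
apply/seteqP; split => t /= ht.
  by apply: rst_trans ht; apply: rst_sym.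
exact: rst_trans ht.
Qed.

Lemma cls_eq_riso zeta zeta' v v' (x : rep v) (y : rep v') : Stab w zeta' v' ->
  cls zeta x = cls zeta' y -> riso x y.
Proof.
move=> st e.
(* This predicate depends on the point alone, so an equation between points of different dimension
   vectors can be rewritten in it. *)
pose qmem (P : qpoint R w) := exists2 t : rep (qdim P), @qclass R G w P t & riso t x.
have : qmem (cls zeta x).
  by exists x; [exact: rst_refl | exact: riso_refl].
rewrite e => -[t /= ht rt]; apply: riso_sym; apply: riso_trans rt.
exact: git_eq_riso ht.
Qed.

Lemma cls_dim zeta zeta' v v' (x : rep v) (y : rep v') : cls zeta x = cls zeta' y -> v = v'.
Proof. exact: (congr1 (@qdim R G w)). Qed.

End GIT.

(** * Commuting reflections *)

Section BraidTools.
Variables (R : realType) (G : dgraph) (w : vtx G -> nat).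
Local Notation C := (R[i]).
Local Notation I := (vtx G).
Local Notation rep := (rep R w).
Implicit Types (v : I -> int) (i j : I).

(** At the vertices of J every adjacent edge and the framing are controlled by a_i and b_i; only
    data avoiding J are left to compare one by one. *)
Lemma riso_glue v v' (y1 : rep v) (y2 : rep v') (J : pred I) g gi :
  (forall i, gi i *m g i = 1%:M) -> (forall i, g i *m gi i = 1%:M) ->
  (forall i (k : star_ix i), J i -> ufm w g k *m lA y1 k = lA y2 k *m g i) ->
  (forall i (k : star_ix i), J i -> g i *m lB y1 k = lB y2 k *m ufm w g k) ->
  (forall i j (h : arr i j), ~~ J i -> ~~ J j -> g j *m rx y1 h = rx y2 h *m g i) ->
  (forall i, ~~ J i -> g i *m rp y1 i = rp y2 i) ->
  (forall i, ~~ J i -> rq y1 i = rq y2 i *m g i) ->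
  riso y1 y2.
Proof.
move=> e1 e2 hA hB hx hp hq; exists g, gi; split => //.
- move=> i j h; have [Ji|nJi] := boolP (J i).
    exact: (hA i (Some (Tagged (fun j => arr i j) h)) Ji).
  have [Jj|nJj] := boolP (J j); last exact: hx.
  have e := hB j (Some (Tagged (fun i => arr j i) (rv h))) Jj.
  by rewrite (rxlB y1 h) (rxlB y2 h) -scalemxAr e -[RHS]scalemxAl.
- move=> i; have [Ji|nJi] := boolP (J i); last exact: hp.
  by have := hB i None Ji; rewrite /= mulmx1.
- move=> i; have [Ji|nJi] := boolP (J i); last exact: hq.
  by have := hA i None Ji; rewrite /= mul1mx.
Qed.

Definition touch i j (k : star_ix i) : bool := if k is Some e then tag e == j else false.

Lemma ufmK_off v v' (f : forall j, 'M[C]_(`|v' j|, `|v j|)) (g : forall j, 'M[C]_(`|v j|, `|v' j|))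
    (J : pred I) i (k : star_ix i) :
  (forall j, ~~ J j -> g j *m f j = 1%:M) -> (forall j, J j -> ~~ touch j k) ->
  ufm w g k *m ufm w f k = 1%:M.
Proof.
case: k => [e|] /= h nt; rewrite ?mulmx1 // h //.
by apply/negP => /nt; rewrite eqxx.
Qed.

Lemma hrefl_A v v' i c (x : rep v) (y : rep v') f g j (k : star_ix j) :
  hrefl_at i c x y f g -> j != i -> ~~ touch i k ->
  ufm w f k *m lA x k = lA y k *m f j.
Proof.
move=> H ji; case: k => [e|] /= nt; last by rewrite mul1mx (hrefl_q H).
by apply: (hrefl_x H).
Qed.

Lemma hrefl_B v v' i c (x : rep v) (y : rep v') f g j (k : star_ix j) :
  hrefl_at i c x y f g -> j != i -> ~~ touch i k ->
  f j *m lB x k = lB y k *m ufm w f k.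
Proof.
move=> H ji; case: k => [e|] /= nt; last by rewrite mulmx1 (hrefl_p H).
by rewrite -scalemxAr -scalemxAl (hrefl_x H).
Qed.

End BraidTools.

Section CommutingSquare.
Variables (R : realType) (G : dgraph) (w : vtx G -> nat).
Local Notation C := (R[i]).
Local Notation I := (vtx G).
Local Notation rep := (rep R w).
Implicit Types (v : I -> int) (i j : I).

(** Both local relations join x to z with no intermediate representation, which makes the record
    symmetric in i and j. When no edge joins i and j, neither U_i nor U_j involves the space at the
    other vertex. *)
Record two_refl v v' i j ci cj (x : rep v) (z : rep v')
    (f : forall j, 'M[C]_(`|v' j|, `|v j|)) (g : forall j, 'M[C]_(`|v j|, `|v' j|)) : Prop :=
  TwoRefl {
  two_gf : forall k, ~~ pred2 i j k -> g k *m f k = 1%:M;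
  two_fg : forall k, ~~ pred2 i j k -> f k *m g k = 1%:M;
  two_x : forall k l (h : arr k l), ~~ pred2 i j k -> ~~ pred2 i j l ->
    f l *m rx x h = rx z h *m f k;
  two_p : forall k, ~~ pred2 i j k -> f k *m rp x k = rp z k;
  two_q : forall k, ~~ pred2 i j k -> rq x k = rq z k *m f k;
  two_i : lrefl (lA x (i := i)) (lB x (i := i)) (lA z (i := i)) (lB z (i := i))
                (ufm w f (i := i)) ci;
  two_j : lrefl (lA x (i := j)) (lB x (i := j)) (lA z (i := j)) (lB z (i := j))
                (ufm w f (i := j)) cj }.

Lemma two_refl_sym v v' i j ci cj (x : rep v) (z : rep v') f g :
  two_refl i j ci cj x z f g -> two_refl j i cj ci x z f g.
Proof.
have e k : pred2 j i k = pred2 i j k by rewrite /= orbC.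
case=> a b cx cp cq hi hj; split => // [k|k|k l h|k|k]; rewrite !e; [exact: a|exact: b|exact: cx|exact: cp|exact: cq].
Qed.

Lemma arr0 i j : #|arr i j| = 0%N -> arr i j -> False.
Proof. by move=> /card0_eq /= e h; have := e h. Qed.

Lemma touch0 i j (k : star_ix i) : #|arr i j| = 0%N -> ~~ touch j k.
Proof.
case: k => [[l h]|] //= /arr0 ij; apply/eqP => lj; move: h; rewrite lj; exact: ij.
Qed.

Lemma touch_same i (k : star_ix i) : ~~ touch i k.
Proof. by case: k => [e|] //=; exact: tag_neq. Qed.

Lemma hrefl_two v v1 v' i j ci cj (x : rep v) (y : rep v1) (z : rep v') :
  i != j -> #|arr i j| = 0%N -> hrefl i ci x y -> hrefl j cj y z ->
  exists f g, two_refl i j ci cj x z f g.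
Proof.
move=> ij e [f1 [g1 H1]] [f2 [g2 H2]].
have ji : j != i by rewrite eq_sym.
have e' : #|arr j i| = 0%N by rewrite card_arrC.
have nP k : ~~ pred2 i j k -> k != i /\ k != j by rewrite /= negb_or => /andP.
have ug2i k : ufm w g2 k *m ufm w f2 k = 1%:M :> 'M_(sdim w v1 (k : star_ix i)).
  apply: (@ufmK_off _ _ w _ _ _ _ (pred1 j)); first exact: hrefl_gf H2.
  by move=> _ /eqP ->; exact: touch0.
have uf2i k : ufm w f2 k *m ufm w g2 k = 1%:M :> 'M_(sdim w v' (k : star_ix i)).
  apply: (@ufmK_off _ _ w _ _ _ _ (pred1 j)); first exact: hrefl_fg H2.
  by move=> _ /eqP ->; exact: touch0.
have ug1j k : ufm w g1 k *m ufm w f1 k = 1%:M :> 'M_(sdim w v (k : star_ix j)).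
  apply: (@ufmK_off _ _ w _ _ _ _ (pred1 i)); first exact: hrefl_gf H1.
  by move=> _ /eqP ->; exact: touch0.
have uf1j k : ufm w f1 k *m ufm w g1 k = 1%:M :> 'M_(sdim w v1 (k : star_ix j)).
  apply: (@ufmK_off _ _ w _ _ _ _ (pred1 i)); first exact: hrefl_fg H1.
  by move=> _ /eqP ->; exact: touch0.
have gf2i := hrefl_gf H2 ij; have fg2i := hrefl_fg H2 ij.
have gf1j := hrefl_gf H1 ji; have fg1j := hrefl_fg H1 ji.
exists (fun k => f2 k *m f1 k), (fun k => g1 k *m g2 k); split.
- move=> k /nP [ki kj]; rewrite -mulmxA (mulmxA (g2 k)) (hrefl_gf H2) // mul1mx (hrefl_gf H1) //.
- move=> k /nP [ki kj]; rewrite -mulmxA (mulmxA (f1 k)) (hrefl_fg H1) // mul1mx (hrefl_fg H2) //.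
- move=> k l h /nP [ki kj] /nP [li lj].
  by rewrite -mulmxA (hrefl_x H1) // mulmxA (hrefl_x H2) // mulmxA.
- by move=> k /nP [ki kj]; rewrite -mulmxA (hrefl_p H1) // (hrefl_p H2).
- by move=> k /nP [ki kj]; rewrite mulmxA -(hrefl_q H2) // (hrefl_q H1).
- have I1 k := mulmx1 (1%:M : 'M[C]_(sdim w v (k : star_ix i))).
  have := lrefl_conj I1 I1 ug2i uf2i (mulmx1 1%:M) (mulmx1 1%:M) gf2i fg2i (hrefl_loc H1).
  apply: lrefl_ext => k.
  + by rewrite mulmx1 mul1mx.
  + by rewrite mulmx1 mul1mx.
  + by rewrite (hrefl_A H2) ?touch0 // -mulmxA fg2i mulmx1.
  + by rewrite (hrefl_B H2) ?touch0 // -mulmxA uf2i mulmx1.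
  + by rewrite mulmx1 -ufm_comp.
- have I1 k := mulmx1 (1%:M : 'M[C]_(sdim w v' (k : star_ix j))).
  have := lrefl_conj uf1j ug1j I1 I1 fg1j gf1j (mulmx1 1%:M) (mulmx1 1%:M) (hrefl_loc H2).
  apply: lrefl_ext => k.
  + by rewrite -mulmxA -(hrefl_A H1) ?touch0 // mulmxA ug1j mul1mx.
  + by rewrite -mulmxA -(hrefl_B H1) ?touch0 // mulmxA gf1j mul1mx.
  + by rewrite mulmx1 mul1mx.
  + by rewrite mulmx1 mul1mx.
  + by rewrite mul1mx -ufm_comp.
Qed.

Lemma two_refl_unique v v1 v2 i j ci cj (x : rep v) (z1 : rep v1) (z2 : rep v2) f1 g1 f2 g2 :
  i != j -> #|arr i j| = 0%N ->
  two_refl i j ci cj x z1 f1 g1 -> two_refl i j ci cj x z2 f2 g2 -> riso z1 z2.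
Proof.
move=> ij e H1 H2; have e' : #|arr j i| = 0%N by rewrite card_arrC.
have nt l (k : star_ix l) : pred2 i j l -> forall m, pred2 i j m -> ~~ touch m k.
  move=> /orP [] /eqP el m /orP [] /eqP em; move: k; rewrite el em => k;
    [exact: touch_same|exact: touch0|exact: touch0|exact: touch_same].
have U m n (f : forall j, 'M[C]_(`|m j|, `|n j|)) g : (forall k, ~~ pred2 i j k -> g k *m f k = 1%:M) ->
   forall l (k : star_ix l), pred2 i j l -> ufm w g k *m ufm w f k = 1%:M.
  by move=> h l k Jl; apply: (@ufmK_off _ _ w _ _ _ _ (pred2 i j)) => // m0; exact: nt.
have Ji : pred2 i j i by rewrite /= eqxx.
have Jj : pred2 i j j by rewrite /= eqxx orbT.
have [hi [hi' [a1 a2 hiA hiB]]] := lrefl_unique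
  (fun k => U _ _ _ _ (two_gf H1) i k Ji) (fun k => U _ _ _ _ (two_fg H1) i k Ji)
  (fun k => U _ _ _ _ (two_gf H2) i k Ji) (fun k => U _ _ _ _ (two_fg H2) i k Ji) (two_i H1) (two_i H2).
have [hj [hj' [b1 b2 hjA hjB]]] := lrefl_unique
  (fun k => U _ _ _ _ (two_gf H1) j k Jj) (fun k => U _ _ _ _ (two_fg H1) j k Jj)
  (fun k => U _ _ _ _ (two_gf H2) j k Jj) (fun k => U _ _ _ _ (two_fg H2) j k Jj) (two_j H1) (two_j H2).
pose T k := 'M[C]_(`|v2 k|, `|v1 k|); pose T' k := 'M[C]_(`|v1 k|, `|v2 k|).
pose g := dfwith (T := T) (dfwith (T := T) (fun k => f2 k *m g1 k) hj) hi.
pose gi := dfwith (T := T') (dfwith (T := T') (fun k => f1 k *m g2 k) hj') hi'.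
have gI : g i = hi by rewrite /g dfwith_in.
have gJ : g j = hj by rewrite /g dfwith_out // dfwith_in.
have giI : gi i = hi' by rewrite /gi dfwith_in.
have giJ : gi j = hj' by rewrite /gi dfwith_out // dfwith_in.
have gk k : ~~ pred2 i j k -> g k = f2 k *m g1 k.
  by rewrite /= negb_or => /andP [ki kj]; rewrite /g !dfwith_out 1?eq_sym.
have gik k : ~~ pred2 i j k -> gi k = f1 k *m g2 k.
  by rewrite /= negb_or => /andP [ki kj]; rewrite /gi !dfwith_out 1?eq_sym.
have ug l (k : star_ix l) : pred2 i j l -> ufm w g k = ufm w f2 k *m ufm w g1 k.
  move=> Jl; rewrite -ufm_comp; case: k (nt l k Jl) => [a|] //= h; apply: gk.
  by apply/negP => /h; rewrite eqxx.
apply: (riso_glue (J := pred2 i j) (g := g) (gi := gi)).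
- move=> k; case: (boolP (pred2 i j k)) => [/orP [] /eqP -> | nk].
  + by rewrite gI giI.
  + by rewrite gJ giJ.
  + by rewrite gk // gik // -mulmxA (mulmxA (g2 k)) (two_gf H2) // mul1mx (two_fg H1).
- move=> k; case: (boolP (pred2 i j k)) => [/orP [] /eqP -> | nk].
  + by rewrite gI giI.
  + by rewrite gJ giJ.
  + by rewrite gk // gik // -mulmxA (mulmxA (g1 k)) (two_gf H1) // mul1mx (two_fg H2).
- move=> l k Jl; rewrite ug //; move: Jl k => /orP [] /eqP -> k.
  + by rewrite gI hiA.
  + by rewrite gJ hjA.
- move=> l k Jl; rewrite ug //; move: Jl k => /orP [] /eqP -> k.
  + by rewrite gI hiB.
  + by rewrite gJ hjB.
- move=> k l h nk nl; rewrite !gk //.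
  have -> : rx z1 h = f1 l *m rx x h *m g1 k.
    by rewrite (two_x H1) // -mulmxA (two_fg H1) // mulmx1.
  rewrite -!mulmxA (mulmxA (g1 l)) (two_gf H1) // mul1mx mulmxA (two_x H2) //.
  by rewrite mulmxA.
- by move=> k nk; rewrite gk // -(two_p H1) // -mulmxA (mulmxA (g1 k)) (two_gf H1) // mul1mx (two_p H2).
- by move=> k nk; rewrite gk // mulmxA -(two_q H2) // (two_q H1) // -mulmxA (two_fg H1) // mulmx1.
Qed.

Lemma hrefl_comm v v1 v2 v' v'' i j ci cj (x : rep v) (y : rep v1) (z : rep v')
    (y' : rep v2) (z' : rep v'') :
  i != j -> #|arr i j| = 0%N -> hrefl i ci x y -> hrefl j cj y z ->
  hrefl j cj x y' -> hrefl i ci y' z' -> riso z z'.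
Proof.
move=> ij e h1 h2 h3 h4; have ji : j != i by rewrite eq_sym.
have e' : #|arr j i| = 0%N by rewrite card_arrC.
have [f [g H]] := hrefl_two ij e h1 h2; have [f' [g' H']] := hrefl_two ji e' h3 h4.
exact: two_refl_unique ij e H (two_refl_sym H').
Qed.

End CommutingSquare.

(** * The braid relation for adjacent vertices *)

Section BraidA2.
Variables (R : realType) (G : dgraph) (w : vtx G -> nat).
Local Notation C := (R[i]).
Local Notation I := (vtx G).
Local Notation rep := (rep R w).
Implicit Types (v : I -> int) (i j : I).

Definition kx i j (h : arr i j) : star_ix i := Some (Tagged (fun j => arr i j) h).

Definition vfam v i := forall k : star_ix i, 'cV[C]_(sdim w v k).

(* b_i without the component along the edge h. *)
Definition bres v (x : rep v) i j (h : arr i j) (u : vfam v i) : 'cV[C]_`|v i| :=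
  \sum_(k | k != kx h) lB x k *m u k.

Lemma bres_ext v (x : rep v) i j (h : arr i j) (u u' : vfam v i) :
  (forall k, k != kx h -> u k = u' k) -> bres x h u = bres x h u'.
Proof. by move=> e; apply: eq_bigr => k kh; rewrite e. Qed.

Lemma bresE v (x : rep v) i j (h : arr i j) (u : vfam v i) :
  \sum_k lB x k *m u k = (eps h)%:~R *: (rx x (rv h) *m u (kx h)) + bres x h u.
Proof. by rewrite (bigD1 (kx h)) //=; congr (_ + _); rewrite scalemxAl. Qed.

Definition ucomp v v' (f : forall j, 'M[C]_(`|v' j|, `|v j|)) i (u : vfam v i) : vfam v' i :=
  fun k => ufm w f k *m u k.

(** The identity a b - a' b' = c is applied to u with its component along h set to 0; in the
    component along h the right side then vanishes. *)
Lemma bres_vec v v' i c (x : rep v) (y : rep v') f g j (h : arr i j) (u : vfam v i) :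
  hrefl_at i c x y f g ->
  (forall k, k != kx h -> ufm w f k *m (lA x k *m bres x h u)
     - lA y k *m bres y h (ucomp f u) = c *: (ufm w f k *m u k)) /\
  f j *m (rx x h *m bres x h u) = rx y h *m bres y h (ucomp f u).
Proof.
move=> H; pose u0 : vfam v i := dfwith u (0 : 'cV_(sdim w v (kx h))).
have u0h : u0 (kx h) = 0 by rewrite /u0 dfwith_in.
have u0k k : k != kx h -> u0 k = u k by move=> kh; rewrite /u0 dfwith_out 1?eq_sym.
have s1 : \sum_k lB x k *m u0 k = bres x h u.
  by rewrite (bresE x h) u0h mulmx0 scaler0 add0r; apply: bres_ext.
have s2 : \sum_k lB y k *m (ufm w f k *m u0 k) = bres y h (ucomp f u).
  rewrite (bresE y h (ucomp f u0)) /ucomp u0h !mulmx0 scaler0 add0r.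
  by apply: bres_ext => k kh; rewrite u0k.
have V k := lrefl_vec (hrefl_loc H) u0 k; rewrite s1 s2 in V.
split=> [k kh|]; first by rewrite V u0k.
by have := V (kx h); rewrite u0h mulmx0 scaler0 => /eqP; rewrite subr_eq0 => /eqP.
Qed.

Lemma hrefl_edge_off v v' i c (x : rep v) (y : rep v') f g j (h : arr i j) (k : star_ix i) :
  hrefl_at i c x y f g -> k != kx h ->
  ufm w f k *m lA x k *m rx x (rv h) = lA y k *m rx y (rv h) *m f j.
Proof.
move=> H kh; have := lrefl_off (hrefl_loc H) kh.
rewrite [lB x _]/(_ *: _) [lB y _]/(_ *: _) -!scalemxAr -scalemxAl.
move=> /(congr1 (fun M => (eps h)%:~R *: M)).
by rewrite !scalerA -intrM eps_sq !scale1r.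
Qed.

Lemma bres_off v v' i c (x : rep v) (y : rep v') f g j l (h : arr j l) (u : vfam v j) :
  hrefl_at i c x y f g -> j != i -> (forall k : star_ix j, k != kx h -> ~~ touch i k) ->
  f j *m bres x h u = bres y h (ucomp f u).
Proof.
move=> H ji nt; rewrite mulmx_sumr; apply: eq_bigr => k kh.
by rewrite mulmxA (hrefl_B H ji (nt k kh)) mulmxA.
Qed.

(* The composite S_i S_j S_i when i and j are joined by one edge h, as seen from the
   vertex i: V'_i is the space of families (u, u') away from h in U_i and U_j with
   x_h (b_i u) + b_j u' = 0. *)
Record a2_half v v' i j (h : arr i j) (h' : arr j i) (c : C) (x : rep v) (t : rep v')
    (f : forall k, 'M[C]_(`|v' k|, `|v k|)) : Prop := Half {
  half_ker : forall (u : vfam v i) (u' : vfam v j),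
    rx x h *m bres x h u + bres x h' u' = 0 <->
    exists l : 'cV_`|v' i|, (forall k, k != kx h -> lA t k *m l = ufm w f k *m u k) /\
      (forall k, k != kx h' -> lA t k *m (rx t h *m l) = ufm w f k *m u' k);
  half_inj : forall l : 'cV_`|v' i|, (forall k, k != kx h -> lA t k *m l = 0) ->
      (forall k, k != kx h' -> lA t k *m (rx t h *m l) = 0) -> l = 0;
  half_same : forall (u : vfam v i) k, k != kx h ->
    ufm w f k *m (lA x k *m bres x h u) - lA t k *m bres t h (ucomp f u) = c *: (ufm w f k *m u k);
  half_cross : forall (u : vfam v i) k, k != kx h' ->
    ufm w f k *m (lA x k *m (rx x h *m bres x h u)) = lA t k *m (rx t h *m bres t h (ucomp f u)) }.

Record a2_refl v v' i j (h : arr i j) (h' : arr j i) c (x : rep v) (t : rep v')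
    (f : forall j, 'M[C]_(`|v' j|, `|v j|)) (g : forall j, 'M[C]_(`|v j|, `|v' j|)) : Prop :=
  A2Refl {
  a2_gf : forall k, ~~ pred2 i j k -> g k *m f k = 1%:M;
  a2_fg : forall k, ~~ pred2 i j k -> f k *m g k = 1%:M;
  a2_x : forall k l (h : arr k l), ~~ pred2 i j k -> ~~ pred2 i j l ->
    f l *m rx x h = rx t h *m f k;
  a2_p : forall k, ~~ pred2 i j k -> f k *m rp x k = rp t k;
  a2_q : forall k, ~~ pred2 i j k -> rq x k = rq t k *m f k;
  a2_i : a2_half h h' c x t f;
  a2_j : a2_half h' h c x t f }.

Lemma a2_refl_sym v v' i j (h : arr i j) (h' : arr j i) c (x : rep v) (t : rep v') f g :
  a2_refl h h' c x t f g -> a2_refl h' h c x t f g.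
Proof.
have e k : pred2 j i k = pred2 i j k by rewrite /= orbC.
case=> a b cx cp cq hi hj; split => // [k|k|k l h0|k|k]; rewrite !e; [exact: a|exact: b|exact: cx|exact: cp|exact: cq].
Qed.

Lemma edge_unique i j (h h' : arr i j) : #|arr i j| = 1%N -> h = h'.
Proof.
by move=> e; have /fintype_le1P le1 : (#|arr i j| <= 1)%N by [rewrite e]; exact: le1.
Qed.

Lemma kx_touch i j (h : arr i j) (k : star_ix i) : #|arr i j| = 1%N -> k != kx h -> ~~ touch j k.
Proof.
move=> e; case: k => [[l h0]|] //= /eqP kh; apply/eqP => lj; apply: kh.
by subst l; rewrite (edge_unique h0 h e).
Qed.

Lemma scale_eps i j (h : arr i j) (V : lmodType C) (u v : V) :
  (eps h)%:~R *: u + v = 0 <-> u = - ((eps h)%:~R *: v).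
Proof.
split=> [/(congr1 (fun z => (eps h)%:~R *: z))|->].
  by rewrite scalerDr scalerA -intrM eps_sq scale1r scaler0 => /eqP; rewrite addr_eq0 => /eqP.
by rewrite scalerN scalerA -intrM eps_sq scale1r addNr.
Qed.

Section Chain.
Variables (v v1 v2 v' : I -> int) (i j : I) (h : arr i j).
Variables (x : rep v) (y : rep v1) (z : rep v2) (t : rep v') (c1 c2 c3 : C).
Variables (f1 : forall k, 'M[C]_(`|v1 k|, `|v k|)) (g1 : forall k, 'M[C]_(`|v k|, `|v1 k|)).
Variables (f2 : forall k, 'M[C]_(`|v2 k|, `|v1 k|)) (g2 : forall k, 'M[C]_(`|v1 k|, `|v2 k|)).
Variables (f3 : forall k, 'M[C]_(`|v' k|, `|v2 k|)) (g3 : forall k, 'M[C]_(`|v2 k|, `|v' k|)).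
Hypotheses (one : #|arr i j| = 1%N) (H1 : hrefl_at i c1 x y f1 g1)
  (H2 : hrefl_at j c2 y z f2 g2) (H3 : hrefl_at i c3 z t f3 g3) (cc : c1 + c3 = c2).

Let h' := rv h.
Let f k := f3 k *m (f2 k *m f1 k).
Let ji : j != i. Proof. exact: arr_neq h. Qed.
Let ij : i != j. Proof. by rewrite eq_sym ji. Qed.
Let one' : #|arr j i| = 1%N. Proof. by rewrite card_arrC. Qed.
Let nti (k : star_ix i) : k != kx h -> ~~ touch j k. Proof. exact: kx_touch. Qed.
Let ntj (k : star_ix j) : k != kx h' -> ~~ touch i k. Proof. exact: kx_touch. Qed.

Let uf l (k : star_ix l) : ufm w f k = ufm w f3 k *m (ufm w f2 k *m ufm w f1 k).
Proof. by rewrite /f ufm_comp ufm_comp. Qed.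

(* Components of an element of V_i or V_j away from the edge h are transported
   by the isomorphisms of each step. *)
Let inj1 l (k : star_ix l) : ~~ touch i k -> ufm w g1 k *m ufm w f1 k = 1%:M.
Proof. by move=> nt; apply: (@ufmK_off _ _ w _ _ _ _ (pred1 i)); [exact: hrefl_gf H1 | move=> _ /eqP ->]. Qed.
Let inj2 l (k : star_ix l) : ~~ touch j k -> ufm w g2 k *m ufm w f2 k = 1%:M.
Proof. by move=> nt; apply: (@ufmK_off _ _ w _ _ _ _ (pred1 j)); [exact: hrefl_gf H2 | move=> _ /eqP ->]. Qed.
Let inj3 l (k : star_ix l) : ~~ touch i k -> ufm w g3 k *m ufm w f3 k = 1%:M.
Proof. by move=> nt; apply: (@ufmK_off _ _ w _ _ _ _ (pred1 i)); [exact: hrefl_gf H3 | move=> _ /eqP ->]. Qed.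


Let gf2i := hrefl_gf H2 ij.
Let fg2i := hrefl_fg H2 ij.
Let gf1j := hrefl_gf H1 ji.
Let fg1j := hrefl_fg H1 ji.
Let gf3j := hrefl_gf H3 ji.
Let fg3j := hrefl_fg H3 ji.
Let bres1 (u : vfam v j) : f1 j *m bres x h' u = bres y h' (ucomp f1 u).
Proof. by apply: (bres_off _ H1). Qed.
Let bres2 (u : vfam v1 i) : f2 i *m bres y h u = bres z h (ucomp f2 u).
Proof. by apply: (bres_off _ H2). Qed.
Let bres3 (u : vfam v2 j) : f3 j *m bres z h' u = bres t h' (ucomp f3 u).
Proof. by apply: (bres_off _ H3). Qed.
Let A1 (k : star_ix j) (l : 'cV_`|v j|) : k != kx h' -> lA y k *m (f1 j *m l) = ufm w f1 k *m (lA x k *m l).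
Proof. by move=> kh; rewrite !mulmxA (hrefl_A H1 ji (ntj kh)). Qed.
Let A2 (k : star_ix i) (l : 'cV_`|v1 i|) : k != kx h -> lA z k *m (f2 i *m l) = ufm w f2 k *m (lA y k *m l).
Proof. by move=> kh; rewrite !mulmxA (hrefl_A H2 ij (nti kh)). Qed.
Let A3 (k : star_ix j) (l : 'cV_`|v2 j|) : k != kx h' -> lA t k *m (f3 j *m l) = ufm w f3 k *m (lA z k *m l).
Proof. by move=> kh; rewrite !mulmxA (hrefl_A H3 ji (ntj kh)). Qed.

(** Exactness at the first step, with the component n in V_j along h separated from the components u
    away from h. *)
Let ker1 (u : vfam v i) (n : 'cV_`|v j|) :
  (exists m, (forall k, k != kx h -> lA y k *m m = ufm w f1 k *m u k) /\ rx y h *m m = f1 j *m n)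
  <-> (eps h)%:~R *: (rx x h' *m n) + bres x h u = 0.
Proof.
pose u0 : vfam v i := dfwith u (n : 'cV_(sdim w v (kx h))).
have u0h : u0 (kx h) = n by rewrite /u0 dfwith_in.
have u0k k : k != kx h -> u0 k = u k by move=> kh; rewrite /u0 dfwith_out 1?eq_sym.
have := lrefl_ker (hrefl_loc H1) u0; rewrite (bresE x h) u0h (bres_ext _ u0k) => K.
rewrite K; split=> -[m hm]; exists m.
  case: hm => hk hh k; case: (eqVneq k (kx h)) => [->|kh]; first by rewrite u0h.
  by rewrite hk // u0k.
split=> [k kh|]; first by rewrite hm u0k.
by have := hm (kx h); rewrite u0h.
Qed.

Let ker2 (u : vfam v1 j) (m : 'cV_`|v1 i|) :
  (exists n, (forall k, k != kx h' -> lA z k *m n = ufm w f2 k *m u k) /\ rx z h' *m n = f2 i *m m)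
  <-> bres y h' u = (eps h)%:~R *: (rx y h *m m).
Proof.
pose u0 : vfam v1 j := dfwith u (m : 'cV_(sdim w v1 (kx h'))).
have u0h : u0 (kx h') = m by rewrite /u0 dfwith_in.
have u0k k : k != kx h' -> u0 k = u k by move=> kh; rewrite /u0 dfwith_out 1?eq_sym.
have := lrefl_ker (hrefl_loc H2) u0; rewrite (bresE y h') u0h (bres_ext _ u0k).
rewrite {1}/h' eps_rvN /h' rvK mulrNz scaleNr -/h' => K.
have -> : bres y h' u = (eps h)%:~R *: (rx y h *m m) <->
    - ((eps h)%:~R *: (rx y h *m m)) + bres y h' u = 0.
  by split=> [->|/eqP]; [rewrite addNr | rewrite addrC subr_eq0 => /eqP].
rewrite K; split=> -[n hn]; exists n.
  case: hn => hk hh k; case: (eqVneq k (kx h')) => [->|kh]; first by rewrite u0h.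
  by rewrite hk // u0k.
split=> [k kh|]; first by rewrite hn u0k.
by have := hn (kx h'); rewrite u0h.
Qed.

Let ker3 (u : vfam v2 i) (n : 'cV_`|v2 j|) :
  (exists l, (forall k, k != kx h -> lA t k *m l = ufm w f3 k *m u k) /\ rx t h *m l = f3 j *m n)
  <-> (eps h)%:~R *: (rx z h' *m n) + bres z h u = 0.
Proof.
pose u0 : vfam v2 i := dfwith u (n : 'cV_(sdim w v2 (kx h))).
have u0h : u0 (kx h) = n by rewrite /u0 dfwith_in.
have u0k k : k != kx h -> u0 k = u k by move=> kh; rewrite /u0 dfwith_out 1?eq_sym.
have := lrefl_ker (hrefl_loc H3) u0; rewrite (bresE z h) u0h (bres_ext _ u0k) => K.
rewrite K; split=> -[m hm]; exists m.
  case: hm => hk hh k; case: (eqVneq k (kx h)) => [->|kh]; first by rewrite u0h.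
  by rewrite hk // u0k.
split=> [k kh|]; first by rewrite hm u0k.
by have := hm (kx h); rewrite u0h.
Qed.

Let cancelU n n' p (a : 'M[C]_(n', n)) (b : 'M[C]_(n, n')) (M N : 'M[C]_(n, p)) :
  b *m a = 1%:M -> a *m M = a *m N -> M = N.
Proof. by move=> ba /(congr1 (mulmx b)); rewrite !mulmxA ba !mul1mx. Qed.

Let inj_y (m : 'cV_`|v1 i|) : (forall k, k != kx h -> lA y k *m m = 0) -> rx y h *m m = 0 -> m = 0.
Proof.
move=> hk hh; apply: (lrefl_inj (hrefl_loc H1)) => k.
by case: (eqVneq k (kx h)) => [->|kh]; [exact: hh | exact: hk].
Qed.
Let inj_z (n : 'cV_`|v2 j|) : (forall k, k != kx h' -> lA z k *m n = 0) -> rx z h' *m n = 0 -> n = 0.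
Proof.
move=> hk hh; apply: (lrefl_inj (hrefl_loc H2)) => k.
by case: (eqVneq k (kx h')) => [->|kh]; [exact: hh | exact: hk].
Qed.
Let inj_t (m : 'cV_`|v' i|) : (forall k, k != kx h -> lA t k *m m = 0) -> rx t h *m m = 0 -> m = 0.
Proof.
move=> hk hh; apply: (lrefl_inj (hrefl_loc H3)) => k.
by case: (eqVneq k (kx h)) => [->|kh]; [exact: hh | exact: hk].
Qed.

Let E3 (k : star_ix i) (l : 'cV_`|v2 j|) : k != kx h ->
  lA t k *m (rx t h' *m (f3 j *m l)) = ufm w f3 k *m (lA z k *m (rx z h' *m l)).
Proof. by move=> kh; have e := hrefl_edge_off H3 kh; rewrite !mulmxA e. Qed.

(** Only the second reflection acts at j, so the space there is already final at z. Its elements are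
    traced back to x by composing the kernel conditions of the first two steps. *)
Let zker (u : vfam v i) (u' : vfam v j) :
  (exists l : 'cV_`|v2 j|,
     (forall k, k != kx h' -> lA z k *m l = ufm w f2 k *m (ufm w f1 k *m u' k)) /\
     (forall k, k != kx h -> lA z k *m (rx z h' *m l) = ufm w f2 k *m (ufm w f1 k *m u k)))
  <-> rx x h' *m bres x h' u' + bres x h u = 0.
Proof.
split=> [[l [hl1 hl2]]|E].
  pose m := g2 i *m (rx z h' *m l); pose n := g1 j *m (rx y h *m m).
  have em : rx z h' *m l = f2 i *m m by rewrite (mulmxA (f2 i)) fg2i mul1mx.
  have en : rx y h *m m = f1 j *m n by rewrite (mulmxA (f1 j)) fg1j mul1mx.
  have e1 : (eps h)%:~R *: (rx x h' *m n) + bres x h u = 0.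
    apply/ker1; exists m; split => // k kh; apply: (cancelU (inj2 (nti kh))).
    by rewrite -A2 // -em hl2.
  have e2 : bres y h' (ucomp f1 u') = (eps h)%:~R *: (rx y h *m m).
    by apply/ker2; exists l.
  have -> : bres x h' u' = (eps h)%:~R *: n.
    by apply: (cancelU gf1j); rewrite bres1 e2 en scalemxAr.
  by rewrite -scalemxAr.
pose n := (eps h)%:~R *: bres x h' u'.
have /ker1 [m [hm1 hm2]] : (eps h)%:~R *: (rx x h' *m n) + bres x h u = 0.
  by rewrite -scalemxAr scalerA -intrM eps_sq scale1r.
have /ker2 [l [hl1 hl2]] : bres y h' (ucomp f1 u') = (eps h)%:~R *: (rx y h *m m).
  by rewrite hm2 -bres1 -scalemxAr scalerA -intrM eps_sq scale1r.
exists l; split => // k kh.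
by rewrite hl2 A2 // hm1.
Qed.

(** The third reflection only transports the space at j, so everything follows from z; the constant
    is that of the single reflection at j. *)
Lemma chain_half_j : a2_half h' h c2 x t f.
Proof.
split.
- move=> u' u; rewrite -zker; split=> -[l [hl1 hl2]].
    exists (f3 j *m l); split=> k kh.
      by rewrite A3 // hl1 // uf !mulmxA.
    by rewrite E3 // hl2 // uf !mulmxA.
  exists (g3 j *m l); have el : l = f3 j *m (g3 j *m l) by rewrite (mulmxA (f3 j)) fg3j mul1mx.
  split=> k kh.
    apply: (cancelU (inj3 (ntj kh))); rewrite -A3 // -el hl1 // uf !mulmxA //.
  apply: (cancelU (inj3 (touch_same k))); rewrite -E3 // -el hl2 // uf !mulmxA //.
- move=> l hl1 hl2; have el : l = f3 j *m (g3 j *m l) by rewrite (mulmxA (f3 j)) fg3j mul1mx.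
  pose l0 := g3 j *m l; rewrite -/l0 in el.
  have z1 k : k != kx h' -> lA z k *m l0 = 0.
    by move=> kh; apply: (cancelU (inj3 (ntj kh))); rewrite -A3 // -el hl1 // mulmx0.
  pose m := g2 i *m (rx z h' *m l0).
  have em : rx z h' *m l0 = f2 i *m m by rewrite (mulmxA (f2 i)) fg2i mul1mx.
  have y1 k : k != kx h -> lA y k *m m = 0.
    move=> kh; apply: (cancelU (inj2 (nti kh))); rewrite -A2 // -em mulmx0.
    by apply: (cancelU (inj3 (touch_same k))); rewrite -E3 // -el hl2 // mulmx0.
  have e2 : bres y h' (fun k => 0) = (eps h)%:~R *: (rx y h *m m).
    by apply/ker2; exists l0; split => // k kh; rewrite mulmx0 z1.
  have b0 : bres y h' (fun k => 0) = 0 by rewrite /bres big1 // => k _; rewrite mulmx0.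
  have m0 : m = 0.
    apply: inj_y => //; move: e2; rewrite b0 => /esym /(congr1 (fun a => (eps h)%:~R *: a)).
    by rewrite scalerA -intrM eps_sq scale1r scaler0.
  by rewrite el (inj_z z1) ?mulmx0 // em m0 mulmx0.
- move=> u' k kh.
  have V := (bres_vec h' (ucomp f1 u') H2).1 k kh.
  have -> : bres t h' (ucomp f u') = f3 j *m bres z h' (ucomp f2 (ucomp f1 u')).
    by rewrite bres3; apply: bres_ext => k0 _; rewrite /ucomp uf !mulmxA.
  rewrite A3 // uf -!(mulmxA (ufm w f3 k)) -mulmxBr scalemxAr; congr (_ *m _).
  by rewrite -!mulmxA -A1 // bres1 V scalemxAr.
- move=> u' k kh.
  have V := (bres_vec h' (ucomp f1 u') H2).2.
  have -> : bres t h' (ucomp f u') = f3 j *m bres z h' (ucomp f2 (ucomp f1 u')).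
    by rewrite bres3; apply: bres_ext => k0 _; rewrite /ucomp uf !mulmxA.
  rewrite E3 // -V A2 // uf -!mulmxA; do 2!congr (_ *m _).
  have e := hrefl_edge_off H1 kh.
  by rewrite -bres1 !mulmxA e.
Qed.

(** The space at i is replaced twice. An element l at t determines n at j in z and m at i in y; the
    kernel conditions of the last two steps are combined with the identity of the first along h. The
    two reflections at i contribute c1 and c3, whose sum is c2. *)
Lemma chain_half_i : a2_half h h' c2 x t f.
Proof.
have bE (u : vfam v i) : f1 j *m (rx x h *m bres x h u) = rx y h *m bres y h (ucomp f1 u).
  exact: (bres_vec h u H1).2.
split.
- move=> u u'; pose b := bres y h (ucomp f1 u); split=> [E|[l [hl1 hl2]]].
    pose m := - ((eps h)%:~R *: b).
    have /ker2 [n [hn1 hn2]] : bres y h' (ucomp f1 u') = (eps h)%:~R *: (rx y h *m m).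
      rewrite mulmxN -scalemxAr scalerN scalerA -intrM eps_sq scale1r -bE -bres1 -mulmxN.
      by congr (_ *m _); apply/eqP; rewrite -addr_eq0 addrC; apply/eqP.
    have /ker3 [l [hl1 hl2]] : (eps h)%:~R *: (rx z h' *m n) + bres z h (ucomp f2 (ucomp f1 u)) = 0.
      rewrite -bres2 -/b hn2 mulmxN -scalemxAr scalerN scalerA -intrM eps_sq scale1r.
      by rewrite addNr.
    exists l; split=> k kh; first by rewrite hl1 // uf /ucomp !mulmxA.
    by rewrite hl2 A3 // hn1 // uf /ucomp !mulmxA.
  pose n := g3 j *m (rx t h *m l); pose m := g2 i *m (rx z h' *m n).
  have en : rx t h *m l = f3 j *m n by rewrite (mulmxA (f3 j)) fg3j mul1mx.
  have em : rx z h' *m n = f2 i *m m by rewrite (mulmxA (f2 i)) fg2i mul1mx.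
  have e3 : (eps h)%:~R *: (rx z h' *m n) + bres z h (ucomp f2 (ucomp f1 u)) = 0.
    apply/ker3; exists l; split => // k kh; by rewrite hl1 // uf /ucomp !mulmxA.
  have e2 : bres y h' (ucomp f1 u') = (eps h)%:~R *: (rx y h *m m).
    apply/ker2; exists n; split => // k kh; apply: (cancelU (inj3 (ntj kh))).
    by rewrite -A3 // -en hl2 // uf /ucomp !mulmxA.
  have mE : m = - ((eps h)%:~R *: b).
    apply/scale_eps; apply: (cancelU gf2i); rewrite mulmx0 mulmxDr -scalemxAr.
    by rewrite bres2 -em.
  apply: (cancelU gf1j); rewrite mulmx0 mulmxDr bE bres1 e2 mE mulmxN -scalemxAr scalerN.
  by rewrite scalerA -intrM eps_sq scale1r subrr.
- move=> l hl1 hl2; pose n := g3 j *m (rx t h *m l).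
  have en : rx t h *m l = f3 j *m n by rewrite (mulmxA (f3 j)) fg3j mul1mx.
  have z1 k : k != kx h' -> lA z k *m n = 0.
    by move=> kh; apply: (cancelU (inj3 (ntj kh))); rewrite -A3 // -en hl2 // mulmx0.
  have e3 : (eps h)%:~R *: (rx z h' *m n) + bres z h (fun k => 0) = 0.
    by apply/ker3; exists l; split => // k kh; rewrite mulmx0 hl1.
  have b0 : bres z h (fun k => 0) = 0 by rewrite /bres big1 // => k _; rewrite mulmx0.
  have n0 : n = 0.
    apply: inj_z => //; move: e3; rewrite b0 => /scale_eps ->.
    by rewrite scaler0 oppr0.
  by apply: inj_t => //; rewrite en n0 mulmx0.
- move=> u k kh.
  have V1 := (bres_vec h u H1).1 k kh.
  have V3 := (bres_vec h (ucomp f2 (ucomp f1 u)) H3).1 k kh.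
  have -> : bres t h (ucomp f u) = bres t h (ucomp f3 (ucomp f2 (ucomp f1 u))).
    by apply: bres_ext => k0 _; rewrite /ucomp uf !mulmxA.
  have -> : lA t k *m bres t h (ucomp f3 (ucomp f2 (ucomp f1 u))) =
     ufm w f3 k *m (lA z k *m bres z h (ucomp f2 (ucomp f1 u))) -
     c3 *: (ufm w f3 k *m ucomp f2 (ucomp f1 u) k) by rewrite -V3 subKr.
  rewrite -bres2 A2 //.
  have -> : lA y k *m bres y h (ucomp f1 u) = ufm w f1 k *m (lA x k *m bres x h u) - c1 *: (ufm w f1 k *m u k).
    by rewrite -V1 subKr.
  rewrite !mulmxBr -!scalemxAr /ucomp uf -!mulmxA -cc scalerDl opprB opprD opprK.
  by rewrite [X in _ + X = _]addrCA addNKr addrC.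
- move=> u k kh.
  have e2 := (bres_vec h (ucomp f2 (ucomp f1 u)) H3).2.
  have -> : bres t h (ucomp f u) = bres t h (ucomp f3 (ucomp f2 (ucomp f1 u))).
    by apply: bres_ext => k0 _; rewrite /ucomp uf !mulmxA.
  rewrite -e2 A3 // uf -!mulmxA; congr (_ *m _).
  rewrite -bres2; have E2 : ufm w f2 k *m lA y k *m rx y h = lA z k *m rx z h *m f2 i.
    by have := hrefl_edge_off H2 kh; rewrite /h' rvK.
  by rewrite -A1 // bE !mulmxA E2.
Qed.

End Chain.

Lemma hrefl_chain v v1 v2 v' i j (h : arr i j) c1 c2 c3 (x : rep v) (y : rep v1) (z : rep v2) (t : rep v') :
  #|arr i j| = 1%N -> c1 + c3 = c2 ->
  hrefl i c1 x y -> hrefl j c2 y z -> hrefl i c3 z t ->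
  exists f g, a2_refl h (rv h) c2 x t f g.
Proof.
move=> one cc [f1 [g1 H1]] [f2 [g2 H2]] [f3 [g3 H3]].
have nP k : ~~ pred2 i j k -> k != i /\ k != j by rewrite /= negb_or => /andP.
exists (fun k => f3 k *m (f2 k *m f1 k)), (fun k => g1 k *m (g2 k *m g3 k)); split.
- move=> k /nP [ki kj]; rewrite -!mulmxA (mulmxA (g3 k)) (hrefl_gf H3) // mul1mx.
  by rewrite (mulmxA (g2 k)) (hrefl_gf H2) // mul1mx (hrefl_gf H1).
- move=> k /nP [ki kj]; rewrite -!mulmxA (mulmxA (f1 k)) (hrefl_fg H1) // mul1mx.
  by rewrite (mulmxA (f2 k)) (hrefl_fg H2) // mul1mx (hrefl_fg H3).
- move=> k l e /nP [ki kj] /nP [li lj].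
  by rewrite -!mulmxA (hrefl_x H1) // (mulmxA (f2 l)) (hrefl_x H2) // !mulmxA (hrefl_x H3) // !mulmxA.
- by move=> k /nP [ki kj]; rewrite -!mulmxA (hrefl_p H1) // (hrefl_p H2) // (hrefl_p H3).
- by move=> k /nP [ki kj]; rewrite !mulmxA -(hrefl_q H3) // -(hrefl_q H2) // (hrefl_q H1).
- exact: chain_half_i one H1 H2 H3 cc.
- exact: chain_half_j one H1 H2 H3.
Qed.

End BraidA2.

(** * Uniqueness of the triple composite at two adjacent vertices *)

Section A2Unique.
Variables (R : realType) (G : dgraph) (w : vtx G -> nat).
Local Notation C := (R[i]).
Local Notation I := (vtx G).
Local Notation rep := (rep R w).
Implicit Types (v : I -> int) (i j : I).

Section Half.
Variables (v v1 v2 : I -> int) (i j : I) (h : arr i j) (h' : arr j i) (c : C).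
Variables (x : rep v) (t1 : rep v1) (t2 : rep v2).
Variables (f1 : forall k, 'M[C]_(`|v1 k|, `|v k|)) (g1 : forall k, 'M[C]_(`|v k|, `|v1 k|)).
Variables (f2 : forall k, 'M[C]_(`|v2 k|, `|v k|)) (g2 : forall k, 'M[C]_(`|v k|, `|v2 k|)).
Hypotheses (Ha1 : a2_half h h' c x t1 f1) (Ha2 : a2_half h h' c x t2 f2).

Definition off l (k : star_ix l) : bool := ~~ touch i k && ~~ touch j k.
Hypotheses (offi : forall k, k != kx h -> off k) (offj : forall k, k != kx h' -> off k).
Hypotheses (gf1 : forall l (k : star_ix l), off k -> ufm w g1 k *m ufm w f1 k = 1%:M)
  (fg1 : forall l (k : star_ix l), off k -> ufm w f1 k *m ufm w g1 k = 1%:M)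
  (gf2 : forall l (k : star_ix l), off k -> ufm w g2 k *m ufm w f2 k = 1%:M)
  (fg2 : forall l (k : star_ix l), off k -> ufm w f2 k *m ufm w g2 k = 1%:M).

Definition trans12 l (k : star_ix l) := ufm w f2 k *m ufm w g1 k.

(** a and b have the same coordinates, in the sense of [half_ker], once the neighbours of t1 and t2
    are identified through those of x. *)
Definition half_rel (a : 'cV[C]_`|v1 i|) (b : 'cV[C]_`|v2 i|) : Prop :=
  (forall k, k != kx h -> lA t2 k *m b = trans12 k *m (lA t1 k *m a)) /\
  (forall k, k != kx h' -> lA t2 k *m (rx t2 h *m b) = trans12 k *m (lA t1 k *m (rx t1 h *m a))).

Lemma half_rel_unique a b b' : half_rel a b -> half_rel a b' -> b = b'.
Proof.
move=> [p1 p2] [q1 q2]; apply/eqP; rewrite -subr_eq0; apply/eqP.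
by apply: (half_inj Ha2) => k kh; rewrite !mulmxBr ?p1 ?q1 ?p2 ?q2 // subrr.
Qed.

(** By [half_ker] both spaces are the same space of pairs of families over x, and by [half_inj] the
    coordinates determine the element. *)
Lemma half_iso : exists hh hi, [/\ hi *m hh = 1%:M, hh *m hi = 1%:M
  & forall a, half_rel a (hh *m a)].
Proof.
apply: linear_rel_iso.
- move=> s a b a' b' [p1 p2] [q1 q2]; split=> k kh.
    by rewrite !mulmxDr -!scalemxAr p1 // q1.
  by rewrite !mulmxDr -!scalemxAr p2 // q2.
- move=> l; pose u k := ufm w g1 k *m (lA t1 k *m l) : 'cV_(sdim w v (k : star_ix i)).
  pose u' k := ufm w g1 k *m (lA t1 k *m (rx t1 h *m l)) : 'cV_(sdim w v (k : star_ix j)).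
  have : rx x h *m bres x h u + bres x h' u' = 0.
    apply/(half_ker Ha1); exists l; split=> k kh; rewrite (mulmxA (ufm w f1 k)) fg1 ?mul1mx //.
      exact: offi.
    exact: offj.
  move=> /(half_ker Ha2) [l2 [p q]]; exists l2; split=> k kh.
    by rewrite p // /trans12 -mulmxA.
  by rewrite q // /trans12 -mulmxA.
- move=> l; pose u k := ufm w g2 k *m (lA t2 k *m l) : 'cV_(sdim w v (k : star_ix i)).
  pose u' k := ufm w g2 k *m (lA t2 k *m (rx t2 h *m l)) : 'cV_(sdim w v (k : star_ix j)).
  have : rx x h *m bres x h u + bres x h' u' = 0.
    apply/(half_ker Ha2); exists l; split=> k kh; rewrite (mulmxA (ufm w f2 k)) fg2 ?mul1mx //.
      exact: offi.
    exact: offj.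
  move=> /(half_ker Ha1) [l1 [p q]]; exists l1; split=> k kh.
    have o := offi kh.
    by rewrite p // /trans12 -!mulmxA (mulmxA (ufm w g1 k)) gf1 // mul1mx (mulmxA (ufm w f2 k)) fg2 // mul1mx.
  have o := offj kh.
  by rewrite q // /trans12 -!mulmxA (mulmxA (ufm w g1 k)) gf1 // mul1mx (mulmxA (ufm w f2 k)) fg2 // mul1mx.
- move=> b [p q]; apply: (half_inj Ha2) => k kh; first by rewrite p // !mulmx0.
  by rewrite q // !mulmx0.
- move=> a [p q]; apply: (half_inj Ha1) => k kh.
    have o := offi kh; have := p k kh => /esym /(congr1 (mulmx (ufm w f1 k *m ufm w g2 k))).
    rewrite !mulmx0 /trans12 -!mulmxA (mulmxA (ufm w g2 k)) gf2 // mul1mx.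
    by rewrite (mulmxA (ufm w f1 k)) fg1 // mul1mx.
  have o := offj kh; have := q k kh => /esym /(congr1 (mulmx (ufm w f1 k *m ufm w g2 k))).
  rewrite !mulmx0 /trans12 -!mulmxA (mulmxA (ufm w g2 k)) gf2 // mul1mx.
  by rewrite (mulmxA (ufm w f1 k)) fg1 // mul1mx.
Qed.

Lemma same_rel (u : vfam R w v i) k : k != kx h ->
  lA t2 k *m bres t2 h (ucomp f2 u) = trans12 k *m (lA t1 k *m bres t1 h (ucomp f1 u)).
Proof.
move=> kh; have o := offi kh.
have e1 := half_same Ha1 u kh; have e2 := half_same Ha2 u kh.
have -> : lA t2 k *m bres t2 h (ucomp f2 u) =
    ufm w f2 k *m (lA x k *m bres x h u) - c *: (ufm w f2 k *m u k) by rewrite -e2 subKr.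
have -> : lA t1 k *m bres t1 h (ucomp f1 u) =
    ufm w f1 k *m (lA x k *m bres x h u) - c *: (ufm w f1 k *m u k) by rewrite -e1 subKr.
by rewrite mulmxBr -scalemxAr /trans12 -!mulmxA !(mulmxA (ufm w g1 k)) gf1 // !mul1mx.
Qed.

Lemma half_rel_bres (u : vfam R w v i) :
  half_rel (bres t1 h (ucomp f1 u)) (bres t2 h (ucomp f2 u)).
Proof.
split=> k kh; first exact: same_rel.
have o := offj kh.
rewrite -(half_cross Ha2 u kh) -(half_cross Ha1 u kh).
by rewrite /trans12 -!mulmxA (mulmxA (ufm w g1 k)) gf1 // mul1mx.
Qed.

(** The moment map equation at i expresses the loop along h through the scalar m and the components
    away from h, which the relation already controls. *)
Lemma half_rel_loop m a b : rv h = h' ->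
  \sum_(k : star_ix i) lB t1 k *m lA t1 k = m%:M ->
  \sum_(k : star_ix i) lB t2 k *m lA t2 k = m%:M ->
  half_rel a b -> forall k, k != kx h ->
  lA t2 k *m (rx t2 h' *m (rx t2 h *m b)) = trans12 k *m (lA t1 k *m (rx t1 h' *m (rx t1 h *m a))).
Proof.
move=> rvh m1 m2 [p q] k kh; have o := offi kh.
have loop v0 (t : rep v0) (l : 'cV_`|v0 i|) : \sum_(k : star_ix i) lB t k *m lA t k = m%:M ->
    rx t h' *m (rx t h *m l) = (eps h)%:~R *: (m *: l - bres t h (fun k => lA t k *m l)).
  move=> /(congr1 (fun M => M *m l)); rewrite mulmx_suml mul_scalar_mx => <-.
  under eq_bigr => k0 _ do rewrite -mulmxA.
  by rewrite (bresE t h (fun k => lA t k *m l)) rvh addrK scalerA -intrM eps_sq scale1r.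
rewrite (loop _ t2 b m2) (loop _ t1 a m1) -!scalemxAr !mulmxBr -!scalemxAr p //.
congr (_ *: (_ - _)).
pose u k := ufm w g1 k *m (lA t1 k *m a) : 'cV_(sdim w v (k : star_ix i)).
have <- : bres t2 h (ucomp f2 u) = bres t2 h (fun k => lA t2 k *m b).
  by apply: bres_ext => k0 kh0; rewrite /ucomp p // /trans12 -mulmxA.
have <- : bres t1 h (ucomp f1 u) = bres t1 h (fun k => lA t1 k *m a).
  apply: bres_ext => k0 kh0; have o0 := offi kh0.
  by rewrite /ucomp /u (mulmxA (ufm w f1 k0)) fg1 // mul1mx.
exact: same_rel.
Qed.

(** A single component of b_i is [bres] of a family supported at k, to which [half_rel_bres]
    applies. *)
Lemma half_lB hh (k : star_ix i) : (forall a, half_rel a (hh *m a)) -> k != kx h ->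
  hh *m lB t1 k = lB t2 k *m trans12 k.
Proof.
move=> hP kh; have o := offi kh; apply: mulmx_ext => z.
have single v0 (t : rep v0) (y : 'cV_(sdim w v0 k)) (u : vfam R w v0 i) :
    u k = y -> (forall l, l != k -> u l = 0) -> bres t h u = lB t k *m y.
  move=> <- u0; rewrite /bres (bigD1 k) //= [X in _ + X]big1 ?addr0 // => l /andP [_ lk].
  by rewrite u0 // mulmx0.
pose u : vfam R w v i := dfwith (fun k => 0) (ufm w g1 k *m z).
have uk : u k = ufm w g1 k *m z by rewrite /u dfwith_in.
have ul l : l != k -> u l = 0 by move=> lk; rewrite /u dfwith_out 1?eq_sym.
have := half_rel_bres u.
rewrite (single _ t1 z); last 2 first.
- by rewrite /ucomp uk (mulmxA (ufm w f1 k)) fg1 // mul1mx.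
- by move=> l lk; rewrite /ucomp ul // mulmx0.
rewrite (single _ t2 (trans12 k *m z)); last 2 first.
- by rewrite /ucomp uk /trans12 mulmxA.
- by move=> l lk; rewrite /ucomp ul // mulmx0.
by move=> P; rewrite -!mulmxA (mulmxA (ufm w f2 k)); exact: (half_rel_unique (hP _) P).
Qed.

End Half.

(** The isomorphisms at i and j are obtained separately. They commute with the edge h because images
    under it are related again: one half of the relation at j is a half of that at i, the other is
    [half_rel_loop]. *)
Lemma a2_refl_unique v v1 v2 i j (h : arr i j) c mi mj (x : rep v) (t1 : rep v1) (t2 : rep v2)
    f1 g1 f2 g2 : #|arr i j| = 1%N ->
  \sum_(k : star_ix i) lB t1 k *m lA t1 k = mi%:M ->
  \sum_(k : star_ix i) lB t2 k *m lA t2 k = mi%:M ->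
  \sum_(k : star_ix j) lB t1 k *m lA t1 k = mj%:M ->
  \sum_(k : star_ix j) lB t2 k *m lA t2 k = mj%:M ->
  a2_refl h (rv h) c x t1 f1 g1 -> a2_refl h (rv h) c x t2 f2 g2 -> riso t1 t2.
Proof.
move=> one mi1 mi2 mj1 mj2 H1 H2; set h' := rv h in H1 H2 *.
have one' : #|arr j i| = 1%N by rewrite card_arrC.
have ji : j != i := arr_neq h; have ij : i != j by rewrite eq_sym.
have oi (k : star_ix i) : k != kx h -> off i j k.
  by move=> kh; rewrite /off touch_same (kx_touch one kh).
have oj (k : star_ix j) : k != kx h' -> off i j k.
  by move=> kh; rewrite /off touch_same andbT (kx_touch one' kh).
have oi' (k : star_ix i) : k != kx h -> off j i k by rewrite /off andbC; exact: oi.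
have oj' (k : star_ix j) : k != kx h' -> off j i k by rewrite /off andbC; exact: oj.
have U m n (f : forall j, 'M[C]_(`|m j|, `|n j|)) g : (forall k, ~~ pred2 i j k -> g k *m f k = 1%:M) ->
   forall l (k : star_ix l), off i j k -> ufm w g k *m ufm w f k = 1%:M.
  move=> e l k /andP [o1 o2]; apply: (@ufmK_off _ _ w _ _ _ _ (pred2 i j)) => //.
  by move=> k0 /orP [] /eqP ->.
have U' m n (f : forall j, 'M[C]_(`|m j|, `|n j|)) g : (forall k, ~~ pred2 i j k -> g k *m f k = 1%:M) ->
   forall l (k : star_ix l), off j i k -> ufm w g k *m ufm w f k = 1%:M.
  by move=> e l k; rewrite /off andbC; exact: U.
have gf1 := U _ _ _ _ (a2_gf H1); have fg1 := U _ _ _ _ (a2_fg H1).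
have gf2 := U _ _ _ _ (a2_gf H2); have fg2 := U _ _ _ _ (a2_fg H2).
have gf1' := U' _ _ _ _ (a2_gf H1); have fg1' := U' _ _ _ _ (a2_fg H1).
have gf2' := U' _ _ _ _ (a2_gf H2); have fg2' := U' _ _ _ _ (a2_fg H2).
have [hi [hi' [a1 a2 hP]]] := half_iso (a2_i H1) (a2_i H2) oi oj gf1 fg1 gf2 fg2.
have [hj [hj' [b1 b2 hQ]]] := half_iso (a2_j H1) (a2_j H2) oj' oi' gf1' fg1' gf2' fg2'.
have Ei : rx t2 h *m hi = hj *m rx t1 h.
  apply: mulmx_ext => a; rewrite -!mulmxA; apply: (half_rel_unique (a2_j H2)) (hQ (rx t1 h *m a)).
  split=> k kh; first by case: (hP a) => _; apply.
  exact: (half_rel_loop (a2_i H1) (a2_i H2) oi gf1 fg1 (erefl _) mi1 mi2 (hP a) kh).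
have Ej : rx t2 h' *m hj = hi *m rx t1 h'.
  apply: mulmx_ext => a; rewrite -!mulmxA; apply: (half_rel_unique (a2_i H2)) (hP (rx t1 h' *m a)).
  split=> k kh; first by case: (hQ a) => _; apply.
  exact: (half_rel_loop (a2_j H1) (a2_j H2) oj' gf1' fg1' (rvK h) mj1 mj2 (hQ a) kh).
pose T k := 'M[C]_(`|v2 k|, `|v1 k|); pose T' k := 'M[C]_(`|v1 k|, `|v2 k|).
pose g := dfwith (T := T) (dfwith (T := T) (fun k => f2 k *m g1 k) hj) hi.
pose gi := dfwith (T := T') (dfwith (T := T') (fun k => f1 k *m g2 k) hj') hi'.
have gI : g i = hi by rewrite /g dfwith_in.
have gJ : g j = hj by rewrite /g dfwith_out // dfwith_in.
have giI : gi i = hi' by rewrite /gi dfwith_in.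
have giJ : gi j = hj' by rewrite /gi dfwith_out // dfwith_in.
have gk k : ~~ pred2 i j k -> g k = f2 k *m g1 k.
  by rewrite /= negb_or => /andP [ki kj]; rewrite /g !dfwith_out 1?eq_sym.
have gik k : ~~ pred2 i j k -> gi k = f1 k *m g2 k.
  by rewrite /= negb_or => /andP [ki kj]; rewrite /gi !dfwith_out 1?eq_sym.
have ug l (k : star_ix l) : off i j k -> ufm w g k = trans12 g1 f2 k.
  rewrite /trans12 -ufm_comp; case: k => [a|] //= /andP [o1 o2]; apply: gk.
  by rewrite /= negb_or o1 o2.
have lBh v0 (t : rep v0) : lB t (kx h) = (eps h)%:~R *: rx t h' by [].
have lBh' v0 (t : rep v0) : lB t (kx h') = (eps h')%:~R *: rx t h by rewrite /= rvK.
apply: (riso_glue (J := pred2 i j) (g := g) (gi := gi)).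
- move=> k; case: (boolP (pred2 i j k)) => [/orP [] /eqP -> | nk].
  + by rewrite gI giI.
  + by rewrite gJ giJ.
  + by rewrite gk // gik // -mulmxA (mulmxA (g2 k)) (a2_gf H2) // mul1mx (a2_fg H1).
- move=> k; case: (boolP (pred2 i j k)) => [/orP [] /eqP -> | nk].
  + by rewrite gI giI.
  + by rewrite gJ giJ.
  + by rewrite gk // gik // -mulmxA (mulmxA (g1 k)) (a2_gf H1) // mul1mx (a2_fg H2).
- move=> l k /orP [] /eqP el; move: k; rewrite el => k.
  + rewrite gI; case: (eqVneq k (kx h)) => [->|kh]; first by rewrite /= gJ Ei.
    by apply: mulmx_ext => a; rewrite ug ?oi // -[LHS]mulmxA -[RHS]mulmxA; case: (hP a) => ->.
  + rewrite gJ; case: (eqVneq k (kx h')) => [->|kh]; first by rewrite /= gI Ej.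
    by apply: mulmx_ext => a; rewrite ug ?oj // -[LHS]mulmxA -[RHS]mulmxA; case: (hQ a) => ->.
- move=> l k /orP [] /eqP el; move: k; rewrite el => k.
  + rewrite gI; case: (eqVneq k (kx h)) => [->|kh].
      by rewrite !lBh -scalemxAr -scalemxAl -Ej -gJ.
    by rewrite ug ?oi // (half_lB (a2_i H1) (a2_i H2) oi oj gf1 fg1 hP kh).
  + rewrite gJ; case: (eqVneq k (kx h')) => [->|kh].
      by rewrite !lBh' -scalemxAr -scalemxAl -Ei -gI.
    by rewrite ug ?oj // (half_lB (a2_j H1) (a2_j H2) oj' oi' gf1' fg1' hQ kh).
- move=> k l e nk nl; rewrite !gk //.
  have -> : rx t1 e = f1 l *m rx x e *m g1 k.
    by rewrite (a2_x H1) // -mulmxA (a2_fg H1) // mulmx1.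
  rewrite -!mulmxA (mulmxA (g1 l)) (a2_gf H1) // mul1mx mulmxA (a2_x H2) //.
  by rewrite mulmxA.
- by move=> k nk; rewrite gk // -(a2_p H1) // -mulmxA (mulmxA (g1 k)) (a2_gf H1) // mul1mx (a2_p H2).
- by move=> k nk; rewrite gk // mulmxA -(a2_q H2) // (a2_q H1) // -mulmxA (a2_fg H1) // mulmx1.
Qed.

(** The constants are minus the values of z at the roots i, i + j, j, met in opposite orders on the
    two sides. The moment map equations at both ends, needed for uniqueness, have the same parameter
    by the braid relation. *)
Lemma hrefl_braid v v1 v2 v3 v1' v2' v3' i j (z : I -> C) (x : rep v)
    (y1 : rep v1) (y2 : rep v2) (y3 : rep v3) (y1' : rep v1') (y2' : rep v2') (y3' : rep v3') :
  i != j -> #|arr i j| = 1%N -> in_Lambda z x ->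
  hrefl i (- z i) x y1 -> hrefl j (- (z i + z j)) y1 y2 -> hrefl i (- z j) y2 y3 ->
  hrefl j (- z j) x y1' -> hrefl i (- (z i + z j)) y1' y2' -> hrefl j (- z i) y2' y3' ->
  riso y3 y3'.
Proof.
move=> ij one L h1 h2 h3 h1' h2' h3'.
have ji : j != i by rewrite eq_sym.
have one' : #|arr j i| = 1%N by rewrite card_arrC.
have [h0 _] : exists h0 : arr i j, true.
  by move/eqP: one => /fintype1P [h0 _]; exists h0.
have E1 k l (u : I -> C) : k != l -> #|arr k l| = 1%N -> srefl l (srefl k u) k = u l.
  move=> kl e; rewrite srefl_neq 1?eq_sym // card_arrC e mulr1n srefl_same srefl_neq //.
  by rewrite e mulr1n [u l + _]addrC addKr.
have E2 k l (u : I -> C) : k != l -> #|arr k l| = 1%N -> srefl k u l = u k + u l.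
  by move=> kl e; rewrite srefl_neq // e mulr1n addrC.
have L3 : in_Lambda (srefl i (srefl j (srefl i z))) y3.
  apply: hrefl_Lambda (_ : hrefl i _ y2 y3) _; first by rewrite srefl_same E1.
  apply: hrefl_Lambda (_ : hrefl j _ y1 y2) _; first by rewrite srefl_same E2.
  by apply: hrefl_Lambda (_ : hrefl i _ x y1) _; rewrite ?srefl_same.
have L3' : in_Lambda (srefl i (srefl j (srefl i z))) y3'.
  rewrite srefl_braid //.
  apply: hrefl_Lambda (_ : hrefl j _ y2' y3') _; first by rewrite srefl_same E1.
  apply: hrefl_Lambda (_ : hrefl i _ y1' y2') _; first by rewrite srefl_same E2 // addrC.
  by apply: hrefl_Lambda (_ : hrefl j _ x y1') _; rewrite ?srefl_same.
have [f [g H]] := hrefl_chain h0 one (esym (opprD _ _)) h1 h2 h3.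
have e' : - z j + - z i = - (z i + z j) by rewrite -opprD addrC.
have [f' [g' H']] := hrefl_chain (rv h0) one' e' h1' h2' h3'.
rewrite rvK in H'.
move/in_LambdaP: L3 => L3; move/in_LambdaP: L3' => L3'.
exact: (a2_refl_unique one (L3 i) (L3' i) (L3 j) (L3' j) H (a2_refl_sym H')).
Qed.

End A2Unique.

(** * Reflections along words *)

Section Words.
Variables (R : realType) (G : dgraph) (w : vtx G -> nat).
Local Notation C := (R[i]).
Local Notation I := (vtx G).
Local Notation rep := (rep R w).
Implicit Types (v : I -> int) (i j : I) (zeta : param R G).
Local Notation p1 i zeta := (pact [:: i] zeta).

(** [sslocus] asks for a nonnegative vector, while a representation sees absolute values only; this
    closure is invariant under isomorphism. *)
Definition ssr zeta v (x : rep v) : Prop :=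
  exists v0 (x0 : rep v0), sslocus zeta x0 /\ riso x0 x.

Lemma ssr_riso zeta v v' (x : rep v) (y : rep v') : riso x y -> ssr zeta x -> ssr zeta y.
Proof. by move=> e [v0 [x0 [s e0]]]; exists v0, x0; split => //; exact: riso_trans e. Qed.

Lemma ssr_Lambda zeta v (x : rep v) : ssr zeta x -> in_Lambda zeta.2 x.
Proof.
move=> [v0 [x0 [[_ /in_LambdaP L _] [g [g' [e1 e2 hx hp hq]]]]]]; apply/in_LambdaP => i.
have -> : \sum_(k : star_ix i) lB x k *m lA x k = g i *m (\sum_(k : star_ix i) lB x0 k *m lA x0 k) *m g' i.
  rewrite mulmx_sumr mulmx_suml; apply: eq_bigr => k _.
  rewrite mulmxA (riso_lB hx hp) -!mulmxA; congr (_ *m _).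
  by rewrite mulmxA (riso_lA hx hq) -mulmxA e2 mulmx1.
by rewrite L mul_mx_scalar -scalemxAl e2 scalemx1.
Qed.

Lemma step_ssr i zeta v v' (x : rep v) (y : rep v') :
  step i zeta x y -> ssr zeta x -> ssr (p1 i zeta) y.
Proof.
move=> s [v0 [x0 [s0 e0]]]; have [v1 [y0 hy]] := step_exists (step_defd s) s0.
exists _, y0; split; first exact: step_sslocus erefl hy v1 s0.
by apply: step_unique (step_riso e0 (riso_refl _) hy) s.
Qed.

Lemma step_ex i zeta v (x : rep v) : ssr zeta x -> defd zeta i ->
  exists v' (y : rep v'), step i zeta x y.
Proof.
move=> [v0 [x0 [s0 e0]]] d; have [v1 [y0 hy]] := step_exists d s0.
by exists _, y0; exact: step_riso e0 (riso_refl _) hy.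
Qed.

Definition comm_at zeta i j : Prop :=
  forall v v1 v2 v1' v2' (x : rep v) (y1 : rep v1) (y2 : rep v2) (y1' : rep v1') (y2' : rep v2'),
  ssr zeta x -> step i zeta x y1 -> step j (p1 i zeta) y1 y2 ->
  step j zeta x y1' -> step i (p1 j zeta) y1' y2' -> riso y2 y2'.

Definition braid_at zeta i j : Prop :=
  forall v v1 v2 v3 v1' v2' v3' (x : rep v) (y1 : rep v1) (y2 : rep v2) (y3 : rep v3)
    (y1' : rep v1') (y2' : rep v2') (y3' : rep v3'),
  ssr zeta x -> step i zeta x y1 -> step j (p1 i zeta) y1 y2 -> step i (p1 j (p1 i zeta)) y2 y3 ->
  step j zeta x y1' -> step i (p1 j zeta) y1' y2' -> step j (p1 i (p1 j zeta)) y2' y3' ->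
  riso y3 y3'.

Lemma comm_at_sym zeta i j : comm_at zeta i j -> comm_at zeta j i.
Proof. by move=> H v v1 v2 v1' v2' x y1 y2 y1' y2' s a b c d; apply: riso_sym; exact: H s c d a b. Qed.

Lemma braid_at_sym zeta i j : braid_at zeta i j -> braid_at zeta j i.
Proof.
move=> H v v1 v2 v3 v1' v2' v3' x y1 y2 y3 y1' y2' y3' s a b c a' b' c'.
by apply: riso_sym; exact: H s a' b' c' a b c.
Qed.

Lemma p1_comm i j zeta : i != j -> #|arr i j| = 0%N -> p1 i (p1 j zeta) = p1 j (p1 i zeta).
Proof. by move=> ij e; case: zeta => a b; rewrite /pact /= !(srefl_comm _ ij e). Qed.

Lemma p1_braid i j zeta : i != j -> #|arr i j| = 1%N ->
  p1 i (p1 j (p1 i zeta)) = p1 j (p1 i (p1 j zeta)).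
Proof. by move=> ij e; case: zeta => a b; rewrite /pact /= !(srefl_braid _ ij e). Qed.

Lemma p1_same1 i zeta : (p1 i zeta).1 i = - zeta.1 i.
Proof. exact: srefl_same. Qed.
Lemma p1_same2 i zeta : (p1 i zeta).2 i = - zeta.2 i.
Proof. exact: srefl_same. Qed.
Lemma p1_neq1 i j zeta : i != j -> (p1 i zeta).1 j = zeta.1 j + zeta.1 i *+ #|arr i j|.
Proof. exact: srefl_neq. Qed.
Lemma p1_neq2 i j zeta : i != j -> (p1 i zeta).2 j = zeta.2 j + zeta.2 i *+ #|arr i j|.
Proof. exact: srefl_neq. Qed.

(* The square of S_i and S_j read from its next corner. *)
Lemma comm_at_rot zeta i j : i != j -> #|arr i j| = 0%N -> comm_at (p1 i zeta) i j -> comm_at zeta i j.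
Proof.
move=> ij e H v v1 v2 v1' v2' x y1 y2 y1' y2' s a b c d.
have sy1 := step_ssr a s; have sy2 := step_ssr b sy1.
have ej (u : param R G) : defd (p1 j u) i <-> defd u i.
  by rewrite /defd p1_neq1 1?eq_sym // p1_neq2 1?eq_sym // card_arrC e !addr0.
have di : defd (p1 j (p1 i zeta)) i by apply/ej; exact: step_defd (step_sym a).
have [v3 [z hz]] := step_ex sy2 di.
have b' : step j (p1 i (p1 i zeta)) x y1' by rewrite pact1K.
have e1 := H _ _ _ _ _ _ _ _ _ _ sy1 (step_sym a) b' b hz.
have hz' := step_sym hz; rewrite -(p1_comm zeta ij e) pact1K in hz'.
exact: step_unique hz' (step_riso e1 (riso_refl _) d).
Qed.

Lemma comm_at_dir zeta i j : i != j -> #|arr i j| = 0%N ->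
  dir zeta i -> dir zeta j -> comm_at zeta i j.
Proof.
move=> ij e di dj v v1 v2 v1' v2' x y1 y2 y1' y2' s a b c d.
have e' : #|arr j i| = 0%N by rewrite card_arrC.
have dj' : dir (p1 i zeta) j by rewrite /dir p1_neq1 // p1_neq2 // e !addr0.
have di' : dir (p1 j zeta) i by rewrite /dir p1_neq1 1?eq_sym // p1_neq2 1?eq_sym // e' !addr0.
have b' := step_dir dj' b; rewrite p1_neq2 // e addr0 in b'.
have d' := step_dir di' d; rewrite p1_neq2 1?eq_sym // e' addr0 in d'.
exact: hrefl_comm ij e (step_dir di a) b' (step_dir dj c) d'.
Qed.

Lemma defd_dir zeta i : defd zeta i -> ~ dir zeta i -> dir (p1 i zeta) i.
Proof.
move=> d nd; case: (defdP d) => // h.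
by rewrite /dir p1_same1 p1_same2; exact: h.
Qed.

(** s_i does not affect the value at j, so one rotation for each vertex that is not direct
    suffices. *)
Lemma comm_all zeta i j : i != j -> #|arr i j| = 0%N -> defd zeta i -> defd zeta j -> comm_at zeta i j.
Proof.
move=> ij e di dj; have ji : j != i by rewrite eq_sym.
have e' : #|arr j i| = 0%N by rewrite card_arrC.
have half_case u : dir u i -> defd u j -> comm_at u i j.
  move=> dui duj; have [duj'|nd] := pselect (dir u j); first exact: comm_at_dir.
  apply: comm_at_sym; apply: comm_at_rot => //; apply: comm_at_sym.
  apply: comm_at_dir => //; last exact: defd_dir.
  by rewrite /dir p1_neq1 // p1_neq2 // e' !addr0.
have [h|h] := pselect (dir zeta i); first exact: half_case.
apply: comm_at_rot => //; apply: half_case; first exact: defd_dir.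
by rewrite /defd p1_neq1 // p1_neq2 // e !addr0.
Qed.

(** The hypotheses say that the values at the positive roots i, j and i + j are direct; every step
    on either side meets one of these values. *)
Lemma braid_at_dir zeta i j : i != j -> #|arr i j| = 1%N ->
  dir zeta i -> dir zeta j -> dir (p1 i zeta) j -> braid_at zeta i j.
Proof.
move=> ij e di dj dij v v1 v2 v3 v1' v2' v3' x y1 y2 y3 y1' y2' y3' s a b c a' b' c'.
have ji : j != i by rewrite eq_sym.
have e' : #|arr j i| = 1%N by rewrite card_arrC.
have v1i : (p1 j (p1 i zeta)).1 i = zeta.1 j.
  by rewrite p1_neq1 // e' mulr1n p1_same1 p1_neq1 // e mulr1n [_ + zeta.1 i]addrC addKr.
have v2i : (p1 j (p1 i zeta)).2 i = zeta.2 j.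
  by rewrite p1_neq2 // e' mulr1n p1_same2 p1_neq2 // e mulr1n [_ + zeta.2 i]addrC addKr.
have v1j : (p1 i (p1 j zeta)).1 j = zeta.1 i.
  by rewrite p1_neq1 // e mulr1n p1_same1 p1_neq1 // e' mulr1n [_ + zeta.1 j]addrC addKr.
have v2j : (p1 i (p1 j zeta)).2 j = zeta.2 i.
  by rewrite p1_neq2 // e mulr1n p1_same2 p1_neq2 // e' mulr1n [_ + zeta.2 j]addrC addKr.
have w2j : (p1 i zeta).2 j = zeta.2 i + zeta.2 j by rewrite p1_neq2 // e mulr1n addrC.
have w2i : (p1 j zeta).2 i = zeta.2 i + zeta.2 j by rewrite p1_neq2 // e' mulr1n.
have dji : dir (p1 j zeta) i.
  move: dij; rewrite /dir w2j w2i p1_neq1 // p1_neq1 // e e' !mulr1n [zeta.1 j + _]addrC.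
  by [].
have hb := step_dir dij b; rewrite w2j in hb.
have hb' := step_dir dji b'; rewrite w2i in hb'.
have dc : dir (p1 j (p1 i zeta)) i by rewrite /dir v1i v2i.
have dc' : dir (p1 i (p1 j zeta)) j by rewrite /dir v1j v2j.
have hc := step_dir dc c; rewrite v2i in hc.
have hc' := step_dir dc' c'; rewrite v2j in hc'.
exact: hrefl_braid ij e (ssr_Lambda s) (step_dir di a) hb hc (step_dir dj a') hb' hc'.
Qed.

(** For a single edge: the parameter does not vanish at any of the positive roots i, j, i + j. *)
Definition defd3 zeta i j : Prop := [/\ defd zeta i, defd zeta j & defd (p1 i zeta) j].

Lemma defd3_rot zeta i j : i != j -> #|arr i j| = 1%N -> defd3 zeta i j -> defd3 (p1 i zeta) i j.
Proof.
move=> ij e [di dj dij]; split => //; last by rewrite pact1K.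
by move: di; rewrite /defd p1_same1 p1_same2 !oppr_eq0.
Qed.

Lemma defd3_sym zeta i j : i != j -> #|arr i j| = 1%N -> defd3 zeta i j -> defd3 zeta j i.
Proof.
move=> ij e [di dj dij]; split => //; have ji : j != i by rewrite eq_sym.
move: dij; rewrite /defd !p1_neq1 // !p1_neq2 // [#|arr j i|]card_arrC e !mulr1n.
by rewrite [zeta.1 j + _]addrC [zeta.2 j + _]addrC.
Qed.

(* The hexagon of S_i and S_j read from its next corner. *)
Lemma braid_at_rot zeta i j : i != j -> #|arr i j| = 1%N -> defd3 zeta i j ->
  braid_at (p1 i zeta) i j -> braid_at zeta i j.
Proof.
move=> ij e [di dj dij] H v v1 v2 v3 v1' v2' v3' x y1 y2 y3 y1' y2' y3' s a b c a' b' c'.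
have s1 := step_ssr a s; have s2 := step_ssr b s1; have s3 := step_ssr c s2.
have d4 : defd (p1 i (p1 j (p1 i zeta))) j.
  by rewrite p1_braid //; exact: step_defd (step_sym c').
have [v4 [z hz]] := step_ex s3 d4.
have aa : step j (p1 i (p1 i zeta)) x y1' by rewrite pact1K.
have bb : step i (p1 j (p1 i (p1 i zeta))) y1' y2' by rewrite pact1K.
have e1 := H _ _ _ _ _ _ _ _ _ _ _ _ _ _ s1 (step_sym a) aa bb b c hz.
have hz' := step_sym hz; rewrite (p1_braid zeta ij e) pact1K in hz'.
exact: step_unique hz' (step_riso e1 (riso_refl _) c').
Qed.

Lemma braid_all zeta i j : i != j -> #|arr i j| = 1%N -> defd3 zeta i j -> braid_at zeta i j.
Proof.
have val1 k l (u : param R G) : k != l -> #|arr k l| = 1%N -> (p1 k u).1 l = u.1 k + u.1 l.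
  by move=> kl e; rewrite p1_neq1 // e mulr1n addrC.
have val2 k l (u : param R G) : k != l -> #|arr k l| = 1%N -> (p1 k u).2 l = u.2 k + u.2 l.
  by move=> kl e; rewrite p1_neq2 // e mulr1n addrC.
have A k l (u : param R G) : k != l -> #|arr k l| = 1%N -> defd3 u k l -> dir u k -> dir u l -> braid_at u k l.
  move=> kl e d dk dl; have [dm|ndm] := pselect (dir (p1 k u) l); first exact: braid_at_dir.
  have lk : l != k by rewrite eq_sym.
  have e' : #|arr l k| = 1%N by rewrite card_arrC.
  (* Here $\xi_k+\xi_l>0$ and $\zeta_{\mathbb C}$ vanishes at k + l. If it vanished at k or l it
     would vanish at both, making $\xi_k$ and $\xi_l$ negative. So it is nonzero at k and l, and two
     rotations make all three roots direct. *)
  have [b0 b2] : 0 < (p1 k u).1 l /\ (p1 k u).2 l = 0.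
    have := d; case=> _ _ dd; split; last by apply/eqP/negP => /negP h; apply: ndm; right.
    case: dd => h; last by case: ndm; right.
    by rewrite lt_neqAle eq_sym h leNgt; apply/negP => h'; apply: ndm; left.
  rewrite val1 // in b0; rewrite val2 // in b2.
  have uk2 : u.2 k != 0.
    apply/eqP => uk0; move: b2 dl dk; rewrite /dir uk0 add0r => ->; rewrite eqxx.
    by move=> [h|//] [h'|//]; have := ltrD h' h; rewrite addr0 ltNge (ltW b0).
  have ul2 : u.2 l != 0.
    by apply: contra_neq uk2 => ul0; rewrite ul0 addr0 in b2.
  apply: braid_at_rot => //; apply: braid_at_sym; apply: braid_at_rot => //.
    by apply: defd3_sym => //; exact: defd3_rot.
  apply: braid_at_dir => //.
  + by left; rewrite p1_same1 val1 // oppr_lt0.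
  + by right; rewrite val2 // val2 // p1_same2 addrC addKr.
  + by rewrite pact1K; right; rewrite p1_same2 oppr_eq0.
have B k l (u : param R G) : k != l -> #|arr k l| = 1%N -> defd3 u k l -> dir u k -> braid_at u k l.
  move=> kl e d dk; have [dl|ndl] := pselect (dir u l); first exact: A.
  have lk : l != k by rewrite eq_sym.
  have e' : #|arr l k| = 1%N by rewrite card_arrC.
  have d' := defd3_sym kl e d.
  (* Rotating at l makes l direct and puts the value of k + l at k. If that one is not direct, a
     rotation at k makes it so and brings the original value of k to l. *)
  apply: braid_at_sym; apply: braid_at_rot => //.
  have dll : dir (p1 l u) l by apply: defd_dir => //; case: d.
  have r1 := defd3_rot lk e' d'.
  have [dlk|ndlk] := pselect (dir (p1 l u) k); first exact: A.
  apply: braid_at_sym; apply: braid_at_rot => //; first exact: defd3_sym.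
  apply: A => //; first by apply: defd3_rot => //; exact: defd3_sym.
    by apply: defd_dir => //; case: r1 => _.
  move: dk; rewrite /dir val1 // val2 // val1 // val2 // p1_same1 p1_same2.
  by rewrite [u.1 l + _]addrC [u.2 l + _]addrC !addrK.
move=> ij e d; have [di|ndi] := pselect (dir zeta i); first exact: B.
apply: braid_at_rot => //; apply: B => //; first exact: defd3_rot.
by apply: defd_dir => //; case: d.
Qed.

Fixpoint wstep r zeta v v' (x : rep v) (y : rep v') : Prop :=
  if r is i :: r' then
    exists u (z : rep u), wstep r' zeta x z /\ step i (pact r' zeta) z y
  else riso x y.

Lemma wstep_riso r zeta v v' v1 v1' (x : rep v) (y : rep v') (x1 : rep v1) (y1 : rep v1') :
  riso x x1 -> riso y y1 -> wstep r zeta x y -> wstep r zeta x1 y1.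
Proof.
elim: r v' v1' y y1 => [|i r IH] v' v1' y y1 ex ey /=.
  by move=> e; apply: riso_trans (riso_sym ex) (riso_trans e ey).
move=> [u [z [h s]]]; exists u, z; split; first exact: IH (riso_refl z) h.
exact: step_riso (riso_refl z) ey s.
Qed.

Lemma wstep_unique r zeta v v1 v2 (x : rep v) (y1 : rep v1) (y2 : rep v2) :
  wstep r zeta x y1 -> wstep r zeta x y2 -> riso y1 y2.
Proof.
elim: r v1 v2 y1 y2 => [|i r IH] v1 v2 y1 y2 /=.
  by move=> e1 e2; apply: riso_trans (riso_sym e1) e2.
move=> [u1 [z1 [h1 s1]]] [u2 [z2 [h2 s2]]]; have e := IH _ _ _ _ h1 h2.
exact: step_unique (step_riso e (riso_refl _) s1) s2.
Qed.

Lemma pact_cons i r zeta : pact (i :: r) zeta = p1 i (pact r zeta).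
Proof. by []. Qed.

Lemma wstep_ssr r zeta v v' (x : rep v) (y : rep v') :
  ssr zeta x -> wstep r zeta x y -> ssr (pact r zeta) y.
Proof.
elim: r v' y => [|i r IH] v' y s /=; first by move=> e; case: (zeta) s => a b; exact: ssr_riso.
by move=> [u [z [h st]]]; exact: step_ssr st (IH _ _ s h).
Qed.

Lemma wstep_ex r zeta v (x : rep v) : ssr zeta x -> word_defined r zeta ->
  exists v' (y : rep v'), wstep r zeta x y.
Proof.
move=> s; elim: r => [|i r IH] /=; first by exists v, x; exact: riso_refl.
move=> [/IH [v' [y hy]] d]; have [v'' [z hz]] := step_ex (wstep_ssr s hy) d.
by exists v'', z, v', y.
Qed.

Lemma wstep_defined r zeta v v' (x : rep v) (y : rep v') : wstep r zeta x y -> word_defined r zeta.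
Proof.
elim: r v' y => [//|i r IH] v' y /= [u [z [h s]]]; split; first exact: IH h.
exact: step_defd s.
Qed.

(** Definedness passes one way only, as cancellation of [i :: i] demands. The equal actions on
    parameters and vectors are recorded to make the relation stable under adding a letter. *)
Definition word_le r r' : Prop :=
  (forall zeta, pact r zeta = pact r' zeta) /\ (forall v, star w r v = star w r' v) /\
  (forall zeta, word_defined r zeta -> word_defined r' zeta /\
   forall v v1 v2 (x : rep v) (y1 : rep v1) (y2 : rep v2), ssr zeta x ->
     wstep r zeta x y1 -> wstep r' zeta x y2 -> riso y1 y2).

Lemma pact_cat r r' zeta : pact (r ++ r') zeta = pact r (pact r' zeta).
Proof. by rewrite /pact /wact !foldr_cat. Qed.

(** The weight $\mathbf w-C\mathbf v$. The action * is affine in $\mathbf v$ but linear in this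
    vector, where it is [srefl]. *)
Definition star_def i v : int := (w i)%:Z - \sum_k cartan i k * v k.

Lemma star1_at i v : star1 w i v i = v i + star_def i v.
Proof. by rewrite /star1 eqxx /star_def addrA addrAC. Qed.

Lemma star1_off i j v : j != i -> star1 w i v j = v j.
Proof. by move=> /negbTE ji; rewrite /star1 ji. Qed.

Lemma star_def_star1 i j v : star_def i (star1 w j v) = star_def i v - cartan i j * star_def j v.
Proof.
rewrite /star_def (bigD1 j) //= star1_at [in RHS](bigD1 j) //=.
have -> : \sum_(k | k != j) cartan i k * star1 w j v k = \sum_(k | k != j) cartan i k * v k.
  by apply: eq_bigr => k kj; rewrite star1_off.
rewrite /star_def; ring.
Qed.

Lemma star_comm i j v : i != j -> #|arr i j| = 0%N ->
  star1 w i (star1 w j v) = star1 w j (star1 w i v).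
Proof.
move=> ij e; have ji : j != i by rewrite eq_sym.
have cij : cartan i j = 0 by rewrite cartan_neq // e.
have cji : cartan j i = 0 by rewrite cartanC.
apply: funext => k; case: (eqVneq k i) => [->|ki].
  by rewrite star1_at !(star1_off _ ij) star1_at star_def_star1 cij mul0r subr0.
case: (eqVneq k j) => [->|kj]; last by rewrite !star1_off.
by rewrite (star1_off _ ji) !star1_at (star1_off _ ji) star_def_star1 cji mul0r subr0.
Qed.

Lemma star_braid i j v : i != j -> #|arr i j| = 1%N ->
  star1 w i (star1 w j (star1 w i v)) = star1 w j (star1 w i (star1 w j v)).
Proof.
move=> ij e; have ji : j != i by rewrite eq_sym.
have cij : cartan i j = -1 by rewrite cartan_neq // e.
have cji : cartan j i = -1 by rewrite cartanC.
apply: funext => k; case: (eqVneq k i) => [->|ki].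
  rewrite star1_at (star1_off _ ij) star1_at (star1_off _ ij) star1_at (star1_off _ ij).
  by rewrite !star_def_star1 cij cji cartanii; ring.
case: (eqVneq k j) => [->|kj]; last by rewrite !star1_off.
rewrite (star1_off _ ji) star1_at (star1_off _ ji) star1_at (star1_off _ ji) star1_at.
by rewrite !star_def_star1 cij cji cartanii; ring.
Qed.

(** Definedness survives the rank two moves because both sides meet the same values of the
    parameter, in another order. *)
Lemma weyl_word_le r r' : weyl_eq r r' -> exists2 r0, word_le r r0 & word_le r' r0.
Proof.
apply: tits.
- move=> s; split=> //; split=> // zeta d; split=> // v v1 v2 x y1 y2 _.
  exact: wstep_unique.
- move=> r1 r2 r3 [p12 [s12 h12]] [p23 [s23 h23]]; split; first by move=> z; rewrite p12.
  split=> [v|zeta d1]; first by rewrite s12.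
  have [d2 e12] := h12 _ d1; have [d3 e23] := h23 _ d2; split=> // v v1 v2 x y1 y2 sx a b.
  have [v3 [z hz]] := wstep_ex sx d2.
  exact: riso_trans (e12 _ _ _ _ _ _ sx a hz) (e23 _ _ _ _ _ _ sx hz b).
- move=> k s s' [p [st h]]; split; first by move=> z; rewrite pact_cons p.
  split=> [v|zeta /= [d dk]]; first by rewrite /= st.
  have [d' e] := h _ d.
  have q : defd (pact s' zeta) k by rewrite -p; exact: dk.
  split; first by split.
  move=> v v1 v2 x y1 y2 sx /= [u1 [z1 [a1 b1]]] [u2 [z2 [a2 b2]]].
  have ez := e _ _ _ _ _ _ sx a1 a2; rewrite -p in b2.
  exact: step_unique (step_riso ez (riso_refl _) b1) b2.
- move=> i s; split; first by move=> z; exact: (pact1K i (pact s z)).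
  split=> [v|zeta /= [[d _] _]]; first by rewrite /= star1K.
  split=> // v v1 v2 x y1 y2 sx /= [u1 [z1 [[u2 [z2 [a b]]] c]]] h.
  by apply: riso_trans (wstep_unique a h); apply: step_unique c (step_sym b).
- move=> i j s ij e; split; first by move=> z; exact: (p1_comm (pact s z)).
  split=> [v|zeta /= [[d dj] di]]; first by rewrite /= star_comm.
  have e' : #|arr j i| = 0%N by rewrite card_arrC.
  have ji : j != i by rewrite eq_sym.
  have di' : defd (pact s zeta) i.
    have : defd (p1 j (pact s zeta)) i by exact: di.
    by rewrite /defd p1_neq1 // p1_neq2 // e' !addr0.
  have dj' : defd (p1 i (pact s zeta)) j by rewrite /defd p1_neq1 // p1_neq2 // e !addr0.
  split=> // v v1 v2 x y1 y2 sx /= [a1 [a2 [[b1 [b2 [h1 s1]]] t1]]] [c1 [c2 [[d1 [d2 [h2 s2]]] t2]]].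
  have E := wstep_unique h1 h2; have sb := wstep_ssr sx h1.
  have H := comm_all (zeta := pact s zeta) ji e' dj di'.
  exact: (H _ _ _ _ _ _ _ _ _ _ sb s1 t1 (step_riso (riso_sym E) (riso_refl _) s2) t2).
- move=> i j s ij e; split; first by move=> z; exact: (p1_braid (pact s z)).
  have ji : j != i by rewrite eq_sym.
  have e' : #|arr j i| = 1%N by rewrite card_arrC.
  split=> [v|zeta /= [[[d di] dji] d3]]; first by rewrite /= star_braid.
  have v1i k l (u : param R G) : k != l -> #|arr k l| = 1%N -> (p1 l (p1 k u)).1 k = u.1 l.
    move=> kl ekl; rewrite p1_neq1 1?eq_sym // card_arrC ekl mulr1n p1_same1 p1_neq1 // ekl mulr1n.
    by rewrite [_ + u.1 k]addrC addKr.
  have v2i k l (u : param R G) : k != l -> #|arr k l| = 1%N -> (p1 l (p1 k u)).2 k = u.2 l.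
    move=> kl ekl; rewrite p1_neq2 1?eq_sym // card_arrC ekl mulr1n p1_same2 p1_neq2 // ekl mulr1n.
    by rewrite [_ + u.2 k]addrC addKr.
  have dj : defd (pact s zeta) j.
    have : defd (p1 j (p1 i (pact s zeta))) i by exact: d3.
    by rewrite /defd v1i // v2i.
  have D3 : defd3 (pact s zeta) i j by [].
  have [_ _ dij] := defd3_sym ij e D3.
  have dj' : defd (p1 i (p1 j (pact s zeta))) j by rewrite /defd v1i // v2i.
  split=> // v v1 v2 x y1 y2 sx /=.
  move=> [a1 [a2 [[b1 [b2 [[c1 [c2 [h1 s1]]] s2]]] s3]]] [a1' [a2' [[b1' [b2' [[c1' [c2' [h1' s1']]] s2']]] s3']]].
  have E := wstep_unique h1 h1'; have sb := wstep_ssr sx h1.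
  have H := braid_all ij e D3.
  exact: (H _ _ _ _ _ _ _ _ _ _ _ _ _ _ sb s1 s2 s3 (step_riso (riso_sym E) (riso_refl _) s1') s2' s3').
Qed.

End Words.

(** * The functors S_x on quiver varieties *)

Section Functor.
Variables (R : realType) (G : dgraph) (w : vtx G -> nat).
Local Notation C := (R[i]).
Local Notation I := (vtx G).
Local Notation rep := (rep R w).
Implicit Types (v : I -> int) (i j : I) (zeta : param R G).
Local Notation p1 i zeta := (pact [:: i] zeta).

Lemma riso_fsub v v' (x : rep v) (y : rep v') D (S : gsub R v') : riso x y -> fsub y D S ->
  exists T : gsub R v, fsub x D T /\ forall i, \dim (T i) = \dim (S i).
Proof.
move=> [g [g' [e1 e2 hx hp hq]]] [st sp sq].
exists (fun i => mximg (g' i) (S i)); split; last by move=> i; exact: dim_mximg (e2 i).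
have TP i u : u \in mximg (g' i) (S i) <-> g i *m u \in S i.
  split=> [/mximgP [s hs ->]|h]; first by rewrite mulmxA e2 mul1mx.
  by rewrite -[u]mul1mx -e1 -mulmxA; exact: mem_mximg.
split.
- by move=> i j h u /TP hu; apply/TP; rewrite mulmxA hx -mulmxA; exact: st.
- by move=> i u hu; apply/TP; rewrite mulmxA hp; exact: sp.
- by move=> i u /TP hu; rewrite hq -mulmxA; exact: sq.
Qed.

Lemma riso_eqdim v v' (x : rep v) (y : rep v') :
  (forall i, 0 <= v i) -> (forall i, 0 <= v' i) -> riso x y -> v = v'.
Proof.
move=> v0 v'0 e; apply: funext => i; rewrite -(gez0_abs (v0 i)) -(gez0_abs (v'0 i)).
by congr Posz; exact: riso_dim e.
Qed.

Lemma riso_sslocus zeta v v' (x : rep v) (y : rep v') :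
  (forall i, 0 <= v' i) -> riso x y -> sslocus zeta x -> sslocus zeta y.
Proof.
move=> v'0 e ssx; have [v0 _ ss] := ssx; have ev := riso_eqdim v0 v'0 e; split=> //.
  by apply: ssr_Lambda; exists v, x.
have /semistableP [h0 h1] := ss.
apply/semistableP; split=> S /(riso_fsub e) [T [fT dT]].
  have -> : theta zeta.1 S = theta zeta.1 T by apply: eq_bigr => i _; rewrite dT.
  exact: h0.
have -> : theta zeta.1 S = theta zeta.1 T by apply: eq_bigr => i _; rewrite dT.
by rewrite -ev; exact: h1.
Qed.

Lemma hrefl_star1_eq v v' i c (x : rep v) (y : rep v') : v' = star1 w i v ->
  hrefl i c x y -> exists2 y' : rep (star1 w i v), riso y y' & refl_rel (i := i) c x y'.
Proof. by move=> e; subst v'; exact: hrefl_star1. Qed.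

Lemma refl_direct_step i zeta v v' (x : rep v) (y : rep v') : v' = star1 w i v ->
  sslocus zeta x -> sslocus (p1 i zeta) y -> hrefl i (- zeta.2 i) x y ->
  refl_direct i zeta (cls zeta x) (cls (p1 i zeta) y).
Proof.
move=> e sx sy h; have [y' ey hy] := hrefl_star1_eq e h.
have [v'0 _ _] := sy; subst v'.
have sy' := riso_sslocus v'0 ey sy.
exists v, x, y'; split; [by split | split=> // | by rewrite p1_same2].
exact: cls_riso ey.
Qed.

(** A point remembers its representative only up to [git_eq]; [Stab] makes this an isomorphism,
    under which [step] is invariant. *)
Lemma refl1P i zeta v (x : rep v) P' : Stab w zeta v -> sslocus zeta x ->
  refl1 i zeta (cls zeta x) P' <->
  exists v' (y : rep v'), [/\ v' = star1 w i v, sslocus (p1 i zeta) y, step i zeta x y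
     & P' = cls (p1 i zeta) y].
Proof.
move=> st sx; split.
- move=> [[d [v2 [x2 [y [[sx2 e] [sy ->] /refl_relP h]]]]]|[d [v2 [y [x2 [[sy ->] [sx2 e] /refl_relP h]]]]]].
    have ev := cls_dim e; subst v2.
    exists (star1 w i v), y; split=> //.
    left; split=> //; rewrite p1_same2 in h.
    apply: hrefl_riso (cls_eq_riso st (esym e)) (riso_refl y) _.
    by exists (idmf R v _), (idmf R _ v).
  have ev := cls_dim e; rewrite pact1K in sx2 e h.
  exists v2, y; split=> //; first by rewrite ev star1K.
  right; split=> //.
  apply: hrefl_riso (riso_refl y) (cls_eq_riso st (esym e)) _.
  by exists (idmf R v2 _), (idmf R _ v2).
- move=> [v' [y [e sy s ->]]].
  case: s => [[d h]|[d h]]; first by left; split=> //; exact: refl_direct_step.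
  right; split=> //.
  have := @refl_direct_step i (p1 i zeta) v' v y x; rewrite pact1K; apply=> //.
    by rewrite e star1K.
  by rewrite p1_same2 opprK.
Qed.

Lemma pact0 zeta : pact [::] zeta = zeta.
Proof. by case: zeta. Qed.

Lemma wstep_sslocus r zeta v (x : rep v) : sslocus zeta x -> word_defined r zeta ->
  exists y : rep (star w r v), sslocus (pact r zeta) y /\ wstep r zeta x y.
Proof.
move=> sx; elim: r => [_|i r IH] /=; first by exists x; split; [rewrite pact0|exact: riso_refl].
move=> [/IH [z [sz hz]] d]; have [v0 [y hy]] := step_exists (zeta := pact r zeta) d sz.
exists y; split; first exact: (step_sslocus erefl hy v0 sz).
by exists _, z.
Qed.

Lemma Stab_word r zeta v : word_defined r zeta -> Stab w zeta v ->
  Stab w (pact r zeta) (star w r v).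
Proof.
move=> d st; elim: r d => [_|i r IH] /=; first by rewrite pact0.
by move=> [/IH s d]; exact: (Stab_step (zeta := pact r zeta) d s).
Qed.

Lemma wstep_dim r zeta v v' (x : rep v) (y : rep v') : sslocus zeta x ->
  (forall i, 0 <= v' i) -> wstep r zeta x y -> v' = star w r v.
Proof.
move=> sx v'0 h; have [y0 [sy0 hy0]] := wstep_sslocus sx (wstep_defined h).
have [v0 _ _] := sy0.
exact: riso_eqdim v'0 v0 (wstep_unique h hy0).
Qed.

Lemma refl_wordP r zeta v (x : rep v) P' : Stab w zeta v -> sslocus zeta x ->
  refl_word r zeta (cls zeta x) P' <->
  exists v' (y : rep v'), [/\ sslocus (pact r zeta) y, wstep r zeta x y
     & P' = cls (pact r zeta) y].
Proof.
move=> st sx; elim: r P' => [|i r IH] P' /=.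
  rewrite pact0; split=> [->|[v' [y [sy e ->]]]]; first by exists v, x; split=> //; exact: riso_refl.
  by symmetry; exact: cls_riso e.
split=> [[Q /IH [u [z [sz hz ->]]]]|[v' [y [sy [u [z [hz s]]] ->]]]].
  have [u0 _ _] := sz; have eu := wstep_dim sx u0 hz; subst u.
  move=> /(refl1P _ _ (Stab_word (wstep_defined hz) st) sz) [v' [y [_ sy hy ->]]].
  by exists v', y; split=> //; exists _, z.
have [z0 [sz0 hz0]] := wstep_sslocus sx (wstep_defined hz).
have s0 := step_riso (wstep_unique hz hz0) (riso_refl y) s.
have [v'0 _ _] := sy.
exists (cls (pact r zeta) z0); first by apply/IH; exists _, z0.
apply/(refl1P _ _ (Stab_word (wstep_defined hz) st) sz0); exists v', y; split=> //.
by apply: (@wstep_dim (i :: r) zeta v v' x y sx v'0); exists u, z.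
Qed.

(** The two chains are compared through a third, along the common word of [weyl_word_le], which
    exists because that word is defined as well. *)
Lemma weyl_wstep r r' zeta v v1 v2 (x : rep v) (y1 : rep v1) (y2 : rep v2) : weyl_eq r r' ->
  ssr zeta x -> wstep r zeta x y1 -> wstep r' zeta x y2 -> riso y1 y2.
Proof.
move=> /(weyl_word_le R w) [r0 [_ [_ h]] [_ [_ h']]] sx a b.
have [d e] := h _ (wstep_defined a); have [_ e'] := h' _ (wstep_defined b).
have [v0 [y0 c]] := wstep_ex sx d.
by apply: riso_trans (e _ _ _ _ _ _ sx a c) _; apply: riso_sym; exact: e' sx b c.
Qed.

Lemma weyl_pact r r' zeta : weyl_eq r r' -> pact r zeta = pact r' zeta.
Proof. by move=> e; rewrite /pact !(weyl_eq_wact _ e). Qed.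

Lemma weyl_star r r' v : weyl_eq r r' -> star w r v = star w r' v.
Proof. by move=> /(weyl_word_le R w) [r0 [_ [a _]] [_ [b _]]]; rewrite a b. Qed.

Lemma pact_revK r zeta : pact (rev r) (pact r zeta) = zeta.
Proof.
case: zeta => a b; rewrite /pact /=; have := wact_revK (rev r); rewrite revK => h.
by rewrite !h.
Qed.

Lemma wstep_cat r r' zeta v v1 v' (x : rep v) (z : rep v1) (y : rep v') :
  wstep r' zeta x z -> wstep r (pact r' zeta) z y -> wstep (r ++ r') zeta x y.
Proof.
move=> h; elim: r v' y => [|i r IH] v' y /=; first by move=> e; exact: wstep_riso (riso_refl x) e h.
by move=> [u [t [a s]]]; exists u, t; split; [exact: IH | rewrite pact_cat].
Qed.

Lemma wstep_rev r zeta v v' (x : rep v) (y : rep v') :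
  wstep r zeta x y -> wstep (rev r) (pact r zeta) y x.
Proof.
elim: r v' y => [|i r IH] v' y /=; first exact: riso_sym.
move=> [u [z [h s]]]; rewrite rev_cons -cats1; apply: (wstep_cat (z := z)).
  exists v', y; split; first exact: riso_refl.
  by rewrite pact0; exact: (step_sym (zeta := pact r zeta)).
have -> : pact [:: i] (pact (i :: r) zeta) = pact r zeta by exact: (pact1K i (pact r zeta)).
exact: IH.
Qed.

Lemma wstep_tau (B : forall i, 'M[C]_(w i)) r zeta v v' (x : rep v) (y : rep v') :
  (forall i, B i \in unitmx) ->
  wstep r zeta x y -> wstep r (popp zeta) (tau1 B x) (tau1 B y).
Proof.
move=> hB; elim: r v' y => [|i r IH] v' y /=; first exact: tau1_riso.
move=> [u [z [h s]]]; exists u, (tau1 B z); split; first exact: IH.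
by rewrite -popp_pact; exact: step_tau.
Qed.

Lemma word_defined_popp r zeta : word_defined r zeta -> word_defined r (popp zeta).
Proof.
elim: r => // i r IH [/IH h d]; split=> //.
by move: d; rewrite -popp_pact /= !oppr_eq0.
Qed.

Lemma functor_is_map x zeta v : Stab w zeta v -> refl_defined x zeta ->
  is_map (@refl_functor R G w x zeta) (@quiver_variety R G w zeta v)
    (@quiver_variety R G w (pact x zeta) (star w x v)).
Proof.
move=> st [r er d] P [t stt ->]; have [y [sy hy]] := wstep_sslocus stt d.
exists (cls (pact r zeta) y); split.
- by exists r => //; apply/refl_wordP => //; exists _, y.
- rewrite -(weyl_pact _ er) -(weyl_star _ er); by exists y.
- move=> P'' [r' er' /(refl_wordP _ _ st stt) [v' [y' [sy' hy' ->]]]].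
  have e0 : weyl_eq r r' by move=> u; rewrite er er'.
  rewrite -(weyl_pact _ e0) in sy' *; apply: cls_riso => //; apply: riso_sym.
  by apply: weyl_wstep e0 _ hy hy'; exists v, t; split=> //; exact: riso_refl.
Qed.

End Functor.

(** * The diagram automorphism *)

(** Composition with the inverse bijection, for dependent families. The casts along th k = k0 are
    unambiguous because proofs of equality in an [eqType] are irrelevant. *)
Lemma dep_reindex (K K0 : eqType) (th : K -> K0) (T : K0 -> Type) :
  bijective th -> forall u : forall k, T (th k), exists u0 : forall k, T k, forall k, u0 (th k) = u k.
Proof.
move=> [ht htK thK] u.
have [u0 h0] : exists u0 : forall k0, T k0, forall k0 k (e : th k = k0), ecast k1 (T k1) e (u k) = u0 k0.
  apply: (dep_choice (P := fun k0 (y : T k0) => forall k (e : th k = k0), ecast k1 (T k1) e (u k) = y)) => k0.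
  case: _ / (thK k0); exists (u (ht k0)) => k e; have ek := can_inj htK e; case: _ / (esym ek) e => e.
  by rewrite (eq_irrelevance e erefl).
by exists u0 => k; rewrite -(h0 _ _ erefl).
Qed.

Lemma lrefl_reindex (F : fieldType) (K K0 : finType) (th : K -> K0) (d d' : K0 -> nat) (n n' : nat)
  (A : forall k, 'M[F]_(d k, n)) (B : forall k, 'M[F]_(n, d k))
  (A' : forall k, 'M[F]_(d' k, n')) (B' : forall k, 'M[F]_(n', d' k))
  (f : forall k, 'M[F]_(d' k, d k)) (c : F) : bijective th ->
  lrefl A B A' B' f c ->
  lrefl (d := fun k => d (th k)) (d' := fun k => d' (th k)) (fun k => A (th k)) (fun k => B (th k))
    (fun k => A' (th k)) (fun k => B' (th k)) (fun k => f (th k)) c.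
Proof.
move=> bth L; have [ht htK thK] := bth.
have sE (u0 : forall k, 'cV_(d k)) : \sum_k B (th k) *m u0 (th k) = \sum_k B k *m u0 k.
  by rewrite [RHS](reindex th) //; exact: onW_bij.
split.
- move=> z hz; apply: (lrefl_inj L) => k; by rewrite -(thK k); exact: hz.
- move=> u; have [u0 hu] := dep_reindex (T := fun k => 'cV[F]_(d k)) bth u.
  have -> : \sum_k B (th k) *m u k = \sum_k B k *m u0 k.
    by rewrite -sE; apply: eq_bigr => k _; rewrite hu.
  rewrite (lrefl_ker L); split=> -[z hz]; exists z => k.
    by rewrite hz hu.
  by rewrite -(thK k) hz hu.
- move=> z; have [u hu] := lrefl_surj L z; exists (fun k => u (th k)).
  by rewrite sE.
- move=> k l kl; apply: (lrefl_off L); apply: contra_neq kl; exact: (can_inj htK).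
- by move=> k; exact: (lrefl_diag L).
Qed.

Section Twist.
Variables (R : realType) (G : dgraph) (w : vtx G -> nat).
Local Notation C := (R[i]).
Local Notation I := (vtx G).
Local Notation rep := (rep R w).
Variable a : diag_aut G.
Variables (phi : forall i : I, 'M[C]_(w (dvtxV a i), w i))
  (phiV : forall i : I, 'M[C]_(w i, w (dvtxV a i))).
Hypothesis hphi : forall i, phi i *m phiV i = 1%:M.
Hypothesis hphiV : forall i, phiV i *m phi i = 1%:M.
Implicit Types (v : I -> int) (i j : I) (zeta : param R G).
Local Notation tw := (rep_twist phi phiV).

Lemma dvtxVK i : dvtx a (dvtxV a i) = i.
Proof. exact: permKV. Qed.

Lemma dvtxK i : dvtxV a (dvtx a i) = i.
Proof. exact: permK. Qed.

Lemma dvtxV_inj : injective (dvtxV a).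
Proof. exact: perm_inj. Qed.

Definition star_ix_twist i (k : star_ix i) : star_ix (dvtxV a i) :=
  if k is Some e then Some (Tagged (fun j => arr (dvtxV a i) j) (dhV a (tagged e) : arr (dvtxV a i) (dvtxV a (tag e))))
  else None.

Lemma star_ix_twist_bij i : bijective (@star_ix_twist i).
Proof.
have inj : injective (@star_ix_twist i).
  move=> [[j h]|] [[j' h']|] //= [] ej.
  have e := dvtxV_inj ej; subst j' => {ej}.
  move=> /eqP; rewrite -tag_eqE /tag_eq eqxx /= tagged_asE => /eqP e.
  by rewrite (bij_inj (@dhV_bij _ a i j) e).
have surj k0 : exists k, star_ix_twist k = k0 :> star_ix (dvtxV a i).
  case: k0 => [[j0 h0]|]; last by exists None.
  have [j ej] : exists j, dvtxV a j = j0 by exists (dvtx a j0); exact: dvtxK.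
  subst j0; have [g _ gK] := @dhV_bij _ a i j.
  by exists (Some (Tagged (fun j => arr i j) (g h0))); rewrite /= gK.
have [g gK] := dep_choice surj.
by exists g => // k; apply: inj; rewrite gK.
Qed.

Lemma epsC_sq i j (h : arr i j) : ((eps h)%:~R ^+ dsgn a) * ((eps h)%:~R ^+ dsgn a) = 1 :> C.
Proof. by rewrite -exprMn -intrM eps_sq expr1n. Qed.

(** The star of i in the twist is the star of $a^{-1}(i)$ reindexed by [star_ix_twist]. The
    remaining signs on edges and [phi] on W form an isomorphism of U_i, absorbed by [lrefl_conj]. *)
Lemma hrefl_twist i c v v' (x : rep v) (y : rep v') :
  hrefl (dvtxV a i) c x y -> hrefl i c (tw x) (tw y).
Proof.
move=> [f [g [gf fg fx fp fq loc]]].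
pose f1 j := f (dvtxV a j); pose g1 j := g (dvtxV a j).
have ne j : j != i -> dvtxV a j != dvtxV a i by apply: contra_neq => /dvtxV_inj.
exists f1, g1; split.
- by move=> j ji; apply: gf; exact: ne.
- by move=> j ji; apply: fg; exact: ne.
- by move=> j k h ji ki; rewrite /= -scalemxAr -scalemxAl fx // ne.
- by move=> j ji; rewrite /= mulmxA fp // ne.
- by move=> j ji; rewrite /= fq ?ne // mulmxA.
have L := lrefl_reindex (star_ix_twist_bij i) loc.
pose D u (k : star_ix i) : 'M[C]_(sdim w (atwist a u) k, sdim w u (star_ix_twist k)) :=
  match k with Some e => ((eps (tagged e))%:~R ^+ dsgn a)%:M | None => phiV i end.
pose E u (k : star_ix i) : 'M[C]_(sdim w u (star_ix_twist k), sdim w (atwist a u) k) :=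
  match k with Some e => ((eps (tagged e))%:~R ^+ dsgn a)%:M | None => phi i end.
have ED u k : E u k *m D u k = 1%:M.
  by case: k => [e|] /=; [rewrite -scalar_mxM epsC_sq | exact: hphi].
have DE u k : D u k *m E u k = 1%:M.
  by case: k => [e|] /=; [rewrite -scalar_mxM epsC_sq | exact: hphiV].
have lAE u (z : rep u) (k : star_ix i) : D u k *m lA z (star_ix_twist k) *m 1%:M = lA (tw z) k.
  by rewrite mulmx1; case: k => [e|] //=; rewrite mul_scalar_mx.
have lBE u (z : rep u) (k : star_ix i) : 1%:M *m lB z (star_ix_twist k) *m E u k = lB (tw z) k.
  rewrite mul1mx; case: k => [[j h]|] //=; rewrite mul_mx_scalar dhV_rv !scalerA; congr (_ *: _).
  have ee := @eps_dhV _ a _ _ h; rewrite eps_rvN.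
  case: (dsgn a) ee => /=; rewrite ?expr1 ?expr0 ?mul1r ?mulN1r ?mulr1 => ->.
    by rewrite opprK.
  by [].
have := lrefl_conj (ED v) (DE v) (ED v') (DE v') (mul1mx 1%:M) (mul1mx 1%:M) (mul1mx 1%:M) (mul1mx 1%:M) L.
apply: lrefl_ext => //.
move=> [e|] /=; last by rewrite mulmx1.
by rewrite mul_scalar_mx mul_mx_scalar scalerA epsC_sq scale1r.
Qed.

Lemma riso_twist v v' (x : rep v) (y : rep v') : riso x y -> riso (tw x) (tw y).
Proof.
move=> [g [g' [h1 h2 hx hp hq]]]; exists (fun j => g (dvtxV a j)), (fun j => g' (dvtxV a j)).
split=> /=.
- by move=> i; exact: h1.
- by move=> i; exact: h2.
- by move=> i j h; rewrite -scalemxAr -scalemxAl hx.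
- by move=> i; rewrite mulmxA hp.
- by move=> i; rewrite hq mulmxA.
Qed.

Lemma step_twist i zeta v v' (x : rep v) (y : rep v') :
  step i zeta x y -> step (dvtx a i) (ptwist a zeta) (tw x) (tw y).
Proof.
rewrite -{1}(dvtxK i) => -[[d h]|[d h]].
  by left; split=> //; exact: hrefl_twist.
by right; split=> //; exact: hrefl_twist.
Qed.

Lemma cartan_dvtxV i j : cartan (dvtxV a i) (dvtxV a j) = cartan i j.
Proof.
rewrite /cartan (inj_eq dvtxV_inj); congr (_ - _%:R).
by rewrite -(bij_eq_card (@dhV_bij _ a i j)).
Qed.

Lemma atwist_srefl (A : zmodType) i (u : I -> A) :
  atwist a (srefl i u) = srefl (dvtx a i) (atwist a u).
Proof.
by apply: funext => j; rewrite /atwist /srefl dvtxK -[in RHS]cartan_dvtxV dvtxK.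
Qed.

Lemma atwist_wact (A : zmodType) r (u : I -> A) :
  atwist a (wact r u) = wact (map (dvtx a) r) (atwist a u).
Proof. by elim: r => //= i r IH; rewrite atwist_srefl IH. Qed.

Lemma ptwist_pact r zeta : ptwist a (pact r zeta) = pact (map (dvtx a) r) (ptwist a zeta).
Proof. by rewrite /ptwist /pact /= !atwist_wact. Qed.

Lemma atwist_star1 i v : atwist a w = w ->
  atwist a (star1 w i v) = star1 w (dvtx a i) (atwist a v).
Proof.
move=> hw; apply: funext => j; rewrite /atwist /star1 dvtxK.
have -> : (j == dvtx a i) = (dvtxV a j == i) by rewrite -(inj_eq dvtxV_inj) dvtxK.
case: eqP => // _; congr (_ - _ + _); last by rewrite -[in RHS]hw /atwist dvtxK.
rewrite (reindex_inj dvtxV_inj); apply: eq_bigr => k _.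
by rewrite -[in RHS]cartan_dvtxV dvtxK.
Qed.

Lemma atwist_star r v : atwist a w = w ->
  atwist a (star w r v) = star w (map (dvtx a) r) (atwist a v).
Proof. by move=> hw; elim: r => //= i r IH; rewrite atwist_star1 // IH. Qed.

Lemma wstep_twist r zeta v v' (x : rep v) (y : rep v') :
  wstep r zeta x y -> wstep (map (dvtx a) r) (ptwist a zeta) (tw x) (tw y).
Proof.
elim: r v' y => [|i r IH] v' y /=; first exact: riso_twist.
move=> [u [z [h s]]]; exists (atwist a u), (tw z); split; first exact: IH.
by rewrite -ptwist_pact; exact: step_twist.
Qed.

Lemma word_defined_twist r zeta :
  word_defined (map (dvtx a) r) (ptwist a zeta) <-> word_defined r zeta.
Proof.
elim: r => //= i r IH; rewrite -!atwist_wact.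
by split=> -[/IH h d]; split=> //; move: d; rewrite /atwist dvtxK.
Qed.

End Twist.

(** * The theorem *)

Section Composition.
Variables (R : realType) (G : dgraph) (w : vtx G -> nat).
Implicit Types (v : vtx G -> int) (zeta : param R G).
Local Notation functor := (@refl_functor R G w).

Lemma wact_cat (A : zmodType) r r' (u : vtx G -> A) : wact (r ++ r') u = wact r (wact r' u).
Proof. by rewrite /wact foldr_cat. Qed.

Lemma weyl_eq_cat (r1 r2 s1 s2 : seq (vtx G)) :
  weyl_eq r1 s1 -> weyl_eq r2 s2 -> weyl_eq (r1 ++ r2) (s1 ++ s2).
Proof. by move=> e1 e2 u; rewrite !wact_cat e1 e2. Qed.

Lemma word_defined_cat r r' zeta : word_defined r' zeta -> word_defined r (pact r' zeta) ->
  word_defined (r ++ r') zeta.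
Proof.
move=> d'; elim: r => //= i r IH [/IH d h]; split=> //.
by move: h; rewrite !wact_cat.
Qed.

Lemma functor_cat x x' zeta v P P' P'' : Stab w zeta v -> quiver_variety zeta v P ->
  functor x zeta P P' -> functor x' (pact x zeta) P' P'' -> functor (x' ++ x) zeta P P''.
Proof.
move=> st [t stt ->] [r er /(refl_wordP _ _ st stt) [v1 [y [sy hy ->]]]] [r' er'].
have [v10 _ _] := sy; have ev := wstep_dim stt v10 hy; subst v1.
rewrite -(weyl_pact _ er).
move=> /(refl_wordP _ _ (Stab_word (wstep_defined hy) st) sy) [v2 [z [sz hz ->]]].
exists (r' ++ r); first exact: weyl_eq_cat.
apply/(refl_wordP _ _ st stt); exists v2, z; rewrite pact_cat; split=> //.
exact: wstep_cat hy hz.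
Qed.

(** Composites are values of the product by concatenating words. Conversely the composite exists,
    and a value of the product is unique, so it is the composite. *)
Lemma functor_catP x x' zeta v P P'' : Stab w zeta v -> refl_defined x zeta ->
  refl_defined x' (pact x zeta) -> quiver_variety zeta v P ->
  functor (x' ++ x) zeta P P'' <->
  exists2 P', functor x zeta P P' & functor x' (pact x zeta) P' P''.
Proof.
move=> st dx dx' MP; split=> [h|[P' h h']]; last exact: (functor_cat st MP h h').
have [P' [h1 MP' _]] := functor_is_map st dx MP.
have [r er d] := dx; have st' := Stab_word d st.
rewrite (weyl_pact _ er) (weyl_star R w _ er) in st'.
have [P3 [h2 _ _]] := functor_is_map st' dx' MP'.
have d2 : refl_defined (x' ++ x) zeta.
  have [r' er' d'] := dx'; exists (r' ++ r); first exact: weyl_eq_cat.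
  by apply: word_defined_cat => //; rewrite (weyl_pact _ er).
have [P4 [_ _ u4]] := functor_is_map st d2 MP.
exists P' => //; rewrite (u4 _ h) -(u4 P3) //; exact: (functor_cat st MP h1 h2).
Qed.

End Composition.

Section Sigma.
Variables (R : realType) (G : dgraph) (w : vtx G -> nat).
Local Notation C := (R[i]).
Local Notation I := (vtx G).
Local Notation rep := (rep R w).
Variables (a : diag_aut G) (omega : seq I) (B : forall i : I, 'M[C]_(w i)).
Variables (phi : forall i : I, 'M[C]_(w (dvtxV a i), w i))
  (phiV : forall i : I, 'M[C]_(w i, w (dvtxV a i))).
Hypothesis hB : forall i, B i \in unitmx.
Hypothesis hphi : forall i, phi i *m phiV i = 1%:M.
Hypothesis hphiV : forall i, phiV i *m phi i = 1%:M.
Implicit Types (v : I -> int) (zeta : param R G).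
Local Notation tw := (rep_twist phi phiV).
Local Notation sigma := (sigma omega B phi phiV).

(** Being fixed by $\sigma$ becomes a closed chain of representations: from the transpose of x along
    a word of $\omega$ to some y whose twist is isomorphic to x. *)
Lemma sigma_fixedP zeta v (x : rep v) : Stab w zeta v -> Stab w (popp zeta) v ->
  ptwist a (pact omega (popp zeta)) = zeta -> sslocus zeta x ->
  sigma zeta (cls zeta x) (cls zeta x) <->
  exists r v' (y : rep v'), [/\ weyl_eq r omega, sslocus (pact r (popp zeta)) y,
    wstep r (popp zeta) (tau1 B x) y & riso (tw y) x].
Proof.
move=> st st' hz sx; have sB := sslocus_tau hB; split.
- move=> [Q [Q' [[v1 [x1 [A [uA [s1 e1] ->]]]] [r er hr] [v3 [x3 [s3 e3 e]]]]]].
  have ev := cls_dim e1; subst v1.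
  have e1' : riso x1 x by exact: (cls_eq_riso st (esym e1)).
  have eA : riso (transpose A B x1) (tau1 B x).
    exact: riso_trans (transpose_riso B x1 uA) (tau1_riso B e1').
  have [v0 _ _] := sx; have sx' := sB _ _ _ sx.
  have sA := riso_sslocus v0 (riso_sym eA) sx'.
  rewrite (cls_riso sA sx' eA) in hr.
  move: hr => /(refl_wordP _ _ st' sx') [v2 [y [sy hy e2]]].
  have [v20 _ _] := sy; have ev := wstep_dim sx' v20 hy; subst v2.
  have ey : riso x3 y.
    by apply: cls_eq_riso (Stab_word (wstep_defined hy) st') (etrans (esym e3) e2).
  exists r, v3, x3; split=> //; first by rewrite (weyl_pact _ er).
    exact: wstep_riso (riso_refl _) (riso_sym ey) hy.
  by rewrite hz in e; apply: cls_eq_riso st (esym e).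
- move=> [r [v' [y [er sy hy ey]]]].
  exists (cls (popp zeta) (tau1 B x)), (cls (pact r (popp zeta)) y); split.
  + by exists v, x, (fun=> 1%:M); split=> // i; exact: unitmx1.
  + by exists r => //; apply/(refl_wordP _ _ st' (sB _ _ _ sx)); exists v', y.
  + exists v', y; rewrite -(weyl_pact _ er); split=> //.
    rewrite (weyl_pact _ er) hz; have [v0 _ _] := sy.
    have sty : sslocus zeta (tw y).
      by apply: riso_sslocus (riso_sym ey) sx => i; exact: v0.
    by apply: cls_riso => //; exact: riso_sym.
Qed.

Lemma sigma_fixed_word zeta v v' rx (x : rep v) (y : rep v') : Stab w zeta v -> Stab w (popp zeta) v ->
  ptwist a (pact omega (popp zeta)) = zeta ->
  in_weyl_omega_a a omega rx ->
  sslocus zeta x -> sslocus (pact rx zeta) y -> wstep rx zeta x y ->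
  sigma zeta (cls zeta x) (cls zeta x) ->
  ptwist a (pact omega (popp (pact rx zeta))) = pact rx zeta ->
  sigma (pact rx zeta) (cls (pact rx zeta) y) (cls (pact rx zeta) y).
Proof.
move=> st st' hz [com arx] sx sy hy /(sigma_fixedP st st' hz sx) [r [v2 [x2 [er s2 h2 e2]]]] hz'.
have dx := wstep_defined hy.
have [v'0 _ _] := sy; have ev := wstep_dim sx v'0 hy; subst v'.
apply/(sigma_fixedP (Stab_word dx st) _ hz' sy).
  by rewrite popp_pact; apply: Stab_word => //; exact: word_defined_popp.
(* The word of $a^{-1}(x)$, chosen so that twisting a chain along it gives a chain along [rx]. *)
pose rx' := map (dvtxV a) rx.
have erx : map (dvtx a) rx' = rx by rewrite -map_comp -[RHS]map_id; apply: eq_map => i; exact: dvtxVK.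
have hzr : ptwist a (pact r (popp zeta)) = zeta by rewrite (weyl_pact _ er).
have d' : word_defined rx' (pact r (popp zeta)).
  by apply/(word_defined_twist a); rewrite erx hzr.
have [y2 [sy2 hy2]] := wstep_sslocus s2 d'.
have := wstep_twist hphi hphiV hy2; rewrite erx hzr => ht.
(* The twisted chain starts at x up to isomorphism and follows [rx], hence ends at y; this closes
   the chain for y. *)
have e := wstep_unique (wstep_riso e2 (riso_refl _) ht) hy.
have erx' : weyl_eq rx' rx.
  move=> u; have inj : injective (@atwist G a int).
    move=> u1 u2 h; apply: funext => i; have := congr1 (fun f => f (dvtx a i)) h.
    by rewrite /atwist dvtxK.
  by apply: inj; rewrite !atwist_wact erx -arx.
have back : wstep (rev rx) (popp (pact rx zeta)) (tau1 B y) (tau1 B x).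
  exact: wstep_tau hB (wstep_rev hy).
have pback : pact (rev rx) (popp (pact rx zeta)) = popp zeta.
  by rewrite -popp_pact pact_revK.
exists (rx' ++ (r ++ rev rx)), _, y2; split=> //.
- move=> u; rewrite !wact_cat erx' er.
  by have := com (wact (rev rx) u); rewrite !wact_cat wact_revK.
- by rewrite !pact_cat pback.
- apply: wstep_cat (wstep_cat back _) _; first by rewrite pback; exact: h2.
  by rewrite pact_cat pback.
Qed.

End Sigma.

(** S_i is undefined where $\xi_i$ and $\zeta_{\mathbb C}^{(i)}$ both vanish, hence [refl_defined].
    Parameter and dimension vector move, so the action lives on the family of all these varieties
    and is expressed by unit and composition; the first two clauses say that the conditions tying
    them to $\omega$ and a persist at the target. *)
Theorem proposition4p3p1 (R : realType) (G : dgraph) (a : diag_aut G)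
    (w : vtx G -> nat) (v : vtx G -> int) (zeta : param R G)
    (omega : seq (vtx G))
    (B : forall i : vtx G, 'M[R[i]]_(w i))
    (phi : forall i : vtx G, 'M[R[i]]_(w (dvtxV a i), w i))
    (phiV : forall i : vtx G, 'M[R[i]]_(w i, w (dvtxV a i)))
    (hB : forall i, B i \in unitmx)
    (hphi : forall i, phi i *m phiV i = 1%:M)
    (hphiV : forall i, phiV i *m phi i = 1%:M)
    (hv : forall i, 0 <= v i)
    (hgen : generic zeta v)
    (hzeta : popp (ptwist a (pact omega zeta)) = zeta)
    (hw : atwist a w = w)
    (hav : atwist a (star w omega v) = v) :
  let S := @refl_functor R G w in
  let M := @quiver_variety R G w in
  let SM := sigma_quiver_variety omega B phi phiV in
  (forall x : seq (vtx G),
     in_weyl_omega_a a omega x -> refl_defined x zeta ->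
     [/\ popp (ptwist a (pact omega (pact x zeta))) = pact x zeta,
         atwist a (star w omega (star w x v)) = star w x v,
         is_map (S x zeta) (M zeta v) (M (pact x zeta) (star w x v))
       & is_map (S x zeta) (SM zeta v) (SM (pact x zeta) (star w x v))]) /\
  (forall P, SM zeta v P -> S [::] zeta P P) /\
  (forall x x' : seq (vtx G),
     in_weyl_omega_a a omega x -> in_weyl_omega_a a omega x' ->
     refl_defined x zeta -> refl_defined x' (pact x zeta) ->
     forall P P'', SM zeta v P ->
       (S (x' ++ x) zeta P P'' <->
        exists2 P', S x zeta P P' & S x' (pact x zeta) P' P'')).
Proof.
move=> S M SM.
have st : Stab w zeta v := generic_Stab hgen.
have st' : Stab w (popp zeta) v := generic_Stab (generic_popp hgen).
have hz : ptwist a (pact omega (popp zeta)) = zeta by rewrite -popp_pact.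
have hzx x : in_weyl_omega_a a omega x ->
    popp (ptwist a (pact omega (pact x zeta))) = pact x zeta.
  (* Since x commutes with $\omega$ and is fixed by a, it commutes with $-a\omega$, which fixes
     $\zeta$. *)
  move=> [com ax]; rewrite -pact_cat -(weyl_pact _ com) pact_cat ptwist_pact popp_pact.
  by rewrite hzeta (weyl_pact _ ax).
split.
- move=> x hx dx; have [com ax] := hx.
  have mapM := functor_is_map st dx.
  split=> //; first exact: hzx.
    have -> : star w omega (star w x v) = star w x (star w omega v).
      by have := weyl_star R w v com; rewrite /star !foldr_cat.
    by rewrite atwist_star // hav (weyl_star R w v ax).
  move=> P [MP fixP]; have [P' [h MP' u]] := mapM P MP.
  exists P'; split=> //; split=> //.
  have [r er d] := dx; have [t ht eP] := MP; subst P.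
  have [y [sy hy]] := wstep_sslocus ht d.
  have eP' : P' = cls (pact r zeta) y.
    by symmetry; apply: u; exists r => //; apply/(refl_wordP _ _ st ht); exists _, y.
  (* The functor is computed along the word r, so the two conditions on x are first carried over to
     r. *)
  have hr : in_weyl_omega_a a omega r.
    split; first by move=> q; have := com q; rewrite !wact_cat !er.
    move=> q; rewrite er -ax.
    have := er (fun i => q (dvtx a i)) => /(congr1 (atwist a (A := int))).
    rewrite !atwist_wact; have -> // : atwist a (fun i => q (dvtx a i)) = q.
    by apply: funext => i; rewrite /atwist dvtxVK.
  rewrite eP' -(weyl_pact _ er); apply: sigma_fixed_word hy fixP _ => //.
  by rewrite -popp_pact; exact: hzx.
- split=> [P _|x x' _ _ dx dx' P P'' [MP _]]; first by exists [::].
  exact: functor_catP st dx dx' MP.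
Qed.
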